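(* (i) The spectrum of $\mathcal{A}$ is real and discrete, and $$\sigma(\mathcal{A})=\sigma(A_a)\cup\sigma(B)\cup\sigma(A_b).$$ (ii) If $\lambda$ belongs to only one of the sets $\sigma(A_a)$, $\sigma(B)$ or $\sigma(A_b)$, then $\lambda$ is a simple eigenvalue of $\mathcal{A}$. (iii) If $\lambda\in\sigma(A_a)\cap\sigma(A_b)$, but $\lambda$ is not an eigenvalue of $B$, then $\lambda$ is a double eigenvalue of $\mathcal{A}$ and $X_\lambda=\ker(\mathcal{A}-\lambda)$. (iv) If $\lambda$ belongs to $\sigma(A_a)\cap\sigma(B)$ (resp. $\sigma(A_b)\cap\sigma(B)$), but $\lambda$ is not an eigenvalue of $A_b$ (resp. $A_a$), then $\lambda$ is a double eigenvalue of $\mathcal{A}$. If $\lambda\in\sigma(A_a)\cap\sigma(A_b)\cap\sigma(B)$, then $\lambda$ is an eigenvalue of $\mathcal{A}$ with multiplicity $3$. In both cases $X_\lambda=\ker(\mathcal{A}-\lambda)^2$, but $X_\lambda\neq\ker(\mathcal{A}-\lambda)$.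
   Context: Let $\mathcal{I}=(a,b)$ be a finite interval with $a<0<b$, $\mathcal{I}_a=(a,0)$, $\mathcal{I}_b=(0,b)$, $\mathcal{J}=(-1,1)$. Let $\alpha,\beta\in\mathbb{R}$, let $q,r\in L^\infty(\mathcal{I})$ and $h\in L^\infty(\mathcal{J})$ be real-valued, with $r$ and $h$ uniformly positive (bounded below by positive constants). For a positive weight $\rho$ on an interval $I$, $L_2(\rho,I)$ is the weighted (complex) Lebesgue space with norm $(\int_I\rho|f|^2\,dx)^{1/2}$. $W_2^2(I)$ is the Sobolev space of functions in $L_2(I)$ with derivatives up to order $2$ in $L_2(I)$. Put $\ell_a\phi=\phi(a)\cos\alpha+\phi'(a)\sin\alpha$, $\ell_b\phi=\phi(b)\cos\beta+\phi'(b)\sin\beta$, and $\tau(\phi)=-\phi''+q\phi$. Let $\mathcal{L}=L_2(r,\mathcal{I}_a)\times L_2(h,\mathcal{J})\times L_2(r,\mathcal{I}_b)$ (product Hilbert space). Operators: $\mathring{A}_a\phi=r^{-1}\tau(\phi)$ in $L_2(r,\mathcal{I}_a)$ with domain $D(\mathring{A}_a)=\{\phi\in W_2^2(\mathcal{I}_a):\ell_a\phi=0\}$; $\mathring{A}_b\phi=r^{-1}\tau(\phi)$ in $L_2(r,\mathcal{I}_b)$ with domain $D(\mathring{A}_b)=\{\phi\in W_2^2(\mathcal{I}_b):\ell_b\phi=0\}$; $A_a$ is the restriction of $\mathring{A}_a$ to $\{\phi\in D(\mathring{A}_a):\phi(0)=0\}$; $A_b$ is the restriction of $\mathring{A}_b$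 to $\{\phi\in D(\mathring{A}_b):\phi(0)=0\}$; $B\psi=-h^{-1}\psi''$ in $L_2(h,\mathcal{J})$ with domain $D(B)=\{\psi\in W_2^2(\mathcal{J}):\psi'(-1)=0,\ \psi'(1)=0\}$. $\mathcal{A}$ is the operator $\mathrm{diag}(\mathring{A}_a,B,\mathring{A}_b)$ in $\mathcal{L}$ with domain $$D(\mathcal{A})=\{(\phi_a,\psi,\phi_b)\in D(\mathring{A}_a)\times D(B)\times D(\mathring{A}_b):\ \phi_a(0)=\psi(-1),\ \phi_b(0)=\psi(1)\}.$$ The root subspace of $\mathcal{A}$ for an eigenvalue $\lambda$ is $X_\lambda=\mathrm{span}\{\ker(\mathcal{A}-\lambda)^k: k\in\mathbb{N}\}$. Multiplicity of an eigenvalue $\lambda$ of $\mathcal{A}$ means algebraic multiplicity, $\dim X_\lambda$; ''simple'' and ''double'' mean multiplicity $1$ and $2$ respectively. $\sigma(\cdot)$ denotes the spectrum. *)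

(* Defs.v *)
From HB Require Import structures.
From mathcomp Require Import all_boot all_order all_algebra.
From mathcomp Require Import complex.
From mathcomp Require Import ring lra.
From mathcomp Require Import all_classical all_reals all_analysis.
From mathcomp Require Import measure measurable_realfun lebesgue_integral.

Set Implicit Arguments.
Unset Strict Implicit.
Unset Printing Implicit Defensive.

Import Order.TTheory GRing.Theory Num.Theory numFieldNormedType.Exports.

Local Open Scope classical_set_scope.
Local Open Scope ring_scope.
Local Open Scope complex_scope.

Section L2space.
Context {R : realType}.
Implicit Types (l r : R) (rho : R -> R) (f g : R -> R[i]).
Local Notation mu := (@lebesgue_measure R).

(* |z|^2 *)
Definition abs2 (z : R[i]) : R := complex.Re z ^+ 2 + complex.Im z ^+ 2.

Definition measurable_funC (D : set R) f :=
  measurable_fun D (fun x => complex.Re (f x)) /\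
  measurable_fun D (fun x => complex.Im (f x)).

(* Representatives of elements of L_2(rho, ]l, r[).  Lebesgue integrability of
   rho |f|^2 makes this a vector space for every rho, so that no hypothesis on
   the weight is needed to form the spaces below; the measure is on the Borel
   sets, but equality is modulo sets negligible for it, so every class of
   Lebesgue measurable functions is accounted for. *)
Definition sqint rho l r : {pred R -> R[i]} := mem [set f |
  measurable_funC `]l, r[ f /\
  mu.-integrable `]l, r[ (fun x => (rho x * abs2 (f x))%:E)].

Definition ae_eqC l r f g :=
  {ae mu, forall x, `]l, r[%classic x -> f x = g x}.


Lemma abs2_ge0 z : 0 <= abs2 z.
Proof. by rewrite addr_ge0 ?sqr_ge0. Qed.

Lemma abs2D_ge0 z w : 0 <= abs2 z + abs2 w.
Proof. by rewrite addr_ge0 ?abs2_ge0. Qed.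

Lemma abs2_0 : abs2 0 = 0.
Proof. by rewrite /abs2 /= expr0n addr0. Qed.

Lemma abs2_eq0 z : abs2 z = 0 -> z = 0.
Proof.
case: z => x y /eqP; rewrite /abs2 /= paddr_eq0 ?sqr_ge0//.
by rewrite !sqrf_eq0 => /andP[/eqP-> /eqP->].
Qed.

Lemma abs2M z w : abs2 (z * w) = abs2 z * abs2 w.
Proof. by case: z w => x y [x' y']; rewrite /abs2 /=; ring. Qed.

Lemma abs2D_le z w : abs2 (z + w) <= 2 * (abs2 z + abs2 w).
Proof.
case: z w => x y [x' y']; rewrite /abs2 /=.
by have := sqr_ge0 (x - x'); have := sqr_ge0 (y - y'); nra.
Qed.

Lemma measurable_abs2 (D : set R) f :
  measurable_funC D f -> measurable_fun D (fun x => abs2 (f x)).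
Proof. by case=> mr mi; apply: measurable_funD; exact: measurable_funX. Qed.

Lemma measurable_funCD (D : set R) f g : measurable_funC D f ->
  measurable_funC D g -> measurable_funC D (f + g).
Proof.
move=> [fr fi] [gr gi]; split.
- rewrite (_ : (fun x => _) = (fun x => complex.Re (f x) + complex.Re (g x))).
    exact: measurable_funD.
  by apply/funext => x /=; rewrite raddfD.
- rewrite (_ : (fun x => _) = (fun x => complex.Im (f x) + complex.Im (g x))).
    exact: measurable_funD.
  by apply/funext => x /=; rewrite raddfD.
Qed.

Lemma measurable_funCZ (D : set R) (c : R[i]) f :
  measurable_funC D f -> measurable_funC D (fun x => c * f x).
Proof.
case: c => p q [fr fi]; split.
- rewrite (_ : (fun x => _) =
      (fun x => p * complex.Re (f x) - q * complex.Im (f x))).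
    by apply: measurable_funB; exact: measurable_funM.
  by apply/funext => x /=; case: (f x).
- rewrite (_ : (fun x => _) =
      (fun x => p * complex.Im (f x) + q * complex.Re (f x))).
    by apply: measurable_funD; exact: measurable_funM.
  by apply/funext => x /=; case: (f x).
Qed.

Lemma sqintZ rho l r (c : R[i]) f :
  f \in sqint rho l r -> (fun x => c * f x) \in sqint rho l r.
Proof.
rewrite !inE/= => -[mf intf]; split; first exact: measurable_funCZ.
rewrite (_ : (fun x => _) =
    (fun x => ((abs2 c)%:E * (rho x * abs2 (f x))%:E)%E)).
  exact: integrableZl.
by apply/funext => x; rewrite abs2M -EFinM mulrCA.
Qed.

Lemma sqintD rho l r f g :
  f \in sqint rho l r -> g \in sqint rho l r -> f + g \in sqint rho l r.
Proof.
rewrite !inE/= => -[mf intf] [mg intg].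
have mfg := measurable_funCD mf mg; split=> //.
pose k x := abs2 (f x + g x) / (abs2 (f x) + abs2 (g x)).
rewrite (_ : (fun x => _) = ((EFin \o k) \*
    ((fun x => (rho x * abs2 (f x))%:E) \+
     (fun x => (rho x * abs2 (g x))%:E)))%E); last first.
  apply/funext => x /=; rewrite -EFinD -EFinM -mulrDr /k mulrCA.
  have [s0|s0] := eqVneq (abs2 (f x) + abs2 (g x)) 0; last by rewrite divfK.
  move/eqP: (s0); rewrite paddr_eq0 ?abs2_ge0// => /andP[/eqP/abs2_eq0 fx0].
  move=> /eqP/abs2_eq0 gx0.
  rewrite (_ : (f + g) x = f x + g x)// fx0 gx0 addr0.
  by rewrite abs2_0 !(mul0r, mulr0).
apply: (@integrableMr _ _ _ mu `]l, r[%classic _ k) => //.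
- apply: measurable_funM; first exact: measurable_abs2.
  rewrite (_ : (fun x => _) =
      (fun x => (abs2 (f x) + abs2 (g x)) `^ (-1))).
    apply: (measurableT_comp (measurable_powR _)) => //.
    by apply: measurable_funD; exact: measurable_abs2.
  by apply/funext => x; rewrite powR_inv1// abs2D_ge0.
- exists 2; split; first exact: num_real.
  move=> y y2 x _; apply: le_trans (ltW y2).
  rewrite ger0_norm ?divr_ge0 ?abs2D_ge0 ?abs2_ge0//.
  have [s0|s0] := eqVneq (abs2 (f x) + abs2 (g x)) 0.
    by rewrite /k s0 invr0 mulr0.
  by rewrite ler_pdivrMr ?abs2D_le// lt_neqAle eq_sym s0 abs2D_ge0.
- by apply: integrableD => //; exact: measurable_itv.
Qed.

Lemma sqint_zmod_closed rho l r : zmod_closed (sqint rho l r).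
Proof.
split=> [|f g fL gL].
  have -> : 0 = (fun x => 0 * (0 : R -> R[i]) x).
    by apply/funext => x; rewrite mul0r.
  rewrite inE/=; split; first by split; rewrite (_ : (fun x => _) = cst 0)//;
    apply/funext => x; rewrite mul0r.
  rewrite (_ : (fun x => _) = cst 0%E); first exact: integrable0.
  by apply/funext => x; rewrite mul0r abs2_0 mulr0.
have -> : f - g = f + (fun x => -1 * g x).
  by congr (f + _); apply/funext => x; rewrite mulN1r.
by apply: sqintD => //; exact: sqintZ.
Qed.

HB.instance Definition _ rho l r :=
  GRing.isZmodClosed.Build _ (sqint rho l r) (sqint_zmod_closed rho l r).

Definition sqfun rho l r : Type := {f : R -> R[i] | f \in sqint rho l r}.
HB.instance Definition _ rho l r := SubChoice.on (sqfun rho l r).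
HB.instance Definition _ rho l r :=
  [SubChoice_isSubZmodule of sqfun rho l r by <:].

Definition sqfunZ rho l r (c : R[i]) (f : sqfun rho l r) : sqfun rho l r :=
  exist _ (fun x => c * val f x) (sqintZ c (valP f)).

Definition nullfun rho l r : {pred sqfun rho l r} :=
  mem [set f | ae_eqC l r (val f) 0].

Lemma nullfun_zmod_closed rho l r : zmod_closed (@nullfun rho l r).
Proof.
split=> [|f g]; rewrite !inE/=; first exact: aeW.
have F : Filter (nbhs (almost_everywhere mu)).
  exact: ae_filter_ringOfSetsType.
apply: filterS2 => x fx gx xlr.
transitivity (val f x - val g x) => //.
by move: (fx xlr) (gx xlr) => /= -> ->; exact: subrr.
Qed.

HB.instance Definition _ rho l r :=
  GRing.isZmodClosed.Build _ (@nullfun rho l r) (nullfun_zmod_closed rho l r).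

Lemma sqfunZ_null rho l r (c : R[i]) (f : sqfun rho l r) :
  f \in @nullfun rho l r -> sqfunZ c f \in @nullfun rho l r.
Proof.
rewrite !inE/=.
have F : Filter (nbhs (almost_everywhere mu)).
  exact: ae_filter_ringOfSetsType.
by apply: filterS => x fx xlr; move: (fx xlr) => /= ->; exact: mulr0.
Qed.

(* The complex space L_2(rho, ]l, r[), modulo equality almost everywhere with
   respect to Lebesgue measure (the same null sets as rho dx when rho > 0). *)
Definition L2 rho l r : Type := Quotient.quot (@nullfun rho l r).
HB.instance Definition _ rho l r := GRing.Zmodule.on (L2 rho l r).
HB.instance Definition _ rho l r := EqQuotient.on (L2 rho l r).

Local Open Scope quotient_scope.

Definition L2scale rho l r (c : R[i]) (u : L2 rho l r) : L2 rho l r :=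
  \pi_(L2 rho l r) (sqfunZ c (repr u)).

Lemma L2scale_pi rho l r c (f : sqfun rho l r) :
  L2scale c (\pi_(L2 rho l r) f) = \pi_(L2 rho l r) (sqfunZ c f).
Proof.
apply/eqP; rewrite -[_ == _]Quotient.idealrBE.
have -> : sqfunZ c (repr (\pi_(L2 rho l r) f)) - sqfunZ c f =
    sqfunZ c (repr (\pi_(L2 rho l r) f) - f).
  by apply/val_inj/funext => x /=; rewrite mulrBr.
by apply: sqfunZ_null; rewrite Quotient.idealrBE reprK.
Qed.

Lemma L2_piD rho l r (f g : sqfun rho l r) :
  \pi_(L2 rho l r) (f + g) = \pi_(L2 rho l r) f + \pi_(L2 rho l r) g.
Proof. exact: (@Quotient.pi_add _ (@nullfun rho l r)). Qed.

Lemma L2scaleA rho l r c d (u : L2 rho l r) :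
  L2scale c (L2scale d u) = L2scale (c * d) u.
Proof.
elim/quotW: u => f; rewrite (L2scale_pi d) !L2scale_pi.
congr (\pi_(L2 rho l r) _).
by apply/val_inj/funext => x /=; rewrite mulrA.
Qed.

Lemma L2scale1 rho l r : left_id 1 (@L2scale rho l r).
Proof.
elim/quotW=> f; rewrite L2scale_pi; congr (\pi_(L2 rho l r) _).
by apply/val_inj/funext => x /=; rewrite mul1r.
Qed.

Lemma L2scaleDr rho l r : right_distributive (@L2scale rho l r) +%R.
Proof.
move=> c; elim/quotW=> f; elim/quotW=> g; rewrite -L2_piD !L2scale_pi -L2_piD.
congr (\pi_(L2 rho l r) _).
by apply/val_inj/funext => x /=; exact: mulrDr.
Qed.

Lemma L2scaleDl rho l r (u : L2 rho l r) :
  {morph (@L2scale rho l r)^~ u : c d / c + d}.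
Proof.
move=> c d /=; elim/quotW: u => f; rewrite !L2scale_pi -L2_piD.
congr (\pi_(L2 rho l r) _).
by apply/val_inj/funext => x /=; exact: mulrDl.
Qed.

HB.instance Definition _ rho l r := GRing.Zmodule_isLmodule.Build R[i]
  (L2 rho l r) (@L2scaleA rho l r) (@L2scale1 rho l r) (@L2scaleDr rho l r)
  (@L2scaleDl rho l r).

Definition L2repr rho l r (u : L2 rho l r) : R -> R[i] := val (repr u).

Definition L2norm rho l r (u : L2 rho l r) : R :=
  Num.sqrt (\int[mu]_(x in `]l, r[) (rho x * abs2 (L2repr u x)))%R.

End L2space.

Section Operators.
Context {R : realType} {H : lmodType R[i]}.
Implicit Types (A T : H -> H -> Prop) (lam : R[i]) (S : set H).

(* An operator is given by its graph: [A u v] means that u is in the domain of A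
   and A u = v.  [op_sub A lam] is then A - lam. *)
Definition op_sub A lam : H -> H -> Prop := fun u v => A u (v + lam *: u).

Fixpoint op_pow T (k : nat) : H -> H -> Prop :=
  if k is k'.+1 then fun u v => exists w, T u w /\ op_pow T k' w v
  else fun u v => u = v.

Definition op_ker T : set H := [set u | T u 0].

Definition is_eigenvalue A lam := exists u, u != 0 /\ A u (lam *: u).

(* The complement of the set of those lam for which A - lam is a bijection from
   the domain of A onto the whole space with a bounded inverse. *)
Definition spectrum (nrm : H -> R) A : set R[i] := ~` [set lam |
  (forall v, exists! u, op_sub A lam u v) /\
  (exists M : R, forall u v, op_sub A lam u v -> nrm u <= M * nrm v)].

Definition lspan S : set H := [set v | exists n (c : 'I_n -> R[i]) e,
  (forall i, S (e i)) /\ v = \sum_(i < n) c i *: e i].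

Definition has_dim S (n : nat) := exists e : 'I_n -> H,
  (forall c : 'I_n -> R[i], \sum_(i < n) c i *: e i = 0 -> forall i, c i = 0) /\
  S = lspan (range e).

Definition root_subspace A lam : set H :=
  lspan (\bigcup_k op_ker (op_pow (op_sub A lam) k)).

Definition eigenvalue_of_mult A lam n :=
  is_eigenvalue A lam /\ has_dim (root_subspace A lam) n.

Definition real_spectrum (nrm : H -> R) A :=
  forall lam, spectrum nrm A lam -> complex.Im lam = 0.

(* Isolated eigenvalues of finite algebraic multiplicity, without accumulation
   point in the complex plane. *)
Definition discrete_spectrum (nrm : H -> R) A :=
  (forall lam, spectrum nrm A lam -> exists n, eigenvalue_of_mult A lam n) /\
  (forall z : R[i], exists2 eps : R, 0 < eps &
     forall lam, spectrum nrm A lam -> lam != z -> eps%:C <= `|lam - z|).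

End Operators.

Section SturmLiouville.
Context {R : realType}.
Implicit Types (l r : R) (rho q h theta : R -> R) (f : R -> R[i]).
Local Notation mu := (@lebesgue_measure R).

Definition Linfty l r q := measurable_fun `]l, r[ q /\
  exists M : R, {ae mu, forall x, `]l, r[%classic x -> `|q x| <= M}.

Definition uniformly_positive l r q := exists2 c : R, 0 < c &
  {ae mu, forall x, `]l, r[%classic x -> c <= q x}.

(* Weak derivatives are tested against C^1 functions with compact support in
   the open interval; by mollification this is the same as testing against
   C^oo functions with compact support. *)
Definition test_function l r theta :=
  [/\ forall x, derivable theta x 1, continuous (derive1 theta)
    & exists c d, [/\ l < c, d < r & forall x, x \notin `[c, d] -> theta x = 0]].

Definition weak_deriv_real l r (f g : R -> R) := forall theta,
  test_function l r theta ->
  \int[mu]_(x in `]l, r[) (f x * derive1 theta x) =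
  - \int[mu]_(x in `]l, r[) (g x * theta x).

Definition weak_deriv l r f (g : R -> R[i]) :=
  weak_deriv_real l r (fun x => complex.Re (f x)) (fun x => complex.Re (g x)) /\
  weak_deriv_real l r (fun x => complex.Im (f x)) (fun x => complex.Im (g x)).

(* f is in W_2^2(]l, r[), with f' = f1 and f'' = f2. *)
Definition sobolev2 l r f (f1 f2 : R -> R[i]) :=
  [/\ f \in sqint (cst 1) l r, f1 \in sqint (cst 1) l r,
      f2 \in sqint (cst 1) l r, weak_deriv l r f f1 & weak_deriv l r f1 f2].

(* The value at a point x of [l, r], end points included, of the continuous
   representative on [l, r] of the class of f. *)
Definition bval l r f (x : R) : R[i] := xget 0 [set z | exists g : R -> R[i],
  [/\ {within `[l, r], continuous (fun t => complex.Re (g t))},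
      {within `[l, r], continuous (fun t => complex.Im (g t))},
      ae_eqC l r g f & g x = z]].

Definition represents rho l r (u : L2 rho l r) f := ae_eqC l r (L2repr u) f.

Definition tau q f (f2 : R -> R[i]) : R -> R[i] :=
  fun x => - f2 x + (q x)%:C * f x.

(* u |-> rho^-1 (- u'' + q u), on the elements of W_2^2(]l, r[) satisfying the
   boundary conditions bc, which relate u and u'. *)
Definition sl_op rho q l r (bc : (R -> R[i]) -> (R -> R[i]) -> Prop)
    (u v : L2 rho l r) := exists f f1 f2,
  [/\ sobolev2 l r f f1 f2, bc f f1, represents u f &
      represents v (fun x => ((rho x)^-1)%:C * tau q f f2 x)].

Definition ell l r gamma (x : R) f (f1 : R -> R[i]) : R[i] :=
  bval l r f x * (cos gamma)%:C + bval l r f1 x * (sin gamma)%:C.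

Context (a b alpha beta : R) (q r h : R -> R).

Definition op_Aring_a : L2 r a 0 -> L2 r a 0 -> Prop :=
  sl_op q (fun f f1 => ell a 0 alpha a f f1 = 0).

Definition op_Aring_b : L2 r 0 b -> L2 r 0 b -> Prop :=
  sl_op q (fun f f1 => ell 0 b beta b f f1 = 0).

Definition op_A_a (u v : L2 r a 0) : Prop :=
  op_Aring_a u v /\ bval a 0 (L2repr u) 0 = 0.

Definition op_A_b (u v : L2 r 0 b) : Prop :=
  op_Aring_b u v /\ bval 0 b (L2repr u) 0 = 0.

Definition op_B : L2 h (-1) 1 -> L2 h (-1) 1 -> Prop :=
  sl_op (cst 0) (fun f f1 =>
    bval (-1) 1 f1 (-1) = 0 /\ bval (-1) 1 f1 1 = 0).

Definition L2prod : lmodType R[i] := (L2 r a 0 * L2 h (-1) 1 * L2 r 0 b)%type.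

Definition L2prod_norm (U : L2prod) : R := Num.sqrt
  (L2norm U.1.1 ^+ 2 + L2norm U.1.2 ^+ 2 + L2norm U.2 ^+ 2).

Definition op_calA (U V : L2prod) : Prop :=
  [/\ op_Aring_a U.1.1 V.1.1, op_B U.1.2 V.1.2, op_Aring_b U.2 V.2,
      bval a 0 (L2repr U.1.1) 0 = bval (-1) 1 (L2repr U.1.2) (-1) &
      bval 0 b (L2repr U.2) 0 = bval (-1) 1 (L2repr U.1.2) 1].

End SturmLiouville.

Arguments L2norm {R} rho l r u.
Arguments op_A_a {R} a alpha q r u v.
Arguments op_A_b {R} b beta q r u v.
Arguments op_B {R} h _ _.
Arguments op_calA {R} a b alpha beta q r h U V.
Arguments L2prod_norm {R} a b r h U.

(* Main.v *)
(* On each interval, solving the initial value problem gives a solution theta of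
   the homogeneous equation satisfying the boundary condition at one end point,
   and lam is an eigenvalue of the part exactly when the relevant boundary value d
   of theta at the other end point vanishes; when d <> 0, the part has a bounded
   resolvent, with prescribed inhomogeneous boundary value.  Green's formula makes
   eigenvalues real and eigenfunctions theta_lam, theta_z of distinct eigenvalues
   orthogonal.  When both are normalized by the same Cauchy data, their difference
   w solves (T - z) w = (lam - z) theta_lam with zero data, so its norm is
   O(|lam - z|) times that of theta_lam, while by orthogonality it is at least that
   of theta_lam: this isolates eigenvalues.

   The matching conditions are triangular: the middle component of an element of
   the domain acts as a boundary value for the outer ones, but not conversely.
   When d = 0, Green's formula shows that there is no solution of the homogeneous
   equation with nonzero boundary value, but that there is one modulo theta, i.e.
   a Jordan chain of length two.  So the root subspace is spanned by the outer
   eigenfunctions and by the extension of the middle one to the outer intervals,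
   which is an eigenvector if and only if neither outer part has the eigenvalue.

   Analytically, W_2^2 is identified with the functions whose derivative is the
   primitive of a square integrable function, by the lemma of du Bois-Reymond. *)

Require Import Defs.
From mathcomp Require Import all_boot all_order all_algebra.
From mathcomp Require Import complex.
From mathcomp Require Import ring lra.
From mathcomp Require Import all_classical all_reals all_analysis.
From mathcomp Require Import measurable_realfun.

Set Implicit Arguments.
Unset Strict Implicit.
Unset Printing Implicit Defensive.

Import Order.TTheory GRing.Theory Num.Theory numFieldNormedType.Exports.

Local Open Scope classical_set_scope.
Local Open Scope ring_scope.
Local Open Scope complex_scope.

(** * Absolutely continuous functions and weak derivatives *)

(** The coefficients are only bounded and measurable, so a second derivative is known only almost
    everywhere. Initial value problems are therefore solved as Volterra integral equations, for real
    first-order systems made of real and imaginary parts. The spectral argument uses neither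
    compactness nor a spectral theorem. It is carried out on abstract relations between elements and
    boundary values: solvability with an explicit bound, uniqueness, Green's formula and conjugation
    are all it knows of the differential operator. One argument then serves the Dirichlet condition
    of the outer parts and the Neumann condition of the middle one, and the right interval is
    treated like the left one after an exchange of end points. A boundary value is an argument of
    the relation rather than a condition imposed on the domain, because the coupling has to feed
    values of the middle component into the outer ones. Estimates are kept in squared norms, so that
    constants compose polynomially and a square root appears only in the final statements. *)

Section RealIntegral.
Context {R : realType}.
Local Notation mu := (@lebesgue_measure R).
Implicit Types (f g : R -> R) (l r : R).

Lemma integrable_bounded_mul (D : set R) f g (M : R) : measurable D ->
  measurable_fun D f -> (forall x, D x -> `|f x| <= M) ->
  mu.-integrable D (EFin \o g) ->
  mu.-integrable D (EFin \o (fun x => f x * g x)).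
Proof.
move=> mD mf fM ig; apply: (@integrableMr _ _ _ mu _ mD f (EFin \o g)) => //.
exists M; split; first exact: num_real.
by move=> y My x Dx; exact: le_trans (fM _ Dx) (ltW My).
Qed.

Lemma integrable_restrictT (D : set R) f : measurable D ->
  mu.-integrable D (EFin \o f) -> mu.-integrable setT (EFin \o (f \_ D)).
Proof.
move=> mD /(@integrable_mkcond _ _ _ mu D (EFin \o f) mD).1.
rewrite (_ : (EFin \o f) \_ D = EFin \o (f \_ D))//.
by apply/funext => x; rewrite /patch /=; case: ifP.
Qed.

Lemma patch_itvcc f l r x :
  (f \_ `[l, r]) x = if l <= x <= r then f x else 0.
Proof.
rewrite /patch; have [xlr|xlr] := ifPn.
  by move: xlr; rewrite inE /= in_itv /= => ->.
by move: xlr; rewrite notin_setE /= in_itv /= => /negP/negbTE ->.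
Qed.

(** Fubini on the triangle t <= x, written as the integral over the plane of a product cut off by
    the indicator of the triangle. *)
Lemma Rintegral_mulC_itv l r f g :
  mu.-integrable `[l, r] (EFin \o f) -> mu.-integrable `[l, r] (EFin \o g) ->
  \int[mu]_(x in `[l, r]) (g x * \int[mu]_(t in `[l, x]) f t) =
  \int[mu]_(t in `[l, r]) (f t * \int[mu]_(x in `[t, r]) g x).
Proof.
move=> intf intg.
have mD : measurable (`[l, r]%classic : set R) by exact: measurable_itv.
pose F := f \_ `[l, r]; pose G := g \_ `[l, r].
have iF : mu.-integrable setT (EFin \o F).
  exact: integrable_restrictT.
have iG : mu.-integrable setT (EFin \o G).
  exact: integrable_restrictT.
have mF : measurable_fun setT F by apply/measurable_EFinP; exact: measurable_int iF.
have mG : measurable_fun setT G by apply/measurable_EFinP; exact: measurable_int iG.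
pose A : set (R * R) := [set z | z.2 <= z.1].
have mA : measurable A.
  rewrite (_ : A = setT `&` [set z | z.2 <= z.1]); last by rewrite setTI.
  by apply: measurable_fun_le; [exact: measurableT|exact: measurable_snd|exact: measurable_fst].
pose k (z : R * R) := G z.1 * F z.2 * \1_A z.
have mk : measurable_fun setT k.
  apply: measurable_funM; last exact: measurable_indic.
  by apply: measurable_funM; [exact: (measurableT_comp mG measurable_fst)|exact: (measurableT_comp mF measurable_snd)].
have ik : (mu \x mu)%E.-integrable setT (EFin \o k).
  apply/integrable12ltyP; first exact/measurable_EFinP.
  (* The kernel is dominated by |G x| |F y|, whose iterated integral is the product of two finite L1
     norms. *)
  apply: (@le_lt_trans _ _ (\int[mu]_x (`|G x|%:E * \int[mu]_y `|F y|%:E)))%E.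
    apply: ge0_le_integral => //.
    - by move=> x _; apply: integral_ge0.
    - apply: (@measurable_fun_fubini_tonelli_F _ _ _ _ _ mu (abse \o (EFin \o k))) => [|z]; last exact: abse_ge0.
      by apply: measurableT_comp => //; exact/measurable_EFinP.
    - by apply: emeasurable_funM => //; exact/measurable_EFinP/measurableT_comp.
    - move=> x _; rewrite -ge0_integralZl//; last first.
        by apply/measurable_EFinP; exact: measurableT_comp.
      apply: ge0_le_integral => //.
      + apply/measurable_EFinP; apply: measurableT_comp => //.
        exact: (measurableT_comp mk (measurable_pair1 x)).
      + by apply: measurable_funeM; exact/measurable_EFinP/measurableT_comp.
      + move=> y _; rewrite /= -EFinM lee_fin !normrM ler_piMr ?mulr_ge0//.
        by rewrite indicE; case: (_ \in _); rewrite ?normr1 ?normr0.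
  rewrite ge0_integralZr//; last 2 first.
  - by apply/measurable_EFinP; exact: measurableT_comp.
  - exact: integral_ge0.
  by apply: lte_mul_pinfty; rewrite ?integral_ge0 ?ge0_fin_numE ?integral_ge0//;
    [case/integrableP: iG|case/integrableP: iF].
have int_patch D u : measurable D -> mu.-integrable D (EFin \o u) ->
    (\int[mu]_x ((u \_ D) x)%:E)%E = (\int[mu]_(x in D) u x)%:E.
  move=> mD' iu; rewrite Rintegral_mkcond /Rintegral fineK//.
  exact: (integrable_fin_num _ (integrable_restrictT mD' iu)).
have sub1 x y : l <= x -> y <= r -> `[x, y]%classic `<=` `[l, r]%classic.
  by move=> lx yr z /=; rewrite !in_itv/= => /andP[xz zy];
    rewrite (le_trans lx xz) (le_trans zy yr).
have in1 x : (\int[mu]_y (k (x, y))%:E)%E =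
    (G x * \int[mu]_(t in `[l, x]) f t)%:E.
  have [/andP[lx xr]|xlr] := boolP (l <= x <= r); last first.
    have Gx0 : G x = 0 by rewrite /G patch_itvcc (negbTE xlr).
    by rewrite Gx0 mul0r; apply: integral0_eq => y _; rewrite /k /= Gx0 !mul0r.
  have ifx : mu.-integrable `[l, x] (EFin \o f).
    by apply: integrableS intf => //; exact: sub1.
  rewrite EFinM -(int_patch _ _ _ ifx)// -integralZl//; last first.
    exact: integrable_restrictT.
  apply: eq_integral => y _; rewrite -EFinM /k /= -mulrA; congr (_ * _)%:E.
  rewrite /F !patch_itvcc indicE.
  have -> : ((x, y) \in A) = (y <= x) by apply/idP/idP; rewrite inE.
  have [yx|yx] := leP y x; last by rewrite mulr0 andbF.
  by rewrite (le_trans yx xr) andbT mulr1.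
have in2 y : (\int[mu]_x (k (x, y))%:E)%E =
    (F y * \int[mu]_(x in `[y, r]) g x)%:E.
  have [/andP[lx xr]|xlr] := boolP (l <= y <= r); last first.
    have Fx0 : F y = 0 by rewrite /F patch_itvcc (negbTE xlr).
    by rewrite Fx0 mul0r; apply: integral0_eq => x _; rewrite /k /= Fx0 mulr0 mul0r.
  have igx : mu.-integrable `[y, r] (EFin \o g).
    by apply: integrableS intg => //; exact: sub1.
  rewrite EFinM -(int_patch _ _ _ igx)// -integralZl//; last first.
    exact: integrable_restrictT.
  apply: eq_integral => x _; rewrite -EFinM /k /= (mulrC (G x)) -mulrA.
  congr (_ * _)%:E; rewrite /G !patch_itvcc indicE.
  have -> : ((x, y) \in A) = (y <= x) by apply/idP/idP; rewrite inE.
  have [yx|yx] := leP y x; last by rewrite mulr0.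
  by rewrite (le_trans lx yx) mulr1.
have := Fubini ik.
rewrite /comp /=.
under eq_integral do rewrite in1.
under [in X in _ = X -> _]eq_integral do rewrite in2.
move=> FE.
rewrite [LHS]Rintegral_mkcond [RHS]Rintegral_mkcond.
transitivity (fine (\int[mu]_x (G x * \int[mu]_(t in `[l, x]) f t)%:E)%E).
  congr fine; apply: eq_integral => x _; rewrite /G !patch_itvcc.
  by case: ifP; rewrite ?mul0r.
rewrite FE; congr fine; apply: eq_integral => x _; rewrite /F !patch_itvcc.
by case: ifP; rewrite ?mul0r.
Qed.
End RealIntegral.

Section AbsolutelyContinuous.
Context {R : realType}.
Local Notation mu := (@lebesgue_measure R).
Implicit Types (f g F G : R -> R) (l r : R).

Lemma in_itvcc l r x : (`[l, r]%classic x) = (l <= x <= r) :> Prop.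
Proof. by rewrite /= in_itv. Qed.

Lemma integrable_itvS l r x y f : l <= x -> y <= r ->
  mu.-integrable `[l, r] (EFin \o f) -> mu.-integrable `[x, y] (EFin \o f).
Proof.
move=> lx yr; apply: integrableS => // z; rewrite !in_itvcc => /andP[xz zy].
by rewrite (le_trans lx xz) (le_trans zy yr).
Qed.

Lemma Rintegral_itv_split l x r f : l <= x -> x <= r ->
  mu.-integrable `[l, r] (EFin \o f) ->
  \int[mu]_(t in `[l, r]) f t =
  \int[mu]_(t in `[l, x]) f t + \int[mu]_(t in `[x, r]) f t.
Proof.
move=> lx xr intf; apply/eqP; rewrite addrC -subr_eq; apply/eqP.
have := @Rintegral_itvB R f (BLeft l) (BRight r) x intf.
rewrite !bnd_simp => ->//; rewrite Rintegral_itv_obnd_cbnd//.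
apply: integrableS (integrable_itvS lx (lexx r) intf) => //.
by move=> z; rewrite in_itvcc /= in_itv /= => /andP[/ltW-> ->].
Qed.

(** Absolute continuity, encoded as being a primitive. The derivative is carried along as data,
    since F determines it only almost everywhere. *)
Definition is_AC l r F f := mu.-integrable `[l, r] (EFin \o f) /\
  forall x, l <= x <= r -> F x = F l + \int[mu]_(t in `[l, x]) f t.

Lemma is_AC_primitive l r f (c : R) : mu.-integrable `[l, r] (EFin \o f) ->
  is_AC l r (fun x => c + \int[mu]_(t in `[l, x]) f t) f.
Proof.
by split=> // x _; rewrite set_itv1 Rintegral_set1 addr0.
Qed.

Lemma is_AC_continuous l r F f : l <= r -> is_AC l r F f ->
  {within `[l, r], continuous F}.
Proof.
move=> lr [intf Ff].
have := parameterized_integral_continuous lr intf.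
move=> cf; pose P x := parameterized_integral mu l x f.
apply: (@subspace_eq_continuous _ _ _ (fun x => F l + P x)).
  by move=> x; rewrite inE in_itvcc => xlr; exact/esym/Ff.
by move=> x; apply: cvgD; [exact: cvg_cst|exact: cf].
Qed.

Lemma continuous_itv_integrable l r F : {within `[l, r], continuous F} ->
  mu.-integrable `[l, r] (EFin \o F).
Proof.
by move=> cF; apply: continuous_compact_integrable => //; exact: segment_compact.
Qed.

Lemma continuous_itv_measurable l r F : {within `[l, r], continuous F} ->
  measurable_fun `[l, r] F.
Proof. by move=> cF; apply: subspace_continuous_measurable_fun. Qed.

Lemma continuous_itv_bounded l r F : {within `[l, r], continuous F} ->
  exists2 M, 0 <= M & forall x, l <= x <= r -> `|F x| <= M.
Proof.
move=> cF.
have /compact_bounded[M [Mr FM]] := continuous_compact cF (@segment_compact R l r).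
exists (`|M| + 1) => [|x xlr]; first by rewrite addr_ge0.
apply: (FM (`|M| + 1)); first by rewrite (le_lt_trans (ler_norm M))// ltrDl.
by exists x => //; rewrite in_itvcc.
Qed.

Lemma continuous_mul_integrable l r F g : {within `[l, r], continuous F} ->
  mu.-integrable `[l, r] (EFin \o g) ->
  mu.-integrable `[l, r] (EFin \o (fun x => F x * g x)).
Proof.
move=> cF ig; have [M M0 FM] := continuous_itv_bounded cF.
apply: (@integrable_bounded_mul _ _ _ _ M) => //.
exact: continuous_itv_measurable.
Qed.

Lemma is_AC_lin l r F f G g (a : R) : is_AC l r F f -> is_AC l r G g ->
  is_AC l r (fun x => a * F x + G x) (fun x => a * f x + g x).
Proof.
move=> [intf Ff] [intg Gg].
have iaf : mu.-integrable `[l, r] (EFin \o (fun x => a * f x)).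
  exact: (@integrableZl _ _ _ mu _ _ a (EFin \o f)).
split; first exact: (@integrableD _ _ _ mu _ (measurable_itv _) (EFin \o (fun x => a * f x)) (EFin \o g)).
move=> x /andP[lx xr]; rewrite Ff ?lx// Gg ?lx//.
rewrite RintegralD//; [|exact: (integrable_itvS (lexx l) xr)..].
rewrite RintegralZl//; last exact: (integrable_itvS (lexx l) xr).
by ring.
Qed.

(** Integration by parts. Splitting off the constants F l and G l leaves the two primitives;
    exchanging the order of integration turns one of the integrals into one over [t, r], which is
    the total integral minus the primitive at t. *)
Lemma is_AC_mul l r F f G g : l <= r -> is_AC l r F f -> is_AC l r G g ->
  \int[mu]_(x in `[l, r]) (F x * g x) + \int[mu]_(x in `[l, r]) (G x * f x) =
  F r * G r - F l * G l.
Proof.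
move=> lr acF acG; have cF := is_AC_continuous lr acF.
have cG := is_AC_continuous lr acG.
move: (acF) (acG) => [intf Ff] [intg Gg].
have Pf := is_AC_continuous lr (is_AC_primitive 0 intf).
have Pg := is_AC_continuous lr (is_AC_primitive 0 intg).
have iPf := continuous_mul_integrable Pf intg.
have iPg := continuous_mul_integrable Pg intf.
rewrite (@eq_Rintegral _ _ _ mu _ (fun x => F l * g x +
   (0 + \int[mu]_(t in `[l, x]) f t) * g x)); last first.
  by move=> x; rewrite inE in_itvcc => xlr; rewrite (Ff x xlr); ring.
rewrite [X in _ + X](@eq_Rintegral _ _ _ mu _ (fun x => G l * f x +
   (0 + \int[mu]_(t in `[l, x]) g t) * f x)); last first.
  by move=> x; rewrite inE in_itvcc => xlr; rewrite (Gg x xlr); ring.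
have mD : measurable (`[l, r]%classic : set R) by exact: measurable_itv.
rewrite RintegralD//; last exact: (@integrableZl _ _ _ mu _ _ (F l) (EFin \o g)).
rewrite RintegralD//; last exact: (@integrableZl _ _ _ mu _ _ (G l) (EFin \o f)).
rewrite !RintegralZl//.
have := Rintegral_mulC_itv intf intg.
rewrite [X in X = _ -> _](@eq_Rintegral _ _ _ mu _ (fun x =>
   (0 + \int[mu]_(t in `[l, x]) f t) * g x)); last first.
  by move=> x _; rewrite add0r mulrC.
move=> ->.
rewrite [X in _ + X + _](@eq_Rintegral _ _ _ mu _ (fun x => (\int[mu]_(t in `[l, r]) g t) * f x -
   (0 + \int[mu]_(t in `[l, x]) g t) * f x)); last first.
  move=> x; rewrite inE in_itvcc => /andP[lx xr].
  by rewrite (Rintegral_itv_split lx xr)//; ring.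
rewrite RintegralB//; last exact: (@integrableZl _ _ _ mu _ _ _ (EFin \o f)).
rewrite RintegralZl//.
by rewrite (Ff r) ?lr ?lexx// (Gg r) ?lr ?lexx//; ring.
Qed.

Lemma Rintegral_itvoo l r f : mu.-integrable `]l, r[ (EFin \o f) ->
  \int[mu]_(x in `]l, r[) f x = \int[mu]_(x in `[l, r]) f x.
Proof.
move=> intf.
have mf : measurable_fun `]l, r[ (EFin \o f) by exact: measurable_int intf.
by rewrite /Rintegral -(@integral_itv_bndoo R l r _ true false mf).
Qed.

Lemma measurable_itvoo_cc l r f :
  measurable_fun `]l, r[ f <-> measurable_fun `[l, r] f.
Proof.
by rewrite measurable_fun_itv_bndo_bndcP measurable_fun_itv_obnd_cbndP.
Qed.

Lemma integrable_itvoo_cc l r f : mu.-integrable `]l, r[ (EFin \o f) <->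
  mu.-integrable `[l, r] (EFin \o f).
Proof.
split=> /integrableP[/measurable_EFinP mf ioo]; apply/integrableP; split.
- by apply/measurable_EFinP/measurable_itvoo_cc.
- rewrite (@integral_itv_bndoo R l r _ true false)//.
  by apply/measurable_EFinP; exact: measurableT_comp.
- by apply/measurable_EFinP/measurable_itvoo_cc.
- rewrite -(@integral_itv_bndoo R l r _ true false)//.
  apply/measurable_EFinP; apply: measurableT_comp => //.
  exact/measurable_itvoo_cc.
Qed.

End AbsolutelyContinuous.

(** * The lemma of du Bois-Reymond *)

Section DuBoisReymond.
Context {R : realType}.
Local Notation mu := (@lebesgue_measure R).
Implicit Types (f g F G p : R -> R) (l r s d : R).

Lemma compact_support_primitive p d : 0 <= d -> continuous p ->
  (forall x, d <= `|x| -> p x = 0) ->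
  exists P : R -> R, [/\ forall x : R, is_derive x 1 P (p x), forall x, x <= - d -> P x = 0 &
      forall x, d <= x -> P x = P d].
Proof.
move=> d0 cp p0; pose P u := \int[mu]_(x in `]-oo, u]) p x; exists P.
have pE : p = p \_ `[- d, d].
  apply/funext => x; rewrite patch_itvcc -ler_norml.
  by case: ifPn => //; rewrite -ltNge => /ltW/p0.
have ip : mu.-integrable setT (EFin \o p).
  rewrite pE; apply: integrable_restrictT => //.
  by apply: continuous_itv_integrable; exact: continuous_subspaceT.
split=> [x|x xd|x xd].
- have [] := @continuous_FTC1 R p -oo%O x (x + 1) _ _ _ (cp x).
  + by rewrite ltrDl.
  + by apply: integrableS ip.
  + by rewrite ltNyr.
  by move=> dP <-; rewrite derive1E; exact: derivableP.
- rewrite /P (@eq_Rintegral _ _ _ mu _ (cst 0)).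
    by rewrite Rintegral_cst ?mul0r//; exact: measurable_itv.
  move=> y; rewrite inE /= in_itv /= => yx; apply: p0.
  by rewrite ler0_norm; lra.
- rewrite /P [LHS]Rintegral_mkcond [RHS]Rintegral_mkcond.
  congr Rintegral; apply/funext => y; rewrite /patch.
  have [yd|yd] := leP y d.
    by rewrite !ifT// inE /= in_itv /= // (le_trans yd).
  rewrite [RHS]ifF; last first.
    by apply/negbTE; rewrite notin_setE /= in_itv /=; apply/negP; rewrite -ltNge.
  by case: ifP => // _; apply: p0; rewrite ger0_norm; lra.
Qed.

Definition ramp (y : R) := (y + `|y|) / 2.

(** As [ramp] is the positive part, this is n (d - |u|) truncated to [0, 1]: a continuous
    approximation of the indicator of the open ball of radius d, supported in the closed ball for
    every n. *)
Definition plateau d (n : nat) (u : R) :=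
  ramp (n%:R * (d - `|u|)) - ramp (n%:R * (d - `|u|) - 1).

Lemma ramp_continuous : continuous ramp.
Proof.
move=> x; apply: cvgMl => //; apply: cvgD; first exact: cvg_id.
by apply: cvg_norm; exact: cvg_id.
Qed.

Lemma plateau_continuous d n : continuous (plateau d n).
Proof.
move=> x; have cn : `|u| @[u --> x] --> `|x| by apply: cvg_norm; exact: cvg_id.
have ce : n%:R * (d - `|u|) @[u --> x] --> n%:R * (d - `|x|).
  by apply: cvgMr => //; apply: cvgB => //; exact: cvg_cst.
apply: cvgB; first exact: (continuous_cvg _ (@ramp_continuous _) ce).
apply: (continuous_cvg _ (@ramp_continuous _)).
by apply: cvgB => //; exact: cvg_cst.
Qed.

Lemma plateau_out d n u : d <= `|u| -> plateau d n u = 0.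
Proof.
move=> du; rewrite /plateau /ramp.
have : n%:R * (d - `|u|) <= 0 by rewrite mulr_ge0_le0// subr_le0.
set y := n%:R * _ => y0; rewrite !ler0_norm//; lra.
Qed.

Lemma plateau_bound d n u : `|plateau d n u| <= 1.
Proof.
rewrite /plateau /ramp; set y := n%:R * _.
by case: (ler0P y) => ?; case: (ler0P (y - 1)) => ?; case: ler0P => ?; lra.
Qed.

Lemma plateau_cvg d u : plateau d n u @[n --> \oo] --> ((`|u| < d)%R%:R : R).
Proof.
have [ud|ud] := ltP `|u| d; last first.
  by apply: cvg_near_cst; apply: nearW => n; rewrite plateau_out.
apply: cvg_near_cst.
near=> n.
have : 1 <= n%:R * (d - `|u|).
  rewrite -ler_pdivrMr ?subr_gt0//.
  by near: n; exact: nbhs_infty_ger.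
rewrite /plateau /ramp; set y := n%:R * _ => y1.
by rewrite /= mulr1n !ger0_norm; lra.
Unshelve. all: by end_near. Qed.

(** The primitive of one bump is not compactly supported, since it ends at the total mass [P d]. Two
    translates have the same mass, so the primitive of their difference vanishes on both sides and
    is a test function. *)
Lemma plateau_test l r d s s' n : 0 < d -> l < s - d -> s + d < r ->
  l < s' - d -> s' + d < r ->
  exists2 th, test_function l r th &
    derive1 th = fun x => plateau d n (x - s) - plateau d n (x - s').
Proof.
move=> d0 lsd sdr lsd' sdr'.
have [P [dP P0 Pd]] := compact_support_primitive (ltW d0) (@plateau_continuous d n)
  (@plateau_out d n).
have dsh (t x : R) : is_derive x 1 (fun y => P (y - t)) (plateau d n (x - t)).
  have dt : is_derive x 1 (fun y : R => y - t) 1.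
    by rewrite -[X in is_derive _ _ _ X]subr0; apply: is_deriveB.
  by have := @is_derive1_comp R P (fun y : R => y - t) x _ 1 (dP (x - t)) dt; rewrite mulr1.
have dth (x : R) : is_derive x 1 (fun y => P (y - s) - P (y - s'))
    (plateau d n (x - s) - plateau d n (x - s')).
  by apply: is_deriveB.
have dE : derive1 (fun y => P (y - s) - P (y - s')) =
    fun x => plateau d n (x - s) - plateau d n (x - s').
  by apply/funext => x; rewrite derive1E; apply: derive_val.
exists (fun y => P (y - s) - P (y - s')) => //; split.
- by move=> x; exact: ex_derive.
- rewrite dE => x; apply: cvgB; apply: (continuous_cvg _ (@plateau_continuous d n _));
    by apply: cvgB; [exact: cvg_id|exact: cvg_cst].
- exists (Num.min (s - d) (s' - d)), (Num.max (s + d) (s' + d)); split.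
  + by rewrite lt_min lsd.
  + by rewrite gt_max sdr.
  + move=> x; rewrite in_itv /= negb_and -!ltNge lt_min gt_max.
    move=> /orP[/andP[h1 h2]|/andP[h1 h2]].
      by rewrite !P0 ?subrr//; lra.
    by rewrite Pd ?[P (x - s')]Pd ?subrr//; lra.
Qed.

Lemma measurable_ball_indic (D : set R) d t :
  measurable_fun D (fun x : R => ((`|x - t| < d)%R%:R : R)).
Proof.
rewrite (_ : (fun x => _) = \1_(ball t d)).
  by apply: measurable_indic; exact: measurable_ball.
apply/funext => x; rewrite indicE /ball /= distrC.
by congr ((nat_of_bool _)%:R); apply/idP/idP; rewrite inE.
Qed.

Lemma integrable_mul_ball (D : set R) g d t : measurable D ->
  mu.-integrable D (EFin \o g) ->
  mu.-integrable D (EFin \o (fun x => g x * (`|x - t| < d)%R%:R)).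
Proof.
move=> mD ig; apply: le_integrable (ig) => //.
  apply/measurable_EFinP; apply: measurable_funM.
    by apply/measurable_EFinP; exact: measurable_int ig.
  exact: measurable_ball_indic.
move=> x _; rewrite /= lee_fin normrM ler_piMr//.
by case: ltP; rewrite ?normr1 ?normr0.
Qed.

(** Testing g against differences of bumps gives zero for every n; dominated convergence, with bound
    2 |g|, replaces the bumps by indicators of balls. *)
Lemma shift_invariant_integral l r g d s s' : 0 < d ->
  l < s - d -> s + d < r -> l < s' - d -> s' + d < r ->
  mu.-integrable `]l, r[ (EFin \o g) ->
  (forall th, test_function l r th ->
     \int[mu]_(x in `]l, r[) (g x * derive1 th x) = 0) ->
  \int[mu]_(x in `]l, r[) (g x * (`|x - s| < d)%R%:R) =
  \int[mu]_(x in `]l, r[) (g x * (`|x - s'| < d)%R%:R).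
Proof.
move=> d0 lsd sdr lsd' sdr' ig g0.
have mg : measurable_fun `]l, r[ g by apply/measurable_EFinP; exact: measurable_int ig.
have mi t := @measurable_ball_indic `]l, r[%classic d t.
have ii t := integrable_mul_ball d t (measurable_itv _) ig.
pose f_ n x := g x * (plateau d n (x - s) - plateau d n (x - s')).
pose f x := g x * ((`|x - s| < d)%R%:R - (`|x - s'| < d)%R%:R).
have mf_ n : measurable_fun `]l, r[ (f_ n).
  apply: measurable_funM => //.
  apply: (measurable_funS measurableT) => //.
  apply: continuous_measurable_fun => x.
  by apply: cvgB; apply: (continuous_cvg _ (@plateau_continuous d n _));
    apply: cvgB; [exact: cvg_id|exact: cvg_cst|exact: cvg_id|exact: cvg_cst].
have mf : measurable_fun `]l, r[ f.
  by apply: measurable_funM => //; apply: measurable_funB; exact: mi.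
have i2g : mu.-integrable `]l, r[ (EFin \o (fun x => 2 * `|g x|)).
  apply: (@integrableZl _ _ _ mu _ (measurable_itv _) 2 (EFin \o (fun x => `|g x|))).
  exact: integrable_norm ig.
have [||||||iff_ _ cvgf] := @dominated_convergence _ _ _ mu `]l, r[ _
    (fun n => EFin \o f_ n) (EFin \o f) (EFin \o (fun x => 2 * `|g x|)).
- exact: measurable_itv.
- by move=> n; apply/measurable_EFinP; exact: (mf_ n).
- exact/measurable_EFinP.
- apply: aeW => x _; apply: cvg_EFin; first exact: nearW.
  by apply: cvgMr => //; apply: cvgB; exact: plateau_cvg.
- exact: i2g.
- apply: aeW => x n _; rewrite /= lee_fin normrM mulrC ler_wpM2r//.
  apply: le_trans (ler_normB _ _) _.
  by rewrite (_ : 2 = 1 + 1)// lerD// plateau_bound.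
have f0 n : (\int[mu]_(x in `]l, r[) (EFin \o f_ n) x = 0)%E.
  have [th tth thE] := plateau_test n d0 lsd sdr lsd' sdr'.
  have := g0 _ tth; rewrite thE /Rintegral => /eqP; rewrite fine_eq0.
    by move=> /eqP.
  apply: integrable_fin_num => //.
  apply: le_integrable i2g => //; first by apply/measurable_EFinP; exact: (mf_ n).
  move=> x _; rewrite /= lee_fin normrM [leRHS]ger0_norm ?mulr_ge0//.
  rewrite mulrC ler_wpM2r//; apply: le_trans (ler_normB _ _) _.
  by rewrite (_ : 2 = 1 + 1)// lerD// plateau_bound.
have : (\int[mu]_(x in `]l, r[) (EFin \o f) x = 0)%E.
  apply: cvg_unique cvgf _ => //.
  by apply: cvg_near_cst; apply: nearW => n; exact: f0.
move=> fE0.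
have : \int[mu]_(x in `]l, r[) f x = 0 by rewrite /Rintegral fE0.
rewrite (@eq_Rintegral _ _ _ mu _ (fun x => g x * (`|x - s| < d)%R%:R -
   g x * (`|x - s'| < d)%R%:R)); last by move=> x _; rewrite /f mulrBr.
by rewrite RintegralB// => /eqP; rewrite subr_eq0 => /eqP.
Qed.

(** The averages of g over balls of equal radius inside the interval do not depend on the centre. At
    Lebesgue points they converge to the values of g, which are therefore all equal. *)
Lemma dubois_reymond l r g : mu.-integrable `]l, r[ (EFin \o g) ->
  (forall th, test_function l r th ->
     \int[mu]_(x in `]l, r[) (g x * derive1 th x) = 0) ->
  exists c, {ae mu, forall x, `]l, r[%classic x -> g x = c}.
Proof.
move=> ig g0; pose h := g \_ `]l, r[.
have lh : locally_integrable setT h by exact: integrable_locally.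
have hE x : `]l, r[%classic x -> h x = g x by move=> xlr; rewrite /h patchT// inE.
have key (s s' : R) : `]l, r[%classic s -> `]l, r[%classic s' ->
    lebesgue_pt h s -> lebesgue_pt h s' -> g s = g s'.
  move=> slr s'lr hs hs'; rewrite -(hE s)// -(hE s')//.
  move: slr s'lr; rewrite /= !in_itv /= => /andP[ls sr] /andP[ls' s'r].
  (* Half the smallest distance from s and s' to the end points, so that all the balls used stay
     strictly inside the interval. *)
  pose eta : R := (Num.min (Num.min (s - l) (r - s)) (Num.min (s' - l) (r - s'))) / 2.
  have eta0 : 0 < eta by rewrite divr_gt0// !lt_min !subr_gt0 ls sr ls' s'r.
  have etal : eta < s - l /\ eta < r - s /\ eta < s' - l /\ eta < r - s'.
    have : eta * 2 = Num.min (Num.min (s - l) (r - s)) (Num.min (s' - l) (r - s')).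
      by rewrite divfK.
    move=> e2; have : eta * 2 <= eta * 2 by [].
    rewrite {2}e2 !le_min => /andP[/andP[? ?] /andP[? ?]].
    by repeat split; lra.
  have dn0 n : 0 < eta / n.+1%:R by rewrite divr_gt0.
  have dnle n : eta / n.+1%:R <= eta.
    by rewrite ler_pdivrMr// ler_peMr ?(ltW eta0)// ler1n.
  pose E x n : set R := ball x (eta / n.+1%:R).
  have nE x : nicely_shrinking x (E x).
    split; first by move=> n; exact: measurable_ball.
    exists (1, fun n => PosNum (dn0 n)); split => //=.
    - rewrite -[X in _ --> X](mulr0 eta); apply: cvgMr => //.
      exact: cvg_harmonic.
    - by move=> n.
    - by move=> n; rewrite mul1e.
  have c1 := nice_lebesgue_differentiation nE lh hs.
  have c2 := nice_lebesgue_differentiation nE lh hs'.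
  have intE x n : l < x - eta -> x + eta < r ->
      (\int[mu]_(y in E x n) (h y)%:E)%E =
      (\int[mu]_(y in `]l, r[) (g y * (`|y - x| < eta / n.+1%:R)%R%:R))%:E.
    move=> lx xr.
    rewrite /Rintegral fineK; last first.
      by apply: integrable_fin_num => //; exact: integrable_mul_ball.
    rewrite [LHS]integral_mkcond [RHS]integral_mkcond; congr (integral _ _ _); apply/funext => y.
    have memE : (y \in E x n) = (`|y - x| < eta / n.+1%:R).
      by apply/idP/idP; rewrite inE /E /ball /= distrC.
    rewrite /h /patch memE; case: (`|y - x| < _); case: ifP => // _.
      by rewrite mulr1.
    by rewrite mulr0.
  have [es1 [es2 [es3 es4]]] := etal.
  have b1 : l < s - eta by rewrite ltrBrDr -ltrBrDl.
  have b2 : s + eta < r by rewrite addrC -ltrBrDr.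
  have b3 : l < s' - eta by rewrite ltrBrDr -ltrBrDl.
  have b4 : s' + eta < r by rewrite addrC -ltrBrDr.
  move: c1; rewrite (_ : (fun n => _) = fun n =>
      ((mu (E s' n))^-1 * \int[mu]_(y in E s' n) (h y)%:E)%E); last first.
    apply/funext => n; rewrite (intE s n)// (intE s' n)//.
    rewrite !lebesgue_measure_ball ?(ltW (dn0 n))//.
    congr (_ * _%:E)%E; apply: shift_invariant_integral => //.
    - by rewrite (lt_le_trans b1)// lerB.
    - by rewrite (le_lt_trans _ b2)// lerD.
    - by rewrite (lt_le_trans b3)// lerB.
    - by rewrite (le_lt_trans _ b4)// lerD.
  move=> c1; apply: EFin_inj; exact: (cvg_unique (@ereal_hausdorff R) c1 c2).
(* The constant is the value at any Lebesgue point of the interval. If there is none, almost no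
   point lies in the interval and any constant will do. *)
have [[s0 [s0lr hs0]]|no] := pselect (exists s, `]l, r[%classic s /\ lebesgue_pt h s).
  exists (g s0); have := lebesgue_differentiation lh.
  apply: filterS; first exact: (ae_filter_ringOfSetsType mu).
  by move=> x hx xlr; exact: key.
exists 0; have := lebesgue_differentiation lh.
apply: filterS; first exact: (ae_filter_ringOfSetsType mu).
by move=> x hx xlr; exfalso; apply: no; exists x.
Qed.

End DuBoisReymond.

Section WeakDerivative.
Context {R : realType}.
Local Notation mu := (@lebesgue_measure R).
Implicit Types (f g F G : R -> R) (l r : R).

Lemma aeS (P Q : R -> Prop) : {ae mu, forall x, P x} ->
  (forall x, P x -> Q x) -> {ae mu, forall x, Q x}.
Proof.
move=> aP PQ; move: aP.
by apply: filterS; first exact: (ae_filter_ringOfSetsType mu).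
Qed.

Lemma aeS2 (P Q S : R -> Prop) : {ae mu, forall x, P x} ->
  {ae mu, forall x, Q x} ->
  (forall x, P x -> Q x -> S x) -> {ae mu, forall x, S x}.
Proof.
move=> aP aQ PQ; have F : Filter (nbhs (almost_everywhere mu)).
  exact: ae_filter_ringOfSetsType.
exact: (filterS2 _ _ aP aQ).
Qed.

Lemma ae_eq_Rintegral l r f g : mu.-integrable `]l, r[ (EFin \o f) ->
  mu.-integrable `]l, r[ (EFin \o g) ->
  {ae mu, forall x, `]l, r[%classic x -> f x = g x} ->
  \int[mu]_(x in `]l, r[) f x = \int[mu]_(x in `]l, r[) g x.
Proof.
move=> intf intg fg; rewrite /Rintegral; congr fine.
apply: ae_eq_integral => //.
- exact: measurable_int intf.
- exact: measurable_int intg.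
- by refine (aeS fg _) => x fgx xlr; rewrite /= fgx.
Qed.

Lemma is_AC_ae l r F f g : mu.-integrable `]l, r[ (EFin \o g) ->
  {ae mu, forall x, `]l, r[%classic x -> f x = g x} ->
  is_AC l r F f -> is_AC l r F g.
Proof.
move=> ig fg [intf Ff]; have icg := (integrable_itvoo_cc l r g).1 ig.
split=> // x xlr; rewrite Ff//; congr (_ + _); case/andP: xlr => lx xr.
have sub u : mu.-integrable `[l, r] (EFin \o u) ->
    mu.-integrable `]l, x[ (EFin \o u).
  by move=> iu; apply/integrable_itvoo_cc; exact: integrable_itvS iu.
rewrite -!Rintegral_itvoo; [|exact: sub..].
apply: ae_eq_Rintegral; [exact: sub..|].
refine (aeS fg _) => y fgy; rewrite /= in_itv /= => /andP[ly yx]; apply: fgy.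
by rewrite /= in_itv /= ly (lt_le_trans yx).
Qed.

Lemma test_function_AC l r th : l < r -> test_function l r th ->
  [/\ is_AC l r th (derive1 th), th l = 0 & th r = 0].
Proof.
move=> lr [dth cth [c [d [lc dr th0]]]].
have cont : continuous th.
  move=> x; apply: differentiable_continuous; exact/derivable1_diffP.
split; last 2 first.
- by apply: th0; rewrite in_itv /= negb_and -!ltNge lc.
- by apply: th0; rewrite in_itv /= negb_and -!ltNge dr orbT.
split=> [|x /andP[]].
  by apply: continuous_itv_integrable; exact: continuous_subspaceT.
rewrite le_eqVlt => /predU1P[<- _|lx xr].
  by rewrite set_itv1 Rintegral_set1 addr0.
have dth' : derivable_oo_LRcontinuous th l x.
  split; [by move=> y _; exact: dth| |].
  - by apply: cvg_at_right_filter; exact: cont.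
  - by apply: cvg_at_left_filter; exact: cont.
rewrite /Rintegral (continuous_FTC2 lx (continuous_subspaceT cth) dth')//=.
by rewrite addrCA subrr addr0.
Qed.

Lemma is_AC_weak_deriv l r F f : l < r -> is_AC l r F f ->
  weak_deriv_real l r F f.
Proof.
move=> lr aF th tth; have [ath thl thr] := test_function_AC lr tth.
have cF := is_AC_continuous (ltW lr) aF.
have cth := is_AC_continuous (ltW lr) ath.
have := is_AC_mul (ltW lr) aF ath; rewrite thl thr !mulr0 subr0.
have i1 := continuous_mul_integrable cF ath.1.
have i2 := continuous_mul_integrable cth aF.1.
have -> : (fun x => f x * th x) = (fun x => th x * f x).
  by apply/funext => x; rewrite mulrC.
rewrite !Rintegral_itvoo; [|exact/integrable_itvoo_cc..].
by move/eqP; rewrite addr_eq0 => /eqP.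
Qed.

(** A primitive of f1 also has weak derivative f1, so its difference with f is orthogonal to all
    derivatives of test functions, hence almost everywhere constant. *)
Lemma weak_deriv_AC l r f f1 : l < r -> mu.-integrable `]l, r[ (EFin \o f) ->
  mu.-integrable `]l, r[ (EFin \o f1) -> weak_deriv_real l r f f1 ->
  exists2 F, is_AC l r F f1 & {ae mu, forall x, `]l, r[%classic x -> f x = F x}.
Proof.
move=> lr intf intf1 wf.
have if1 := (integrable_itvoo_cc l r f1).1 intf1.
have aG := is_AC_primitive 0 if1.
pose G x := 0 + \int[mu]_(t in `[l, x]) f1 t.
have wG : weak_deriv_real l r G f1 by exact: is_AC_weak_deriv.
have cG := is_AC_continuous (ltW lr) aG.
have iG : mu.-integrable `]l, r[ (EFin \o G).
  by apply/integrable_itvoo_cc; exact: continuous_itv_integrable.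
have bth th : test_function l r th -> {within `[l, r], continuous (derive1 th)}.
  by case=> _ cth _; exact: continuous_subspaceT.
have ith th u : test_function l r th -> mu.-integrable `]l, r[ (EFin \o u) ->
    mu.-integrable `]l, r[ (EFin \o (fun x => u x * derive1 th x)).
  move=> tth iu; apply/integrable_itvoo_cc.
  rewrite (_ : (fun x => _) = (fun x => derive1 th x * u x)); last first.
    by apply/funext => x; rewrite mulrC.
  apply: continuous_mul_integrable; first exact: bth.
  exact/integrable_itvoo_cc.
have [c fc] : exists c, {ae mu, forall x, `]l, r[%classic x -> f x - G x = c}.
  apply: dubois_reymond.
    exact: (@integrableB _ _ _ mu _ (measurable_itv _) (EFin \o f) (EFin \o G)).
  move=> th tth.
  rewrite (_ : (fun x => _) = (fun x => f x * derive1 th x - G x * derive1 th x)); last first.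
    by apply/funext => x; rewrite mulrBl.
  by rewrite RintegralB//; [rewrite wf// wG// subrr|exact: ith|exact: ith].
exists (fun x => c + \int[mu]_(t in `[l, x]) f1 t); first exact: is_AC_primitive.
by refine (aeS fc _) => x fcx xlr; rewrite -(fcx xlr) /G add0r subrK.
Qed.

Lemma continuous_ae_eq l r F G : l < r -> {within `[l, r], continuous F} ->
  {within `[l, r], continuous G} ->
  {ae mu, forall x, `]l, r[%classic x -> F x = G x} ->
  forall x, l <= x <= r -> F x = G x.
Proof.
move=> lr cF cG FG x xlr.
apply: contrapT => FGx.
have cH : {within `[l, r], continuous (fun x => F x - G x)}.
  by move=> y; apply: cvgB; [exact: cF|exact: cG].
have Hx : 0 < `|F x - G x|.
  by rewrite normr_gt0 subr_eq0; apply/eqP.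
have xA : `[l, r]%classic x by rewrite in_itvcc.
have /cvgrPdist_lt /(_ _ Hx) : (fun y => F y - G y) @ within `[l, r] (nbhs x) -->
    F x - G x.
  by rewrite (nbhs_subspace_in xA); exact: cH.
rewrite near_withinE => /nbhs_ballP[e /= e0 He].
case/andP: xlr => lx xr.
(* The part of the e-neighbourhood of x inside [l, r] has positive length even when x is an end
   point, so the two functions would differ on a set of positive measure. *)
pose u := Num.max l (x - e); pose v := Num.min r (x + e).
have uv : u < v.
  by rewrite /u /v lt_min !gt_max lr /=; apply/and3P; split; lra.
case: FG => A [mA A0 sub].
have : (mu `]u, v[ <= mu A)%E.
  apply: le_measure; rewrite ?inE//.
  move=> y; rewrite /= in_itv /= /u /v gt_max lt_min => /andP[/andP[ly ey] /andP[yr ye]].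
  apply: sub => /= FGy.
  have ylr : `]l, r[%classic y by rewrite /= in_itv /= ly yr.
  have yl : `[l, r]%classic y by rewrite in_itvcc !ltW.
  have := He y; rewrite /ball /= distrC ltr_distl ey ye => /(_ isT yl).
  by rewrite (FGy ylr) subrr subr0 ltxx.
by rewrite A0 lebesgue_measure_itv /= lte_fin uv -EFinD lee_fin subr_le0 leNgt uv.
Qed.

End WeakDerivative.

Lemma half_pow_small (R : realType) (C e : R) : 0 <= C -> 0 < e ->
  exists k, C / 2 ^+ k <= e.
Proof.
move=> C0 e0; have Ce : 0 <= C / e by rewrite divr_ge0// ltW.
exists (Num.Def.archi_bound (C / e)); set k := Num.Def.archi_bound _.
rewrite ler_pdivrMr ?exprn_gt0// mulrC -ler_pdivrMr//.
apply: le_trans (ltW (archi_boundP Ce)) _.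
by rewrite -natrX ler_nat ltnW// ltn_expl.
Qed.

(** 2 A is the fixed point of S -> A + S / 2, so an excess B over it is halved at each application
    of the Volterra operator. *)
Lemma half_contraction_le (R : realFieldType) (A B W a b : R) : 0 <= A -> 1 <= W ->
  a <= A -> b <= (2 * A + B) / 2 * W -> a + b <= (2 * A + B / 2) * W.
Proof. by move=> A0 W1 aA bB; nra. Qed.

Lemma half_fraction_le (R : realFieldType) (a : R) : 0 <= a ->
  a / (2 * a + 1) <= 1 / 2.
Proof.
move=> a0; have a1 : 0 < 2 * a + 1 by rewrite ltr_wpDl// mulr_ge0.
by rewrite ler_pdivrMr//; lra.
Qed.

(** * Linear systems with integrable coefficients *)

Section LinearSystem.
Context {R : realType}.
Local Notation mu := (@lebesgue_measure R).
Context (n : nat) (l r K : R) (m : 'I_n -> 'I_n -> R -> R) (g : 'I_n -> R -> R).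
Context (lr : l <= r) (K0 : 0 <= K).
Context (mm : forall i j, measurable_fun `[l, r] (m i j)).
Context (mK : forall i j x, l <= x <= r -> `|m i j x| <= K).
Context (ig : forall i, mu.-integrable `[l, r] (EFin \o g i)).
Implicit Types (y e : 'I_n -> R -> R).

(** The rate of the exponential weight: n K / L <= 1/2 makes the integral operator a contraction,
    and the summand 1 keeps L positive when n K = 0. *)
Let L := 2 * n%:R * K + 1.
Let w x := expR (L * (x - l)).
Let rhs y i t := \sum_(j < n) m i j t * y j t + g i t.

Let L0 : 0 < L. Proof. by rewrite ltr_wpDl// !mulr_ge0. Qed.

Let w_ge1 x : l <= x -> 1 <= w x.
Proof. by move=> lx; rewrite -expR0 ler_expR mulr_ge0 ?(ltW L0)// subr_ge0. Qed.

Let w_derive (x : R) : is_derive x 1 w (w x * L).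
Proof.
have d0 : is_derive x 1 (fun t : R => t - l) 1.
  by rewrite -[X in is_derive _ _ _ X]subr0; apply: is_deriveB.
have d1 : is_derive x 1 (fun t : R => L * (t - l)) L.
  by have := @is_deriveZ _ _ _ _ L _ _ _ d0; rewrite /GRing.scale /= mulr1.
exact: (@is_derive1_comp R expR (fun t : R => L * (t - l)) x _ _ _ d1).
Qed.

Let wL_derive (x : R) : is_derive x 1 (fun t => L^-1 * w t) (w x).
Proof.
have := @is_deriveZ _ _ _ _ L^-1 _ _ _ (w_derive x); rewrite /GRing.scale /=.
by rewrite mulrCA mulVf ?mulr1// gt_eqF.
Qed.

Let w_continuous : continuous w.
Proof.
move=> x; apply: differentiable_continuous; apply/derivable1_diffP.
by case: (w_derive x).
Qed.

Let w_integral x : l <= x -> \int[mu]_(t in `[l, x]) w t <= w x / L.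
Proof.
rewrite le_eqVlt => /predU1P[<-|lx].
  by rewrite set_itv1 Rintegral_set1 divr_ge0 ?expR_ge0 ?(ltW L0).
have cwL : continuous (fun t => L^-1 * w t).
  by move=> t; apply: cvgMr; exact: w_continuous.
have dw : derivable_oo_LRcontinuous (fun t => L^-1 * w t) l x.
  split; [by move=> y _; case: (wL_derive y)| |].
  - by apply: cvg_at_right_filter; exact: cwL.
  - by apply: cvg_at_left_filter; exact: cwL.
have Dw : {in `]l, x[, (fun t => L^-1 * w t)^`()%classic =1 w}.
  by move=> t _; rewrite derive1E; case: (wL_derive t).
rewrite /Rintegral (continuous_FTC2 lx (continuous_subspaceT w_continuous) dw Dw)/=.
by rewrite mulrC gerBl mulr_ge0 ?expR_ge0 ?invr_ge0 ?(ltW L0).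
Qed.

Let integrable_w (S x : R) : mu.-integrable `[l, x] (EFin \o (fun t => S * w t)).
Proof.
apply: continuous_itv_integrable; apply: continuous_subspaceT => t.
by apply: cvgMr; exact: w_continuous.
Qed.

Let integrable_dominated (S : R) (e : R -> R) : measurable_fun `[l, r] e ->
  (forall x, l <= x <= r -> `|e x| <= S * w x) ->
  mu.-integrable `[l, r] (EFin \o e).
Proof.
move=> me eS; apply: le_integrable (integrable_w S r) => //.
  exact/measurable_EFinP.
move=> x; rewrite in_itvcc => xlr; rewrite /= lee_fin.
exact: le_trans (eS _ xlr) (ler_norm _).
Qed.

Let integrable_lin e i : (forall j, mu.-integrable `[l, r] (EFin \o e j)) ->
  mu.-integrable `[l, r] (EFin \o (fun t => \sum_(j < n) m i j t * e j t)).
Proof.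
move=> ie.
rewrite (_ : _ \o _ = fun t => (\sum_(j < n) (m i j t * e j t)%:E)%E); last first.
  by apply/funext => t; rewrite /= sumEFin.
apply: integrable_sum => // j _.
apply: (@integrable_bounded_mul _ _ _ _ K) => //.
by move=> x; rewrite in_itvcc; exact: mK.
Qed.

Let integrable_rhs y i : (forall j, mu.-integrable `[l, r] (EFin \o y j)) ->
  mu.-integrable `[l, r] (EFin \o rhs y i).
Proof.
move=> iy; apply: (@integrableD _ _ _ mu _ (measurable_itv _)
  (EFin \o (fun t => \sum_(j < n) m i j t * y j t)) (EFin \o g i)) => //.
exact: integrable_lin.
Qed.

(* The weight w makes the Volterra operator a contraction with factor 1/2. *)
Let contraction e (S : R) i x : (forall j, measurable_fun `[l, r] (e j)) ->
  0 <= S -> (forall j t, l <= t <= r -> `|e j t| <= S * w t) -> l <= x <= r ->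
  `|\int[mu]_(t in `[l, x]) (\sum_(j < n) m i j t * e j t)| <= S / 2 * w x.
Proof.
move=> me S0 eS /andP[lx xr].
have ilin : mu.-integrable `[l, x] (EFin \o (fun t => \sum_(j < n) m i j t * e j t)).
  apply: integrable_itvS (lexx l) xr _; apply: integrable_lin => j.
  by apply: (@integrable_dominated S _ (me j)) => t; exact: eS.
apply: (@le_trans _ _ (\int[mu]_(t in `[l, x]) (n%:R * K * S * w t))).
  apply: le_trans (le_normr_Rintegral _ ilin) _ => //.
  apply: le_Rintegral => //; first exact: integrable_norm.
  move=> t; rewrite in_itvcc => /andP[lt tx].
  apply: le_trans (ler_norm_sum _ _ _) _.
  rewrite -!mulrA -[X in X%:R]card_ord mulr_natl -sumr_const ler_sum// => j _.
  have tlr : l <= t <= r by rewrite lt (le_trans tx).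
  by rewrite normrM ler_pM// ?mK// eS.
rewrite RintegralZl//; last first.
  apply: continuous_itv_integrable; apply: continuous_subspaceT; exact: w_continuous.
apply: le_trans (ler_wpM2l _ (w_integral lx)) _; first by rewrite !mulr_ge0.
have nKL : n%:R * K / L <= 1 / 2.
  have -> : L = 2 * (n%:R * K) + 1 by rewrite mulrA.
  by apply: half_fraction_le; rewrite mulr_ge0.
have -> : n%:R * K * S * (w x / L) = n%:R * K / L * (S * w x) by ring.
have -> : S / 2 * w x = 1 / 2 * (S * w x) by ring.
by rewrite ler_wpM2r// mulr_ge0// expR_ge0.
Qed.

(** A crude bound M comes from continuity. Feeding a bound (2 A + B) w into the integral equation
    returns (2 A + B / 2) w, so M is replaced by M / 2 ^ k for every k and disappears in the
    limit. *)
Theorem linear_system_bound y (A : R) :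
  (forall i, is_AC l r (y i) (rhs y i)) ->
  (forall i, `|y i l| + \int[mu]_(t in `[l, r]) `|g i t| <= A) ->
  forall i x, l <= x <= r -> `|y i x| <= 2 * A * expR (L * (r - l)).
Proof.
move=> acy yA.
have cy i := is_AC_continuous lr (acy i).
have my i : measurable_fun `[l, r] (y i) by exact: continuous_itv_measurable.
have [M M0 yM] : exists2 M, 0 <= M & forall i x, l <= x <= r -> `|y i x| <= M.
  have /choice[M MP] : forall i, exists M, 0 <= M /\
      forall x, l <= x <= r -> `|y i x| <= M.
    by move=> i; have [M M0 yM] := continuous_itv_bounded (cy i); exists M.
  exists (\sum_(i < n) M i); first by rewrite sumr_ge0// => i _; exact: (MP i).1.
  move=> i x xlr; apply: le_trans ((MP i).2 _ xlr) _.
  by rewrite (bigD1 i)//= lerDl sumr_ge0// => j _; exact: (MP j).1.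
have step k i x : l <= x <= r -> `|y i x| <= (2 * A + M / 2 ^+ k) * w x.
  elim: k i x => [|k IH] i x xlr.
    have A0 : 0 <= A.
      by apply: le_trans (yA i); rewrite addr_ge0// Rintegral_ge0.
    have lx : l <= x by case/andP: xlr.
    rewrite expr0 divr1; apply: le_trans (yM i x xlr) _.
    by rewrite -[leLHS]mulr1 ler_pM ?w_ge1// lerDr mulr_ge0.
  have A0 : 0 <= A.
    by apply: le_trans (yA i); rewrite addr_ge0// Rintegral_ge0.
  have /andP[lx xr] := xlr.
  have iy j : mu.-integrable `[l, r] (EFin \o y j) by exact: continuous_itv_integrable.
  rewrite ((acy i).2 x xlr) /rhs.
  rewrite RintegralD//; last 2 first.
  - by apply: integrable_itvS (lexx l) xr _; exact: integrable_lin.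
  - by apply: integrable_itvS (lexx l) xr _.
  rewrite addrCA.
  apply: le_trans (ler_normD _ _) _.
  have Q0 : 0 <= 2 * A + M / 2 ^+ k by rewrite addr_ge0 ?mulr_ge0// invr_ge0 exprn_ge0.
  have cont := contraction i my Q0 IH xlr.
  have -> : (2 * A + M / 2 ^+ k.+1) = 2 * A + (M / 2 ^+ k) / 2.
    by rewrite exprSr invfM mulrA.
  rewrite [leLHS]addrC; apply: half_contraction_le cont => //; first exact: w_ge1.
  apply: le_trans (yA i); apply: le_trans (ler_normD _ _) _; rewrite lerD2l.
  have igx : mu.-integrable `[l, x] (EFin \o g i) by exact: integrable_itvS (lexx l) xr _.
  apply: le_trans (le_normr_Rintegral _ igx) _ => //.
  rewrite (Rintegral_itv_split lx xr); last exact: integrable_norm.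
  by rewrite lerDl Rintegral_ge0.
move=> i x xlr.
have A0 : 0 <= A.
  by apply: le_trans (yA i); rewrite addr_ge0// Rintegral_ge0.
have /andP[lx xr] := xlr.
apply: (@le_trans _ _ (2 * A * w x)); last first.
  by rewrite ler_wpM2l ?mulr_ge0// ler_expR ler_wpM2l ?(ltW L0)// lerB.
apply/ler_addgt0Pl => e e0.
have [k Hk] : exists k, M * w x / 2 ^+ k <= e.
  by apply: half_pow_small => //; rewrite mulr_ge0// expR_ge0.
apply: le_trans (step k i x xlr) _; rewrite mulrDl addrC lerD2r.
by rewrite mulrAC.
Qed.

(** Picard iteration from 0. The iterates stay below 2 A w and the successive differences below A w
    / 2 ^ k, so they converge pointwise by comparison with a geometric series. *)
Theorem linear_system_exists (c : 'I_n -> R) : exists y,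
  (forall i, y i l = c i) /\ forall i, is_AC l r (y i) (rhs y i).
Proof.
pose T y i x := c i + \int[mu]_(t in `[l, x]) rhs y i t.
pose u k := iter k T (fun _ _ => 0).
pose A := \sum_(i < n) (`|c i| + \int[mu]_(t in `[l, r]) `|g i t|).
have A0 : 0 <= A by rewrite sumr_ge0// => i _; rewrite addr_ge0// Rintegral_ge0.
have uS k : u k.+1 = T (u k) by [].
have cT y i : (forall j, {within `[l, r], continuous (y j)}) ->
    {within `[l, r], continuous (T y i)}.
  move=> cy; apply: is_AC_continuous lr _; apply: is_AC_primitive.
  by apply: integrable_rhs => j; exact: continuous_itv_integrable.
have cu k i : {within `[l, r], continuous (u k i)}.
  elim: k i => [|k IH] i; last exact: cT.
  by apply: continuous_subspaceT => x; exact: cvg_cst.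
have mu_ k i : measurable_fun `[l, r] (u k i) by exact: continuous_itv_measurable.
have iu k i : mu.-integrable `[l, r] (EFin \o u k i).
  exact: continuous_itv_integrable.
have cgA i x : l <= x <= r -> `|c i + \int[mu]_(t in `[l, x]) g i t| <= A.
  move=> /andP[lx xr]; apply: (@le_trans _ _ (`|c i| + \int[mu]_(t in `[l, r]) `|g i t|)).
    apply: le_trans (ler_normD _ _) _; rewrite lerD2l.
    have igx : mu.-integrable `[l, x] (EFin \o g i) by exact: integrable_itvS (lexx l) xr _.
    apply: le_trans (le_normr_Rintegral _ igx) _ => //.
    rewrite (Rintegral_itv_split lx xr); last exact: integrable_norm.
    by rewrite lerDl Rintegral_ge0.
  rewrite /A (bigD1 i)//= lerDl sumr_ge0// => j _.
  by rewrite addr_ge0// Rintegral_ge0.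
have TE y i x : l <= x <= r -> (forall j, mu.-integrable `[l, r] (EFin \o y j)) ->
   T y i x = c i + \int[mu]_(t in `[l, x]) g i t +
     \int[mu]_(t in `[l, x]) (\sum_(j < n) m i j t * y j t).
  move=> /andP[lx xr] iy; rewrite /T /rhs RintegralD//; last 2 first.
  - by apply: integrable_itvS (lexx l) xr _; exact: integrable_lin.
  - by apply: integrable_itvS (lexx l) xr _.
  by rewrite addrCA addrA addrC -addrA [RHS]addrC addrA addrC.
have ub k i x : l <= x <= r -> `|u k i x| <= 2 * A * w x.
  elim: k i x => [|k IH] i x xlr.
    by rewrite normr0 !mulr_ge0// expR_ge0.
  rewrite uS (TE _ _ _ xlr)//; apply: le_trans (ler_normD _ _) _.
  have A20 : 0 <= 2 * A by rewrite mulr_ge0.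
  have cont := contraction i (mu_ k) A20 IH xlr.
  have lx : l <= x by case/andP: xlr.
  have H := @half_contraction_le _ A 0 (w x) _ _ A0 (w_ge1 lx) (cgA i x xlr).
  by rewrite mul0r !addr0 in H; exact: H cont.
have ud k i x : l <= x <= r -> `|u k.+1 i x - u k i x| <= A / 2 ^+ k * w x.
  elim: k i x => [|k IH] i x xlr.
    rewrite subr0 expr0 divr1 uS (TE _ _ _ xlr)//.
    rewrite (@eq_Rintegral _ _ _ mu _ (cst 0) (fun t => \sum_(j < n) m i j t * _)); last first.
      by move=> t _; apply: big1 => j _; rewrite /= mulr0.
    rewrite Rintegral_cst// mul0r addr0; apply: le_trans (cgA _ _ xlr) _.
    by rewrite ler_peMr// w_ge1//; case/andP: xlr.
  have /andP[lx xr] := xlr.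
  rewrite (uS k.+1) (uS k) (TE (u k.+1) _ _ xlr)// (TE (u k) _ _ xlr)//.
  rewrite opprD addrACA subrr add0r -RintegralB//; last 2 first.
  - by apply: integrable_itvS (lexx l) xr _; exact: integrable_lin.
  - by apply: integrable_itvS (lexx l) xr _; exact: integrable_lin.
  rewrite (@eq_Rintegral _ _ _ mu _ (fun t => \sum_(j < n) m i j t *
     (u k.+1 j t - u k j t))); last first.
    by move=> t _; rewrite -sumrB; apply: eq_bigr => j _; rewrite mulrBr.
  rewrite exprSr invfM mulrA.
  apply: (@contraction (fun j t => u k.+1 j t - u k j t)) => //.
    by move=> j; exact: measurable_funB.
  by rewrite divr_ge0// exprn_ge0.
have ucvg i x : l <= x <= r -> cvgn (fun k => u k i x).
  move=> xlr.
  rewrite (_ : (fun k => _) = fun k => u 0%N i x + series (telescope (u ^~ i ^~ x)) k); last first.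
    by apply/funext => k; rewrite -(@eq_sum_telescope _ (u ^~ i ^~ x)).
  apply: is_cvgD; first exact: is_cvg_cst.
  apply: normed_cvg.
  apply: (@series_le_cvg _ _ (geometric (A * w x) 2^-1)).
  - by move=> k /=.
  - by move=> k /=; rewrite !mulr_ge0 ?expR_ge0// exprn_ge0// invr_ge0.
  - move=> k /=; apply: le_trans (ud k i x xlr) _.
    by rewrite exprVn mulrAC.
  - by apply: is_cvg_geometric_series; rewrite ger0_norm ?invr_ge0// invf_lt1// ltr1n.
pose y i x : R := limn (fun k => u k i x).
have uy i x : l <= x <= r -> u k i x @[k --> \oo] --> y i x.
  by move=> xlr; exact: ucvg.
have my i : measurable_fun `[l, r] (y i).
  apply: (@measurable_fun_cvg _ _ _ _ (fun k => u k i)) => // x.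
  by rewrite in_itvcc; exact: uy.
have yb i x : l <= x <= r -> `|y i x| <= 2 * A * w x.
  move=> xlr.
  apply: cvgr_to_le (cvg_norm (uy i x xlr)) _.
  by apply: nearW => k; exact: ub.
have iy i : mu.-integrable `[l, r] (EFin \o y i).
  by apply: (@integrable_dominated (2 * A)) => // t; exact: yb.
have yT i x : l <= x <= r -> y i x = T y i x.
  move=> xlr; have /andP[lx xr] := xlr.
  have c1 : u k.+1 i x @[k --> \oo] --> y i x.
    by rewrite (cvg_shiftS (fun k => u k i x)); exact: uy.
  suff c2 : u k.+1 i x @[k --> \oo] --> T y i x by exact: (cvg_unique _ c1 c2).
  apply: cvgD; first exact: cvg_cst.
  apply: fine_cvg.
  have irhs e : (forall j, mu.-integrable `[l, r] (EFin \o e j)) ->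
     mu.-integrable `[l, x] (EFin \o rhs e i).
    by move=> ie; apply: integrable_itvS (lexx l) xr _; exact: integrable_rhs.
  rewrite fineK; last by apply: integrable_fin_num => //; exact: irhs.
  (* The bound [ub] does not depend on the index of the iterate, so pointwise convergence passes to
     the integral equation. *)
  have [|||||_ _ H] := @dominated_convergence _ _ _ mu `[l, x]
    (measurable_itv _) (fun k => EFin \o rhs (u k) i) (EFin \o rhs y i)
    (EFin \o (fun t => n%:R * K * (2 * A) * w t + `|g i t|)).
  - by move=> k; apply: measurable_int (irhs _ _).
  - by apply: measurable_int (irhs _ _).
  - apply: aeW => t; rewrite in_itvcc => /andP[lt tx]; apply: cvg_EFin; first exact: nearW.
    apply: cvgD; last exact: cvg_cst.
    apply: cvg_big => [|j _]; first exact: add_continuous.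
    apply: cvgMr; apply: uy.
    by rewrite lt (le_trans tx).
  - apply: (@integrableD _ _ _ mu _ (measurable_itv _)
      (EFin \o (fun t => n%:R * K * (2 * A) * w t)) (EFin \o (fun t => `|g i t|))).
      exact: integrable_w.
    by apply: integrable_norm; exact: integrable_itvS (lexx l) xr _.
  - apply: aeW => t k; rewrite in_itvcc => /andP[lt tx].
    have tlr : l <= t <= r by rewrite lt (le_trans tx).
    rewrite /= lee_fin /rhs; apply: le_trans (ler_normD _ _) _; rewrite lerD2r.
    apply: le_trans (ler_norm_sum _ _ _) _.
    rewrite -!mulrA -[X in X%:R]card_ord mulr_natl -sumr_const ler_sum// => j _.
    by rewrite normrM ler_pM// ?mK// mulrA ub.
  exact: H.
exists y; split=> i.
  by rewrite yT ?lexx// /T set_itv1 Rintegral_set1 addr0.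
split; first exact: integrable_rhs.
move=> x xlr; rewrite [LHS]yT// /T [y i l]yT ?lexx// /T.
by rewrite set_itv1 Rintegral_set1 addr0.
Qed.

End LinearSystem.

(** * Complex-valued functions and the space W_2^2 *)

Section ComplexFunctions.
Context {R : realType}.
Local Notation mu := (@lebesgue_measure R).
Local Notation C := R[i].
Implicit Types (l r : R) (rho p : R -> R) (f g F G : R -> C).

Lemma ae_eq_integrable (D : set R) (f g : R -> R) : measurable D ->
  measurable_fun D g -> {ae mu, forall x, D x -> f x = g x} ->
  mu.-integrable D (EFin \o f) -> mu.-integrable D (EFin \o g).
Proof.
move=> mD mg fg /integrableP[mf foo]; apply/integrableP; split.
  exact/measurable_EFinP.
rewrite (le_lt_trans _ foo)// le_eqVlt; apply/orP; left; apply/eqP.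
apply: ae_eq_integral => //.
- by apply: measurableT_comp => //; exact/measurable_EFinP.
- exact: measurableT_comp.
- by refine (aeS fg _) => x fgx Dx; rewrite /= fgx.
Qed.

Lemma sqintP rho l r f : f \in sqint rho l r <->
  measurable_funC `]l, r[ f /\
  mu.-integrable `]l, r[ (EFin \o (fun x => rho x * abs2 (f x))).
Proof. by split; rewrite inE. Qed.

Lemma integrable_cst_itv l r (k : R) : mu.-integrable `]l, r[ (EFin \o cst k).
Proof.
apply/integrable_itvoo_cc; apply: continuous_itv_integrable.
by apply: continuous_subspaceT => x; exact: cvg_cst.
Qed.

Lemma sqint_bounded_mul l r p f (M : R) : measurable_fun `]l, r[ p ->
  (forall x, `|p x| <= M) -> f \in sqint (cst 1) l r ->
  (fun x => (p x)%:C * f x) \in sqint (cst 1) l r.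
Proof.
move=> mp pM /sqintP[[mr mi] intf]; apply/sqintP; split.
  split.
  - rewrite (_ : (fun x => _) = fun x => p x * complex.Re (f x)).
      exact: measurable_funM.
    by apply/funext => x; case: (f x) => u v /=; rewrite mul0r subr0.
  - rewrite (_ : (fun x => _) = fun x => p x * complex.Im (f x)).
      exact: measurable_funM.
    by apply/funext => x; case: (f x) => u v /=; rewrite mul0r addr0.
rewrite (_ : (fun x => _) = fun x => p x ^+ 2 * (cst 1 x * abs2 (f x))).
  apply: (@integrable_bounded_mul _ _ _ _ (M ^+ 2)) => //.
    exact: measurable_funX.
  move=> x _; rewrite normrX; apply: lerXn2r => //; rewrite ?nnegrE//.
  exact: le_trans (pM x).
apply/funext => x; rewrite abs2M !mul1r; congr (_ * _).
by rewrite /abs2 /= expr0n addr0.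
Qed.

(** Here p stands for rho2 / rho1. A weight bounded from above and below will be compared with the
    constant weight 1 in both directions. *)
Lemma sqint_weight l r (rho1 rho2 p : R -> R) (M : R) f :
  measurable_fun `]l, r[ rho2 -> measurable_fun `]l, r[ p ->
  (forall x, `|p x| <= M) ->
  {ae mu, forall x, `]l, r[%classic x -> p x * rho1 x = rho2 x} ->
  f \in sqint rho1 l r -> f \in sqint rho2 l r.
Proof.
move=> mrho2 mp pM pr /sqintP[mf intf]; apply/sqintP; split=> //.
apply: (@ae_eq_integrable _ (fun x => p x * (rho1 x * abs2 (f x)))) => //.
- by apply: measurable_funM => //; exact: measurable_abs2.
- by refine (aeS pr _) => x prx xlr; rewrite mulrA prx.
- exact: (@integrable_bounded_mul _ _ _ _ M).
Qed.

Lemma integrable_weighted_mul rho l r f g : measurable_fun `]l, r[ rho ->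
  f \in sqint rho l r -> g \in sqint rho l r ->
  mu.-integrable `]l, r[ (EFin \o (fun x => rho x * complex.Re (f x * g x))) /\
  mu.-integrable `]l, r[ (EFin \o (fun x => rho x * complex.Im (f x * g x))).
Proof.
move=> mrho /sqintP[[mfr mfi] intf] /sqintP[[mgr mgi] intg].
have intS : mu.-integrable `]l, r[ (EFin \o (fun x =>
    `|rho x * abs2 (f x)| + `|rho x * abs2 (g x)|)).
  apply: (@integrableD _ _ _ mu _ (measurable_itv _)
    (EFin \o (fun x => `|rho x * abs2 (f x)|))
    (EFin \o (fun x => `|rho x * abs2 (g x)|))); exact: integrable_norm.
have bnd (u : R) x : `|u| <= abs2 (f x) + abs2 (g x) ->
    (`|(rho x * u)%:E| <= `|(`|rho x * abs2 (f x)| + `|rho x * abs2 (g x)|)%:E|)%E.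
  move=> ub; rewrite lee_fin [leRHS]ger0_norm ?addr_ge0// !normrM.
  rewrite (ger0_norm (abs2_ge0 _)) (ger0_norm (abs2_ge0 (g x))) -mulrDr.
  exact: ler_wpM2l.
split; apply: le_integrable intS => //.
- apply/measurable_EFinP; apply: measurable_funM => //.
  rewrite (_ : (fun x => _) = fun x => complex.Re (f x) * complex.Re (g x) -
      complex.Im (f x) * complex.Im (g x)).
    by apply: measurable_funB; exact: measurable_funM.
  by apply/funext => x; case: (f x) => ? ?; case: (g x).
- move=> x _; apply: bnd; rewrite /abs2; case: (f x) => u v; case: (g x) => u' v' /=.
  rewrite ler_norml; have := sqr_ge0 (u - u'); have := sqr_ge0 (v - v').
  by have := sqr_ge0 (u + u'); have := sqr_ge0 (v + v'); nra.
- apply/measurable_EFinP; apply: measurable_funM => //.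
  rewrite (_ : (fun x => _) = fun x => complex.Re (f x) * complex.Im (g x) +
      complex.Im (f x) * complex.Re (g x)).
    by apply: measurable_funD; exact: measurable_funM.
  by apply/funext => x; case: (f x) => ? ?; case: (g x).
- move=> x _; apply: bnd; rewrite /abs2; case: (f x) => u v; case: (g x) => u' v' /=.
  rewrite ler_norml; have := sqr_ge0 (u - v'); have := sqr_ge0 (v - u').
  by have := sqr_ge0 (u + v'); have := sqr_ge0 (v + u'); nra.
Qed.

Lemma sqint_integrable l r f : f \in sqint (cst 1) l r ->
  mu.-integrable `]l, r[ (EFin \o (fun x => complex.Re (f x))) /\
  mu.-integrable `]l, r[ (EFin \o (fun x => complex.Im (f x))).
Proof.
move=> fL; have oneL : (fun _ => 1) \in sqint (cst 1) l r.
  apply/sqintP; split; first by split; exact: measurable_cst.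
  rewrite (_ : (fun x => _) = cst 1); first exact: integrable_cst_itv.
  by apply/funext => x; rewrite /abs2 /= expr1n expr0n addr0 mul1r.
have [|h1 h2] := integrable_weighted_mul _ fL oneL; first exact: measurable_cst.
split; [move: h1|move: h2].
- by rewrite (_ : (fun x => _) = fun x => complex.Re (f x))//;
    apply/funext => x; rewrite mulr1 mul1r.
- by rewrite (_ : (fun x => _) = fun x => complex.Im (f x))//;
    apply/funext => x; rewrite mulr1 mul1r.
Qed.

Definition continuousC l r F :=
  {within `[l, r], continuous (fun x => complex.Re (F x))} /\
  {within `[l, r], continuous (fun x => complex.Im (F x))}.

Lemma continuousC_sqint l r F : continuousC l r F -> F \in sqint (cst 1) l r.
Proof.
move=> [cr ci]; apply/sqintP; split.
  by split; apply/measurable_itvoo_cc; exact: continuous_itv_measurable.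
apply/integrable_itvoo_cc; apply: continuous_itv_integrable.
rewrite (_ : (fun x => _) = fun x => complex.Re (F x) * complex.Re (F x) +
  complex.Im (F x) * complex.Im (F x)).
  by move=> x; apply: cvgD; apply: cvgM; (exact: cr || exact: ci).
by apply/funext => x; rewrite mul1r /abs2 !expr2.
Qed.

Definition is_ACC l r F f :=
  is_AC l r (fun x => complex.Re (F x)) (fun x => complex.Re (f x)) /\
  is_AC l r (fun x => complex.Im (F x)) (fun x => complex.Im (f x)).

Lemma is_AC_eq l r (F f G g : R -> R) : (forall x, F x = G x) ->
  (forall x, f x = g x) -> is_AC l r F f -> is_AC l r G g.
Proof. by move=> /funext -> /funext ->. Qed.

Lemma is_ACC_continuous l r F f : l <= r -> is_ACC l r F f -> continuousC l r F.
Proof. by move=> lr [h1 h2]; split; [exact: is_AC_continuous lr h1|exact: is_AC_continuous lr h2]. Qed.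

(** The product rule is integration by parts on each subinterval [l, x]. *)
Lemma is_AC_prod l r (F f G g : R -> R) : l <= r -> is_AC l r F f ->
  is_AC l r G g -> is_AC l r (fun x => F x * G x) (fun x => F x * g x + G x * f x).
Proof.
move=> lr aF aG; have cF := is_AC_continuous lr aF.
have cG := is_AC_continuous lr aG.
have i1 := continuous_mul_integrable cF aG.1.
have i2 := continuous_mul_integrable cG aF.1.
split; first exact: (@integrableD _ _ _ mu _ (measurable_itv _)
  (EFin \o (fun x => F x * g x)) (EFin \o (fun x => G x * f x))).
move=> x /andP[lx xr].
have sub H h : is_AC l r H h -> is_AC l x H h.
  move=> [ih Hh]; split; first exact: integrable_itvS (lexx l) xr _.
  by move=> y /andP[ly yx]; apply: Hh; rewrite ly (le_trans yx).
rewrite RintegralD//; [|exact: integrable_itvS (lexx l) xr _..].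
by rewrite (is_AC_mul lx (sub _ _ aF) (sub _ _ aG)) addrC subrK.
Qed.

Lemma is_ACC_lin l r (c : C) F f G g : is_ACC l r F f -> is_ACC l r G g ->
  is_ACC l r (fun x => c * F x + G x) (fun x => c * f x + g x).
Proof.
move=> [fr fi] [gr gi]; case: c => u v; split.
- apply: is_AC_eq (is_AC_lin u fr (is_AC_lin (- v) fi gr)) => x;
    rewrite /=; [case: (F x) (G x)|case: (f x) (g x)] => ? ? [? ?] /=; ring.
- apply: is_AC_eq (is_AC_lin u fi (is_AC_lin v fr gi)) => x;
    rewrite /=; [case: (F x) (G x)|case: (f x) (g x)] => ? ? [? ?] /=; ring.
Qed.

Lemma is_ACC_prod l r F f G g : l <= r -> is_ACC l r F f -> is_ACC l r G g ->
  is_ACC l r (fun x => F x * G x) (fun x => F x * g x + G x * f x).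
Proof.
move=> lr [fr fi] [gr gi].
have p1 := is_AC_prod lr fr gr; have p2 := is_AC_prod lr fi gi.
have p3 := is_AC_prod lr fr gi; have p4 := is_AC_prod lr fi gr.
split.
- apply: is_AC_eq (is_AC_lin (-1) p2 p1) => x;
    case: (F x) (G x) (f x) (g x) => ? ? [? ?] [? ?] [? ?] /=; ring.
- apply: is_AC_eq (is_AC_lin 1 p3 p4) => x;
    case: (F x) (G x) (f x) (g x) => ? ? [? ?] [? ?] [? ?] /=; ring.
Qed.

Lemma ae_eqC_parts l r f g : ae_eqC l r f g <->
  {ae mu, forall x, `]l, r[%classic x -> complex.Re (f x) = complex.Re (g x)} /\
  {ae mu, forall x, `]l, r[%classic x -> complex.Im (f x) = complex.Im (g x)}.
Proof.
split=> [fg|[h1 h2]].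
  by split; refine (aeS fg _) => x fgx xlr; rewrite fgx.
refine (aeS2 h1 h2 _) => x r1 r2 xlr; move: (r1 xlr) (r2 xlr).
by case: (f x) (g x) => ? ? [? ?] /= -> ->.
Qed.

Lemma ae_eqC_sym l r f g : ae_eqC l r f g -> ae_eqC l r g f.
Proof. by move=> fg; refine (aeS fg _) => x fgx xlr; rewrite fgx. Qed.

Lemma ae_eqC_trans l r f g h : ae_eqC l r f g -> ae_eqC l r g h ->
  ae_eqC l r f h.
Proof. by move=> fg gh; refine (aeS2 fg gh _) => x fx gx xlr; rewrite fx// gx. Qed.

Lemma is_ACC_ae l r F f g : g \in sqint (cst 1) l r -> ae_eqC l r f g ->
  is_ACC l r F f -> is_ACC l r F g.
Proof.
move=> /sqint_integrable[ir ii] /ae_eqC_parts[er ei] [ar ai].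
by split; [exact: is_AC_ae er ar|exact: is_AC_ae ei ai].
Qed.

Lemma continuousC_ae_eq l r F G : l < r -> continuousC l r F ->
  continuousC l r G -> ae_eqC l r F G -> forall x, l <= x <= r -> F x = G x.
Proof.
move=> lr [Fr Fi] [Gr Gi] /ae_eqC_parts[er ei] x xlr.
have := continuous_ae_eq lr Fr Gr er xlr; have := continuous_ae_eq lr Fi Gi ei xlr.
by case: (F x) (G x) => ? ? [? ?] /= -> ->.
Qed.

(** F itself shows that the set searched by [xget] is inhabited, so the default 0 is never returned;
    any other continuous representative agrees with F on the closed interval. *)
Lemma bval_continuous l r F f x : l < r -> continuousC l r F ->
  ae_eqC l r f F -> l <= x <= r -> bval l r f x = F x.
Proof.
move=> lr cF fF xlr; rewrite /bval; case: xgetP => [z _|].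
  move=> [G [cGr cGi Gf <-]].
  apply: continuousC_ae_eq lr _ cF _ _ xlr => //; exact: ae_eqC_trans Gf fF.
move=> /(_ (F x)) []; exists F; split; [exact: cF.1|exact: cF.2| |by []].
exact: ae_eqC_sym.
Qed.

(** F and F1 are the continuous representatives themselves, so boundary values are plain evaluations
    at l and r. *)
Definition W2 l r F F1 G :=
  [/\ G \in sqint (cst 1) l r, is_ACC l r F F1 & is_ACC l r F1 G].

Lemma W2_continuous l r F F1 G : l <= r -> W2 l r F F1 G ->
  continuousC l r F /\ continuousC l r F1.
Proof. by move=> lr [_ a1 a2]; split; [exact: is_ACC_continuous lr a1|exact: is_ACC_continuous lr a2]. Qed.

Lemma W2_sobolev2 l r F F1 G : l < r -> W2 l r F F1 G -> sobolev2 l r F F1 G.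
Proof.
move=> lr w; have [c1 c2] := W2_continuous (ltW lr) w.
have [GL [a1 a2] [a3 a4]] := w.
by split=> //; [exact: continuousC_sqint|exact: continuousC_sqint| |];
  split; exact: is_AC_weak_deriv.
Qed.

Lemma sobolev2_W2 l r f f1 f2 : l < r -> sobolev2 l r f f1 f2 ->
  exists F F1, [/\ W2 l r F F1 f2, ae_eqC l r f F & ae_eqC l r f1 F1].
Proof.
move=> lr [fL f1L f2L [w1 w2] [w3 w4]].
have [ir ii] := sqint_integrable fL; have [i1r i1i] := sqint_integrable f1L.
have [i2r i2i] := sqint_integrable f2L.
have [F1r aF1r e1r] := weak_deriv_AC lr i1r i2r w3.
have [F1i aF1i e1i] := weak_deriv_AC lr i1i i2i w4.
have [Fr aFr er] := weak_deriv_AC lr ir i1r w1.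
have [Fi aFi ei] := weak_deriv_AC lr ii i1i w2.
pose F x : C := Fr x +i* Fi x; pose F1 x : C := F1r x +i* F1i x.
have aF1 : is_ACC l r F1 f2 by [].
have eF1 : ae_eqC l r f1 F1 by apply/ae_eqC_parts.
exists F, F1; split=> //; last by apply/ae_eqC_parts.
split=> //; apply: (@is_ACC_ae _ _ _ f1) => //.
by apply: continuousC_sqint; exact: is_ACC_continuous (ltW lr) aF1.
Qed.

Lemma W2_lin l r (c : C) F F1 G F' F1' G' : W2 l r F F1 G -> W2 l r F' F1' G' ->
  W2 l r (fun x => c * F x + F' x) (fun x => c * F1 x + F1' x)
    (fun x => c * G x + G' x).
Proof.
move=> [GL a1 a2] [G'L a1' a2']; split; [|exact: is_ACC_lin|exact: is_ACC_lin].
exact: (sqintD (sqintZ c GL) G'L).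
Qed.

Lemma W2_conj l r F F1 G : W2 l r F F1 G ->
  W2 l r (fun x => (F x)^*%C) (fun x => (F1 x)^*%C) (fun x => (G x)^*%C).
Proof.
have cj H h : is_ACC l r H h -> is_ACC l r (fun x => (H x)^*%C) (fun x => (h x)^*%C).
  move=> [hr hi]; split.
    by apply: is_AC_eq hr => x; [case: (H x)|case: (h x)].
  have [ii _] := hi; have z := is_AC_lin (-1) hi (is_AC_lin (-1) hr hr).
  apply: is_AC_eq z => x; [case: (H x)|case: (h x)] => ? ? /=; ring.
move=> [/sqintP[[mr mi] intG] a1 a2]; split; [|exact: cj|exact: cj].
apply/sqintP; split.
  split.
  - by rewrite (_ : (fun x => _) = fun x => complex.Re (G x))//;
      apply/funext => x; case: (G x).
  - rewrite (_ : (fun x => _) = fun x => - complex.Im (G x)).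
      exact: measurableT_comp.
    by apply/funext => x; case: (G x).
rewrite (_ : (fun x => _) = (fun x => cst 1 x * abs2 (G x)))//.
by apply/funext => x; case: (G x) => ? ?; rewrite /abs2 /= sqrrN.
Qed.

End ComplexFunctions.

(** * Second-order initial value problems *)

Section ComplexODE.
Context {R : realType}.
Local Notation mu := (@lebesgue_measure R).
Local Notation C := R[i].

Lemma Rintegral_itvoo_cst (l r k : R) : l < r ->
  \int[mu]_(x in `]l, r[) k = k * (r - l).
Proof.
move=> lr; rewrite Rintegral_cst; last exact: measurable_itv.
by have := lebesgue_measure_itv `]l, r[; rewrite /= lte_fin lr -EFinD => ->.
Qed.

Lemma sqr_Rintegral_le (l r : R) (f : R -> R) : l < r ->
  mu.-integrable `]l, r[ (EFin \o f) ->
  mu.-integrable `]l, r[ (EFin \o (fun x => f x ^+ 2)) ->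
  (\int[mu]_(x in `]l, r[) `|f x|) ^+ 2 <=
  (r - l) * \int[mu]_(x in `]l, r[) (f x ^+ 2).
Proof.
move=> lr ifi if2; set X := \int[mu]_(x in _) `|f x|.
have d0 : 0 < r - l by rewrite subr_gt0.
pose k := X / (r - l).
have mI : measurable (`]l, r[%classic : set R) by exact: measurable_itv.
have iabs : mu.-integrable `]l, r[ (EFin \o (fun x => `|f x|)) by exact: integrable_norm.
(* Here k is the mean of |f|; the inequality says that the variance of |f| is nonnegative. *)
have : 0 <= \int[mu]_(x in `]l, r[) ((`|f x| - k) ^+ 2).
  by apply: Rintegral_ge0 => x _; exact: sqr_ge0.
rewrite (@eq_Rintegral _ _ _ mu _ (fun x => (f x ^+ 2 + (- (2 * k)) * `|f x|) + k ^+ 2)); last first.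
  by move=> x _; rewrite -(real_normK (num_real (f x))); ring.
have i1 : mu.-integrable `]l, r[ (EFin \o (fun x => - (2 * k) * `|f x|)).
  exact: (@integrableZl _ _ _ mu _ mI _ (EFin \o (fun x => `|f x|))).
rewrite RintegralD//; last 2 first.
- exact: (@integrableD _ _ _ mu _ mI (EFin \o (fun x => f x ^+ 2))
    (EFin \o (fun x => - (2 * k) * `|f x|))).
- exact: integrable_cst_itv.
rewrite RintegralD// RintegralZl// -/X Rintegral_itvoo_cst//.
set Y := \int[mu]_(x in _) (f x ^+ 2).
have -> : Y + - (2 * k) * X + k ^+ 2 * (r - l) = Y - X ^+ 2 / (r - l).
  by rewrite /k; field; rewrite gt_eqF.
by rewrite subr_ge0 ler_pdivrMr// mulrC.
Qed.

Lemma sqr_sum6_le (a b c d e f : R) : (a + b + c + d + (e + f)) ^+ 2 <=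
  8 * (a ^+ 2 + b ^+ 2 + (c ^+ 2 + d ^+ 2) + (e ^+ 2 + f ^+ 2)).
Proof.
have two (x y : R) : (x + y) ^+ 2 <= 2 * (x ^+ 2 + y ^+ 2).
  by have := sqr_ge0 (x - y); nra.
have := two (a + b + c + d) (e + f); have := two e f.
rewrite -[a + b + c + d]addrA.
have := two (a + b) (c + d); have := two a b; have := two c d.
have := sqr_ge0 e; have := sqr_ge0 f.
by lra.
Qed.

(** One inequality for each row of the real system: the first two rows have no source term, the last
    two carry the real and imaginary parts of the source. *)
Lemma le_sum6 (a b c d x y : R) : 0 <= a -> 0 <= b -> 0 <= c -> 0 <= d ->
  0 <= x -> 0 <= y -> let S := a + b + c + d + (x + y) in
  [/\ a + 0 <= S, b + 0 <= S, c + x <= S & d + y <= S].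
Proof. by move=> a0 b0 c0 d0 x0 y0 /=; split; lra. Qed.

Lemma le_weighted_sum (d Yr Yi f g Xr Xi : R) : 0 <= d -> 0 <= Yr -> 0 <= Yi ->
  0 <= f -> 0 <= g -> Xr ^+ 2 <= d * Yr -> Xi ^+ 2 <= d * Yi ->
  f + g + (Xr ^+ 2 + Xi ^+ 2) <= (1 + d) * (Yr + Yi + f + g).
Proof. by move=> *; nra. Qed.

Lemma sqint_boundedC_mul (l r K : R) (P F : R -> C) :
  measurable_fun `]l, r[ (fun x => complex.Re (P x)) ->
  measurable_fun `]l, r[ (fun x => complex.Im (P x)) ->
  (forall x, `|complex.Re (P x)| <= K) -> (forall x, `|complex.Im (P x)| <= K) ->
  F \in sqint (cst 1) l r -> (fun x => P x * F x) \in sqint (cst 1) l r.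
Proof.
move=> mr mi br bi FL.
have h1 := sqint_bounded_mul mr br FL.
have h2 := sqintZ 'i%C (sqint_bounded_mul mi bi FL).
rewrite (_ : (fun x => P x * F x) = (fun x => (complex.Re (P x))%:C * F x) +
  (fun x => 'i%C * ((complex.Im (P x))%:C * F x))); first exact: sqintD h1 h2.
apply/funext => x; rewrite [RHS]/=.
transitivity ((complex.Re (P x))%:C * F x + 'i%C * ((complex.Im (P x))%:C * F x)) => //.
by case: (P x) => u v; case: (F x) => u' v' /=; apply/eqP; rewrite eq_complex /=;
  apply/andP; split; apply/eqP; ring.
Qed.

Context (l r K : R) (P : R -> C).
Context (lr : l < r) (K1 : 1 <= K).
Context (mPr : measurable_fun setT (fun x => complex.Re (P x))).
Context (mPi : measurable_fun setT (fun x => complex.Im (P x))).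
Context (PrK : forall x, `|complex.Re (P x)| <= K).
Context (PiK : forall x, `|complex.Im (P x)| <= K).

Let K0 : 0 <= K. Proof. exact: le_trans K1. Qed.

(* F'' = P F + H as a first-order real system for (Re F, Im F, Re F', Im F'). *)
Let sysm (i j : 'I_4) (t : R) : R := match val i, val j with
  | 0%N, 2%N => 1 | 1%N, 3%N => 1
  | 2%N, 0%N => complex.Re (P t) | 2%N, 1%N => - complex.Im (P t)
  | 3%N, 0%N => complex.Im (P t) | 3%N, 1%N => complex.Re (P t)
  | _, _ => 0 end.
Let sysg (H : R -> C) (i : 'I_4) (t : R) : R := match val i with
  | 2%N => complex.Re (H t) | 3%N => complex.Im (H t) | _ => 0 end.
Let sysy (F F1 : R -> C) (i : 'I_4) (t : R) : R := match val i with
  | 0%N => complex.Re (F t) | 1%N => complex.Im (F t)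
  | 2%N => complex.Re (F1 t) | _ => complex.Im (F1 t) end.

Let sysm_measurable i j : measurable_fun `[l, r] (sysm i j).
Proof.
have mr : measurable_fun `[l, r] (fun x => complex.Re (P x)) by exact: measurable_funTS.
have mi : measurable_fun `[l, r] (fun x => complex.Im (P x)) by exact: measurable_funTS.
case: i => [[|[|[|[|//]]]] ?]; case: j => [[|[|[|[|//]]]] ?]; rewrite /sysm //=;
  exact: measurableT_comp.
Qed.

Let sysm_bound i j x : l <= x <= r -> `|sysm i j x| <= K.
Proof.
move=> _; case: i => [[|[|[|[|//]]]] ?]; case: j => [[|[|[|[|//]]]] ?];
  by rewrite /sysm /= ?normr0 ?normr1 ?normrN.
Qed.

Let sysg_integrable H i : H \in sqint (cst 1) l r ->
  mu.-integrable `[l, r] (EFin \o sysg H i).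
Proof.
move=> /sqint_integrable[/integrable_itvoo_cc h1 /integrable_itvoo_cc h2].
have h0 : mu.-integrable `[l, r] (EFin \o cst (0 : R)).
  by apply/integrable_itvoo_cc; exact: integrable_cst_itv.
by case: i => [[|[|[|[|//]]]] ?].
Qed.

Let sysE F F1 H (i : 'I_4) t :
  \sum_(j < 4) sysm i j t * sysy F F1 j t + sysg H i t =
  sysy F1 (fun x => P x * F x + H x) i t.
Proof.
rewrite !big_ord_recl big_ord0 /sysm /sysy /sysg /=.
case: (P t) (F t) (F1 t) (H t) => ? ? [? ?] [? ?] [? ?].
by case: i => [[|[|[|[|//]]]] ?] /=; ring.
Qed.

Lemma ode_exists (H : R -> C) (s0 s1 : C) : H \in sqint (cst 1) l r ->
  exists F F1, [/\ W2 l r F F1 (fun x => P x * F x + H x), F l = s0 & F1 l = s1].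
Proof.
move=> HL.
have [y [yl yAC]] := @linear_system_exists R 4 l r K sysm (sysg H) (ltW lr) K0
  sysm_measurable sysm_bound (fun i => sysg_integrable i HL)
  (sysy (fun _ => s0) (fun _ => s1) ^~ 0).
pose i0 : 'I_4 := @Ordinal 4 0 isT; pose i1 : 'I_4 := @Ordinal 4 1 isT.
pose i2 : 'I_4 := @Ordinal 4 2 isT; pose i3 : 'I_4 := @Ordinal 4 3 isT.
pose F x : C := y i0 x +i* y i1 x; pose F1 x : C := y i2 x +i* y i3 x.
have yE j x : y j x = sysy F F1 j x.
  by case: j => [[|[|[|[|//]]]] p]; rewrite /sysy /=; congr (y _ x); exact: val_inj.
have AC i : is_AC l r (y i) (sysy F1 (fun x => P x * F x + H x) i).
  apply: is_AC_eq (yAC i) => // x; rewrite -sysE.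
  by congr (_ + _); apply: eq_bigr => j _; rewrite yE.
have a1 : is_ACC l r F F1 by split; [exact: (AC i0)|exact: (AC i1)].
have a2 : is_ACC l r F1 (fun x => P x * F x + H x) by split; [exact: (AC i2)|exact: (AC i3)].
exists F, F1; split.
- split=> //; apply: sqintD => //; apply: (@sqint_boundedC_mul _ _ K) => //.
  + exact: measurable_funTS.
  + exact: measurable_funTS.
  + by apply: continuousC_sqint; exact: is_ACC_continuous (ltW lr) a1.
- by rewrite /F !yl /sysy /=; case: (s0).
- by rewrite /F1 !yl /sysy /=; case: (s1).
Qed.

(** The bound for first-order systems involves the L1 norm of the source; the Cauchy-Schwarz
    inequality on the bounded interval converts it into the L2 norm. *)
Lemma ode_bound : exists2 M, 0 <= M & forall F F1 H,
  H \in sqint (cst 1) l r -> W2 l r F F1 (fun x => P x * F x + H x) ->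
  forall x, l <= x <= r ->
  abs2 (F x) <= M * (\int[mu]_(t in `]l, r[) abs2 (H t) + abs2 (F l) + abs2 (F1 l)) /\
  abs2 (F1 x) <= M * (\int[mu]_(t in `]l, r[) abs2 (H t) + abs2 (F l) + abs2 (F1 l)).
Proof.
pose E := 2 * expR ((2 * 4%:R * K + 1) * (r - l)) : R.
have E0 : 0 <= E by rewrite mulr_ge0// expR_ge0.
have d0 : 0 < r - l by rewrite subr_gt0.
(* E is the constant for one real component. The 2 adds real and imaginary parts, the 8 squares a
   sum of six terms, and 1 + (r - l) comes from the Cauchy-Schwarz inequality. *)
exists (2 * E ^+ 2 * (8 * (1 + (r - l)))).
  by rewrite !mulr_ge0 ?sqr_ge0// addr_ge0// ltW.
move=> F F1 H HL w.
have [ihr ihi] := sqint_integrable HL.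
have [_ intH] := (sqintP _ _ _ _).1 HL.
have part2 (u : R -> R) : mu.-integrable `]l, r[ (EFin \o u) ->
    (forall x, u x ^+ 2 <= abs2 (H x)) ->
    mu.-integrable `]l, r[ (EFin \o (fun x => u x ^+ 2)).
  move=> iu ub; apply: le_integrable intH => //.
    apply/measurable_EFinP; apply: measurable_funX.
    by apply/measurable_EFinP; exact: measurable_int iu.
  by move=> x _; rewrite /= lee_fin mul1r !ger0_norm ?sqr_ge0 ?abs2_ge0.
have i2r : mu.-integrable `]l, r[ (EFin \o (fun x => complex.Re (H x) ^+ 2)).
  by apply: part2 => // x; rewrite lerDl sqr_ge0.
have i2i : mu.-integrable `]l, r[ (EFin \o (fun x => complex.Im (H x) ^+ 2)).
  by apply: part2 => // x; rewrite lerDr sqr_ge0.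
have HE : \int[mu]_(t in `]l, r[) abs2 (H t) =
    \int[mu]_(t in `]l, r[) (complex.Re (H t) ^+ 2) +
    \int[mu]_(t in `]l, r[) (complex.Im (H t) ^+ 2) by rewrite -RintegralD.
pose Xr := \int[mu]_(t in `]l, r[) `|complex.Re (H t)|.
pose Xi := \int[mu]_(t in `]l, r[) `|complex.Im (H t)|.
have Xr0 : 0 <= Xr by exact: Rintegral_ge0.
have Xi0 : 0 <= Xi by exact: Rintegral_ge0.
have csr := sqr_Rintegral_le lr ihr i2r; have csi := sqr_Rintegral_le lr ihi i2i.
pose A := `|complex.Re (F l)| + `|complex.Im (F l)| + `|complex.Re (F1 l)| +
  `|complex.Im (F1 l)| + (Xr + Xi).
have gA i : `|sysy F F1 i l| + \int[mu]_(t in `[l, r]) `|sysg H i t| <= A.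
  have icc u : mu.-integrable `]l, r[ (EFin \o u) ->
      \int[mu]_(t in `[l, r]) `|u t| = \int[mu]_(t in `]l, r[) `|u t|.
    by move=> iu; rewrite Rintegral_itvoo//; exact: integrable_norm.
  have i0 : \int[mu]_(t in `[l, r]) `|0 : R| = 0.
    by rewrite Rintegral_cst ?normr0 ?mul0r//; exact: measurable_itv.
  have [b0 b1 b2 b3] := le_sum6 (normr_ge0 (complex.Re (F l)))
    (normr_ge0 (complex.Im (F l))) (normr_ge0 (complex.Re (F1 l)))
    (normr_ge0 (complex.Im (F1 l))) Xr0 Xi0.
  by case: i => [[|[|[|[|//]]]] ?]; rewrite /sysy /sysg /= ?i0 ?(icc _ ihr) ?(icc _ ihi).
have A0 : 0 <= A by rewrite /A !addr_ge0.
have [_ a1 a2] := w.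
have AC i : is_AC l r (sysy F F1 i)
    (fun t => \sum_(j < 4) sysm i j t * sysy F F1 j t + sysg H i t).
  rewrite (_ : (fun t => _) = sysy F1 (fun x => P x * F x + H x) i); last first.
    by apply/funext => t; exact: sysE.
  by case: i => [[|[|[|[|//]]]] ?]; [exact: a1.1|exact: a1.2|exact: a2.1|exact: a2.2].
have bound := @linear_system_bound R 4 l r K sysm (sysg H) (ltW lr) K0
  sysm_measurable sysm_bound (fun i => sysg_integrable i HL) _ A AC gA.
have bE i x : l <= x <= r -> sysy F F1 i x ^+ 2 <= E ^+ 2 * A ^+ 2.
  move=> xlr; rewrite -exprMn -(real_normK (num_real (sysy F F1 i x))).
  apply: lerXn2r; rewrite ?nnegrE ?mulr_ge0//.
  by apply: le_trans (bound i x xlr) _; rewrite /E mulrAC.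
have A2 : A ^+ 2 <= 8 * (1 + (r - l)) *
    (\int[mu]_(t in `]l, r[) abs2 (H t) + abs2 (F l) + abs2 (F1 l)).
  apply: le_trans (sqr_sum6_le _ _ _ _ _ _) _.
  rewrite -mulrA ler_pM2l// !real_normK ?num_real// HE.
  apply: le_weighted_sum => //; rewrite ?abs2_ge0 ?(ltW d0)//.
  - by apply: Rintegral_ge0 => x _; exact: sqr_ge0.
  - by apply: Rintegral_ge0 => x _; exact: sqr_ge0.
have fin u v : u ^+ 2 <= E ^+ 2 * A ^+ 2 -> v ^+ 2 <= E ^+ 2 * A ^+ 2 ->
    u ^+ 2 + v ^+ 2 <= 2 * E ^+ 2 * (8 * (1 + (r - l))) *
      (\int[mu]_(t in `]l, r[) abs2 (H t) + abs2 (F l) + abs2 (F1 l)).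
  move=> ub vb; apply: (@le_trans _ _ (2 * E ^+ 2 * A ^+ 2)); last first.
    by rewrite -[leRHS]mulrA; apply: ler_wpM2l A2; rewrite mulr_ge0// sqr_ge0.
  by rewrite -mulrA mulr_natl mulr2n lerD.
move=> x xlr; split; apply: fin.
- exact: (bE (@Ordinal 4 0 isT) x xlr).
- exact: (bE (@Ordinal 4 1 isT) x xlr).
- exact: (bE (@Ordinal 4 2 isT) x xlr).
- exact: (bE (@Ordinal 4 3 isT) x xlr).
Qed.

End ComplexODE.

(* The form is bilinear and symmetric, so that it can be fed to Green's formula
   without conjugations; the inner product of u and w is form u (conj w), and N
   is the squared norm. *)
Record conj_form {R : realType} (H : lmodType R[i]) (N : H -> R) := ConjForm {
  cf_form : H -> H -> R[i];
  cf_conj : H -> H;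
  cf_formDl : forall c u u' w,
    cf_form (c *: u + u') w = c * cf_form u w + cf_form u' w;
  cf_formC : forall u w, cf_form u w = cf_form w u;
  cf_conj_lin : forall c u u',
    cf_conj (c *: u + u') = c^*%C *: cf_conj u + cf_conj u';
  cf_normE : forall u, cf_form u (cf_conj u) = (N u)%:C;
  cf_norm_eq0 : forall u, N u = 0 -> u = 0;
  cf_norm_ge0 : forall u, 0 <= N u
}.

(* T u v s0 s1 t0 t1 is the graph u |-> v of a maximal second order operator,
   where s0, s1 and t0, t1 are the values of u and u' at the two end points. *)
Record green_system {R : realType} (H : lmodType R[i]) (N : H -> R)
    (cf : conj_form N) (sgn : R[i])
    (T : H -> H -> R[i] -> R[i] -> R[i] -> R[i] -> Prop) : Prop := GreenSystem {
  gs_sign_neq0 : sgn != 0;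
  gs_lin : forall c u v s0 s1 t0 t1 u' v' s0' s1' t0' t1',
    T u v s0 s1 t0 t1 -> T u' v' s0' s1' t0' t1' ->
    T (c *: u + u') (c *: v + v') (c * s0 + s0') (c * s1 + s1')
      (c * t0 + t0') (c * t1 + t1');
  gs_trace0 : forall v s0 s1 t0 t1, T 0 v s0 s1 t0 t1 ->
    [/\ s0 = 0, s1 = 0, t0 = 0 & t1 = 0];
  gs_solve : forall lam, exists2 B, 0 <= B & forall v s0 s1, exists u t0 t1,
    [/\ T u (v + lam *: u) s0 s1 t0 t1, N u <= B * (N v + abs2 s0 + abs2 s1),
        abs2 t0 <= B * (N v + abs2 s0 + abs2 s1) &
        abs2 t1 <= B * (N v + abs2 s0 + abs2 s1)];
  gs_uniq : forall lam u t0 t1, T u (lam *: u) 0 0 t0 t1 -> u = 0;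
  gs_green : forall u v s0 s1 t0 t1 u' v' s0' s1' t0' t1',
    T u v s0 s1 t0 t1 -> T u' v' s0' s1' t0' t1' ->
    cf_form cf v u' - cf_form cf u v' =
    sgn * ((s0 * s1' - s1 * s0') - (t0 * t1' - t1 * t0'));
  gs_conjT : forall u v s0 s1 t0 t1, T u v s0 s1 t0 t1 ->
    T (cf_conj cf u) (cf_conj cf v) s0^*%C s1^*%C t0^*%C t1^*%C
}.

(** * Representatives of L2 classes and of bounded coefficients *)

Section L2classes.
Context {R : realType}.
Local Notation mu := (@lebesgue_measure R).
Local Notation C := R[i].
Local Open Scope quotient_scope.
Implicit Types (l r : R) (rho : R -> R) (f g : R -> C).

Lemma represents_pi rho l r (f : sqfun rho l r) :
  represents (\pi_(L2 rho l r) f) (val f).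
Proof.
have : repr (\pi_(L2 rho l r) f) - f \in @nullfun _ rho l r.
  by rewrite Quotient.idealrBE reprK.
rewrite inE /= => h; refine (aeS h _) => x hx xlr.
by have /eqP := hx xlr; rewrite /= subr_eq0 => /eqP.
Qed.

Lemma represents_exists rho l r f : f \in sqint rho l r ->
  exists u : L2 rho l r, represents u f.
Proof.
by move=> fL; exists (\pi_(L2 rho l r) (exist _ f fL : sqfun rho l r));
  exact: represents_pi.
Qed.

Lemma represents_inj rho l r (u v : L2 rho l r) f :
  represents u f -> represents v f -> u = v.
Proof.
move=> uf vf; rewrite -[u]reprK -[v]reprK; apply/eqP.
rewrite -[_ == _]Quotient.idealrBE inE /=.
refine (aeS2 uf vf _) => x ux vx xlr.
transitivity (L2repr u x - L2repr v x) => //.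
by rewrite ux// vx// subrr.
Qed.

Lemma represents_lin rho l r (c : C) (u v : L2 rho l r) f g :
  represents u f -> represents v g ->
  represents (c *: u + v) (fun x => c * f x + g x).
Proof.
move=> uf vg.
have e : c *: u + v = \pi_(L2 rho l r) (sqfunZ c (repr u) + repr v).
  by rewrite L2_piD -L2scale_pi !reprK.
rewrite e; apply: ae_eqC_trans (represents_pi _) _.
refine (aeS2 uf vg _) => x ux vx xlr.
transitivity (c * L2repr u x + L2repr v x) => //.
by rewrite ux// vx.
Qed.

Lemma represents0 rho l r : represents (0 : L2 rho l r) (fun _ => 0).
Proof.
have := represents_lin (-1) (f := L2repr 0) (g := L2repr 0)
  (aeW _ (fun _ _ => erefl _)) (aeW _ (fun _ _ => erefl _)) :
  represents (_ : L2 rho l r) _.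
rewrite scaleN1r addNr => h; apply: ae_eqC_trans h _.
by apply: aeW => x _ /=; rewrite mulN1r addNr.
Qed.

Lemma represents_repr rho l r (u : L2 rho l r) : represents u (L2repr u).
Proof. exact: aeW. Qed.

Lemma L2repr_sqint rho l r (u : L2 rho l r) : L2repr u \in sqint rho l r.
Proof. exact: valP. Qed.

Lemma bounded_version l r (p : R -> R) : Linfty l r p ->
  exists (pt : R -> R) (M : R), [/\ measurable_fun setT pt, forall x, `|pt x| <= M &
    {ae mu, forall x, `]l, r[%classic x -> pt x = p x}].
Proof.
move=> [mp [M pM]].
(* Truncation at the absolute value of M keeps the two levels in order whatever the sign of M. *)
pose pt x := Num.max (- `|M|) (Num.min `|M| ((p \_ `]l, r[) x)).
exists pt, `|M|; split.
- apply: measurable_maxr; first exact: measurable_cst.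
  apply: measurable_minr; first exact: measurable_cst.
  exact: (measurable_restrictT p (measurable_itv `]l, r[)).1 mp.
- move=> x; rewrite ler_norml /pt le_max lexx /= ge_max.
  by rewrite (le_trans _ (normr_ge0 M)) ?oppr_le0//= ge_min lexx.
- refine (aeS pM _) => x px xlr; rewrite /pt patchT ?inE//.
  have := le_trans (px xlr) (ler_norm M); rewrite ler_norml => /andP[h1 h2].
  by rewrite (min_idPr h2) (max_idPr h1).
Qed.

Lemma positive_version l r (p : R -> R) : Linfty l r p -> uniformly_positive l r p ->
  exists (pt : R -> R) (c M : R), [/\ measurable_fun setT pt, 0 < c, forall x, c <= pt x <= M &
    {ae mu, forall x, `]l, r[%classic x -> pt x = p x}].
Proof.
move=> hp [c c0 pc]; have [p1 [M [mp1 p1M p1E]]] := bounded_version hp.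
exists (fun x => Num.max c (p1 x)), c, (Num.max c M); split=> //.
- by apply: measurable_maxr.
- move=> x; rewrite le_max lexx /= ge_max !le_max lexx /=.
  by rewrite (le_trans (ler_norm _) (p1M x)) orbT.
- refine (aeS2 pc p1E _) => x px qx xlr; rewrite qx//.
  by rewrite (max_idPr (px xlr)).
Qed.

End L2classes.

Lemma le_sum3_weight (R : realFieldType) (M X a b d : R) : 0 <= M -> 0 <= a ->
  0 <= b -> 0 <= d -> X <= M * a -> X + b + d <= (1 + M) * (a + b + d).
Proof. by move=> *; nra. Qed.

(** * The maximal Sturm-Liouville operator *)

Section MaximalOperator.
Context {R : realType}.
Local Notation mu := (@lebesgue_measure R).
Local Notation C := R[i].
Context (l r : R) (rho q : R -> R).
Implicit Types (u v w : L2 rho l r) (F G : R -> C).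

Definition sl_max u v (s0 s1 t0 t1 : C) := exists F F1 G,
  [/\ W2 l r F F1 G, represents u F,
      represents v (fun x => ((rho x)^-1)%:C * tau q F G x) &
      [/\ F l = s0, F1 l = s1, F r = t0 & F1 r = t1]].

Definition L2sqnorm u : R := \int[mu]_(x in `]l, r[) (rho x * abs2 (L2repr u x)).

Definition L2form u w : C :=
  (\int[mu]_(x in `]l, r[) (rho x * complex.Re (L2repr u x * L2repr w x))) +i*
  (\int[mu]_(x in `]l, r[) (rho x * complex.Im (L2repr u x * L2repr w x))).

Context (lr : l < r) (mrho : measurable_fun `]l, r[ rho).
Context (mq : measurable_fun `]l, r[ q).
(** [rt] and [qt] are versions of [rho] and [q] that satisfy their bounds at every point, as the
    estimates for differential equations require; they may be exchanged with the originals under any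
    integral. *)
Context (rt qt : R -> R) (c M : R) (c0 : 0 < c).
Context (mrt : measurable_fun setT rt) (rtb : forall x, c <= rt x <= M).
Context (rtE : {ae mu, forall x, `]l, r[%classic x -> rt x = rho x}).
Context (mqt : measurable_fun setT qt) (qtM : forall x, `|qt x| <= M).
Context (qtE : {ae mu, forall x, `]l, r[%classic x -> qt x = q x}).

Let rt0 x : 0 < rt x. Proof. by case/andP: (rtb x) => h _; exact: lt_le_trans h. Qed.

Let M0 : 0 < M. Proof. by case/andP: (rtb 0) => h1 /(le_trans h1); exact: lt_le_trans. Qed.

Let rtM x : `|rt x| <= M.
Proof. by rewrite gtr0_norm//; case/andP: (rtb x). Qed.

Let mI : measurable (`]l, r[%classic : set R). Proof. exact: measurable_itv. Qed.

Let mrtI : measurable_fun `]l, r[ rt. Proof. exact: measurable_funTS. Qed.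

Let sq_rho1 F : F \in sqint rho l r -> F \in sqint (cst 1) l r.
Proof.
apply: (@sqint_weight _ _ _ rho (cst 1) (fun x => (rt x)^-1) c^-1).
- exact: measurable_cst.
- rewrite (_ : (fun x => _) = (fun x => (rt x) `^ (-1))).
    by apply: (measurableT_comp (measurable_powR _)).
  by apply/funext => x; rewrite powR_inv1// ltW.
- move=> x; rewrite ger0_norm ?invr_ge0 ?(ltW (rt0 x))//.
  by rewrite lef_pV2 ?posrE//; case/andP: (rtb x).
- by refine (aeS rtE _) => x rx xlr; rewrite -rx// mulVf// gt_eqF.
Qed.

Let sq_1rho F : F \in sqint (cst 1) l r -> F \in sqint rho l r.
Proof.
apply: (@sqint_weight _ _ _ (cst 1) rho rt M) => //.
by refine (aeS rtE _) => x rx xlr; rewrite -rx// mulr1.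
Qed.

Let sq_W2 F F1 G : W2 l r F F1 G -> F \in sqint rho l r.
Proof.
move=> w; have [cF _] := W2_continuous (ltW lr) w.
by apply: sq_1rho; exact: continuousC_sqint.
Qed.

Let ae_Rint (f g : R -> R) : mu.-integrable `]l, r[ (EFin \o f) ->
  measurable_fun `]l, r[ g -> {ae mu, forall x, `]l, r[%classic x -> f x = g x} ->
  \int[mu]_(x in `]l, r[) f x = \int[mu]_(x in `]l, r[) g x.
Proof. by move=> ifi mg fg; apply: ae_eq_Rintegral => //; exact: ae_eq_integrable fg ifi. Qed.

Lemma L2sqnormE u F : F \in sqint rho l r -> represents u F ->
  L2sqnorm u = \int[mu]_(x in `]l, r[) (rho x * abs2 (F x)).
Proof.
move=> FL uF; apply: ae_eq_Rintegral.
- by have [] := (sqintP _ _ _ _).1 (L2repr_sqint u).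
- by have [] := (sqintP _ _ _ _).1 FL.
- by refine (aeS uF _) => x ux xlr; rewrite ux.
Qed.

Lemma L2formE u w F G : F \in sqint rho l r -> G \in sqint rho l r ->
  represents u F -> represents w G -> L2form u w =
  (\int[mu]_(x in `]l, r[) (rho x * complex.Re (F x * G x))) +i*
  (\int[mu]_(x in `]l, r[) (rho x * complex.Im (F x * G x))).
Proof.
move=> FL GL uF wG.
have [i1 i2] := integrable_weighted_mul mrho (L2repr_sqint u) (L2repr_sqint w).
have [i3 i4] := integrable_weighted_mul mrho FL GL.
by congr (_ +i* _); apply: ae_eq_Rintegral => //;
  refine (aeS2 uF wG _) => x ux wx xlr; rewrite ux// wx.
Qed.

Lemma L2formC u w : L2form u w = L2form w u.
Proof.
by congr (_ +i* _); apply: eq_Rintegral => x _; rewrite (mulrC (L2repr u x)).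
Qed.

Lemma L2formDl (k : C) u u' w :
  L2form (k *: u + u') w = k * L2form u w + L2form u' w.
Proof.
have rep := represents_lin k (represents_repr u) (represents_repr u').
have uL := L2repr_sqint u; have u'L := L2repr_sqint u'; have wL := L2repr_sqint w.
rewrite (L2formE _ wL rep (represents_repr w)); last exact: (sqintD (sqintZ k uL) u'L).
have [i1 i2] := integrable_weighted_mul mrho uL wL.
have [i3 i4] := integrable_weighted_mul mrho u'L wL.
have iZ (a : R) f : mu.-integrable `]l, r[ (EFin \o f) ->
    mu.-integrable `]l, r[ (EFin \o (fun x => a * f x)).
  by move=> ifi; exact: (@integrableZl _ _ _ mu _ mI a (EFin \o f)).
have iD (f g : R -> R) : mu.-integrable `]l, r[ (EFin \o f) ->
    mu.-integrable `]l, r[ (EFin \o g) ->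
    mu.-integrable `]l, r[ (EFin \o (fun x => f x + g x)).
  by move=> ifi igi; exact: (@integrableD _ _ _ mu _ mI (EFin \o f) (EFin \o g)).
case: k {rep} => k1 k2; rewrite /L2form.
apply/eqP; rewrite eq_complex /=; apply/andP; split; apply/eqP.
- rewrite (@eq_Rintegral _ _ _ mu _ (fun x =>
    (k1 * (rho x * complex.Re (L2repr u x * L2repr w x)) +
     (- k2) * (rho x * complex.Im (L2repr u x * L2repr w x))) +
     rho x * complex.Re (L2repr u' x * L2repr w x))); last first.
    by move=> x _; case: (L2repr u x) => ? ?; case: (L2repr u' x) => ? ?;
      case: (L2repr w x) => ? ? /=; ring.
  rewrite RintegralD//; [|by apply: iD; exact: iZ].
  by rewrite RintegralD ?RintegralZl// ?mulNr//; exact: iZ.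
- rewrite (@eq_Rintegral _ _ _ mu _ (fun x =>
    (k1 * (rho x * complex.Im (L2repr u x * L2repr w x)) +
     k2 * (rho x * complex.Re (L2repr u x * L2repr w x))) +
     rho x * complex.Im (L2repr u' x * L2repr w x))); last first.
    by move=> x _; case: (L2repr u x) => ? ?; case: (L2repr u' x) => ? ?;
      case: (L2repr w x) => ? ? /=; ring.
  rewrite RintegralD//; [|by apply: iD; exact: iZ].
  by rewrite RintegralD ?RintegralZl//; exact: iZ.
Qed.

Lemma L2sqnorm_ge0 u : 0 <= L2sqnorm u.
Proof.
have [mu_ iu] := (sqintP _ _ _ _).1 (L2repr_sqint u).
rewrite /L2sqnorm (ae_Rint iu (g := fun x => rt x * abs2 (L2repr u x))).
- by apply: Rintegral_ge0 => x _; rewrite mulr_ge0 ?abs2_ge0// ltW.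
- by apply: measurable_funM => //; exact: measurable_abs2.
- by refine (aeS rtE _) => x rx xlr; rewrite rx.
Qed.

Lemma L2sqnorm_eq0 u : L2sqnorm u = 0 -> u = 0.
Proof.
have [mu_ iu] := (sqintP _ _ _ _).1 (L2repr_sqint u).
pose f x := rt x * abs2 (L2repr u x).
have mf : measurable_fun `]l, r[ f.
  by apply: measurable_funM => //; exact: measurable_abs2.
have fE : {ae mu, forall x, `]l, r[%classic x ->
    rho x * abs2 (L2repr u x) = f x}.
  by refine (aeS rtE _) => x rx xlr; rewrite /f rx.
have if_ : mu.-integrable `]l, r[ (EFin \o f) by exact: ae_eq_integrable fE iu.
have f0 x : 0 <= f x by rewrite mulr_ge0 ?abs2_ge0// ltW.
rewrite /L2sqnorm (ae_Rint iu mf fE) /Rintegral => /eqP.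
rewrite fine_eq0; last exact: integrable_fin_num.
move=> /eqP int0.
have /ae_eq_integral_abs : (\int[mu]_(x in `]l, r[) `|(EFin \o f) x| = 0)%E.
  rewrite -[RHS]int0; apply: eq_integral => x _.
  by rewrite /= ger0_norm.
move=> /(_ mI) h.
apply: (@represents_inj _ _ _ _ _ _ (fun _ => 0)); last exact: represents0.
have {}h := h ((measurable_EFinP _ _).2 mf).
refine (aeS h _) => x hx xlr.
have [] := hx xlr; rewrite /f => /eqP; rewrite mulf_eq0 gt_eqF//= => /eqP.
exact: abs2_eq0.
Qed.

Lemma conj_sqint F : F \in sqint rho l r -> (fun x => (F x)^*%C) \in sqint rho l r.
Proof.
move=> /sqintP[[mr mi] intF]; apply/sqintP; split.
  split.
  - by rewrite (_ : (fun x => _) = (fun x => complex.Re (F x)))//;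
      apply/funext => x; case: (F x).
  - rewrite (_ : (fun x => _) = fun x => - complex.Im (F x)).
      exact: measurableT_comp.
    by apply/funext => x; case: (F x).
rewrite (_ : (fun x => _) = (fun x => rho x * abs2 (F x)))//.
by apply/funext => x; case: (F x) => ? ?; rewrite /abs2 /= sqrrN.
Qed.

Definition L2conj u : L2 rho l r :=
  sval (cid (represents_exists (conj_sqint (L2repr_sqint u)))).

Lemma L2conj_repr u F : represents u F -> represents (L2conj u) (fun x => (F x)^*%C).
Proof.
move=> uF; rewrite /L2conj; case: cid => u' /= u'E.
by apply: ae_eqC_trans u'E _; refine (aeS uF _) => x ux xlr; rewrite ux.
Qed.

Lemma L2conj_lin (k : C) u u' : L2conj (k *: u + u') = k^*%C *: L2conj u + L2conj u'.
Proof.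
have h := represents_lin k (represents_repr u) (represents_repr u').
apply: represents_inj (L2conj_repr h) _.
have h' := represents_lin k^*%C (L2conj_repr (represents_repr u))
  (L2conj_repr (represents_repr u')).
apply: ae_eqC_trans h' _; apply: aeW => x _.
by case: k {h} => ? ?; case: (L2repr u x) => ? ?; case: (L2repr u' x) => ? ? /=;
  apply/eqP; rewrite eq_complex /=; apply/andP; split; apply/eqP; ring.
Qed.

Lemma L2form_conj u : L2form u (L2conj u) = (L2sqnorm u)%:C.
Proof.
have uL := L2repr_sqint u.
rewrite (L2formE uL (conj_sqint uL) (represents_repr u) (L2conj_repr (represents_repr u))).
apply/eqP; rewrite eq_complex /=; apply/andP; split; apply/eqP.
  by apply: eq_Rintegral => x _; case: (L2repr u x) => ? ?; rewrite /abs2 /=; ring.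
rewrite (@eq_Rintegral _ _ _ mu _ (cst 0)).
  by rewrite Rintegral_cst ?mul0r.
by move=> x _; case: (L2repr u x) => ? ? /=; ring.
Qed.

Lemma sl_max_conj u v s0 s1 t0 t1 : sl_max u v s0 s1 t0 t1 ->
  sl_max (L2conj u) (L2conj v) s0^*%C s1^*%C t0^*%C t1^*%C.
Proof.
move=> [F [F1 [G [w uF vG [<- <- <- <-]]]]].
exists (fun x => (F x)^*%C), (fun x => (F1 x)^*%C), (fun x => (G x)^*%C).
split=> //; [exact: W2_conj|exact: L2conj_repr|].
apply: ae_eqC_trans (L2conj_repr vG) _; apply: aeW => x _; rewrite /tau.
by case: (F x) => ? ?; case: (G x) => ? ? /=;
  apply/eqP; rewrite eq_complex /=; apply/andP; split; apply/eqP; ring.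
Qed.

Lemma sl_max_lin (k : C) u v s0 s1 t0 t1 u' v' s0' s1' t0' t1' :
  sl_max u v s0 s1 t0 t1 -> sl_max u' v' s0' s1' t0' t1' ->
  sl_max (k *: u + u') (k *: v + v') (k * s0 + s0') (k * s1 + s1')
    (k * t0 + t0') (k * t1 + t1').
Proof.
move=> [F [F1 [G [w uF vG [<- <- <- <-]]]]].
move=> [F' [F1' [G' [w' uF' vG' [<- <- <- <-]]]]].
exists (fun x => k * F x + F' x), (fun x => k * F1 x + F1' x), (fun x => k * G x + G' x).
split=> //; [exact: W2_lin|exact: represents_lin|].
apply: ae_eqC_trans (represents_lin k vG vG') _; apply: aeW => x _; rewrite /tau.
by ring.
Qed.

(** By linearity, this says that the four boundary values depend only on the class u. The continuous
    representative of the zero class vanishes identically, and then so does its derivative. *)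
Lemma sl_max_trace0 v s0 s1 t0 t1 : sl_max 0 v s0 s1 t0 t1 ->
  [/\ s0 = 0, s1 = 0, t0 = 0 & t1 = 0].
Proof.
move=> [F [F1 [G [w uF vG [<- <- <- <-]]]]].
have [cF cF1] := W2_continuous (ltW lr) w.
have c00 : continuousC l r (fun _ => 0).
  by split; apply: continuous_subspaceT => x; exact: cvg_cst.
have F0 : forall x, l <= x <= r -> F x = 0.
  apply: continuousC_ae_eq => //.
  by apply: ae_eqC_trans (ae_eqC_sym uF) _; exact: represents0.
have [_ [ar ai] [a1r a1i]] := w.
have ll : l <= l <= r by rewrite lexx ltW.
have rr : l <= r <= r by rewrite lexx ltW.
(* Integrating the product of F and F1 gives the integral of F1 ^+ 2. *)
have real (f g h : R -> R) : is_AC l r f g -> is_AC l r g h ->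
    (forall x, l <= x <= r -> f x = 0) ->
    {ae mu, forall x, `]l, r[%classic x -> g x = 0}.
  move=> af ag f0; have := is_AC_mul (ltW lr) af ag.
  rewrite (@eq_Rintegral _ _ _ mu _ (cst 0)); last first.
    by move=> x; rewrite inE in_itvcc => xlr; rewrite f0// mul0r.
  rewrite Rintegral_cst// mul0r add0r !f0// !mul0r subrr /Rintegral => /eqP.
  have cg := is_AC_continuous (ltW lr) ag.
  have ig := continuous_mul_integrable cg af.1.
  rewrite fine_eq0; last exact: integrable_fin_num.
  move=> /eqP int0.
  have mgg : measurable_fun `[l, r] (EFin \o (fun x => g x * g x)).
    exact: measurable_int ig.
  have /ae_eq_integral_abs : (\int[mu]_(x in `[l, r]) `|(EFin \o (fun x => g x * g x)%R) x| = 0)%E.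
    rewrite -[RHS]int0; apply: eq_integral => x _.
    by rewrite /= ger0_norm// -expr2 sqr_ge0.
  move=> /(_ (measurable_itv _) mgg) gg0.
  refine (aeS gg0 _) => x hx; rewrite /= in_itv /= => /andP[lx xr].
  have [] : ((g x * g x)%:E = 0)%E by apply: hx; rewrite in_itvcc !ltW.
  by move=> /eqP; rewrite mulf_eq0 orbb => /eqP.
have F10 : forall x, l <= x <= r -> F1 x = 0.
  apply: continuousC_ae_eq => //; apply/ae_eqC_parts; split.
    by apply: real ar a1r _ => x xlr; rewrite F0.
  by apply: real ai a1i _ => x xlr; rewrite F0.
by split; [exact: F0|exact: F10|exact: F0|exact: F10].
Qed.

(** The relation v + lam u = rho^-1 (- u'' + q u) is rewritten as u'' = (q - lam rho) u - rho v:
    [pot] is the coefficient of u and [src] the source term. *)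
Let pot (lam : C) x : C := (qt x)%:C - lam * (rt x)%:C.

Let potRe lam x : complex.Re (pot lam x) = qt x - complex.Re lam * rt x.
Proof. by case: lam => a b /=; ring. Qed.

Let potIm lam x : complex.Im (pot lam x) = - (complex.Im lam * rt x).
Proof. by case: lam => a b /=; ring. Qed.

Let pot_measurable lam :
  measurable_fun setT (fun x => complex.Re (pot lam x)) /\
  measurable_fun setT (fun x => complex.Im (pot lam x)).
Proof.
split.
- under eq_fun do rewrite potRe.
  by apply: measurable_funB => //; exact: measurable_funM.
- under eq_fun do rewrite potIm.
  by apply: measurableT_comp => //; exact: measurable_funM.
Qed.

(** Besides the real and imaginary parts of the potential, K has to dominate the entries 1 of the
    system matrix, hence the first summand. *)
Let K (lam : C) := 1 + M + `|complex.Re lam| * M + `|complex.Im lam| * M.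

Let K1 lam : 1 <= K lam.
Proof. by rewrite /K -!addrA lerDl !addr_ge0 ?mulr_ge0// ltW. Qed.

Let pot_bound lam x :
  `|complex.Re (pot lam x)| <= K lam /\ `|complex.Im (pot lam x)| <= K lam.
Proof.
have hM : 0 <= M by exact: ltW.
rewrite potRe potIm /K normrN; split.
- apply: le_trans (ler_normB _ _) _; rewrite normrM -addrA lerD//.
    by apply: le_trans (qtM x) _; rewrite lerDr.
  by rewrite ler_wpDr ?mulr_ge0// ler_wpM2l.
- by rewrite normrM ler_wpDl ?addr_ge0 ?mulr_ge0// ler_wpM2l.
Qed.

Let src v x : C := (- rt x)%:C * L2repr v x.

Let src_sqint v : src v \in sqint (cst 1) l r.
Proof.
apply: (@sqint_bounded_mul _ _ _ (fun x => - rt x) _ M).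
- exact: measurableT_comp.
- by move=> x; rewrite normrN.
- by apply: sq_rho1; exact: L2repr_sqint.
Qed.

Let src_norm v : \int[mu]_(x in `]l, r[) abs2 (src v x) <= M * L2sqnorm v.
Proof.
have [mv iv] := (sqintP _ _ _ _).1 (L2repr_sqint v).
have [_ is_] := (sqintP _ _ _ _).1 (src_sqint v).
have fE : {ae mu, forall x, `]l, r[%classic x ->
    rho x * abs2 (L2repr v x) = rt x * abs2 (L2repr v x)}.
  by refine (aeS rtE _) => x rx xlr; rewrite rx.
have mf : measurable_fun `]l, r[ (fun x => rt x * abs2 (L2repr v x)).
  by apply: measurable_funM => //; exact: measurable_abs2.
have if_ := ae_eq_integrable mI mf fE iv.
rewrite /L2sqnorm (ae_Rint iv mf fE) -RintegralZl//.
apply: le_Rintegral => //.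
- by move: is_; rewrite (_ : (fun x => cst 1 x * _) = fun x => abs2 (src v x))//;
    apply/funext => x; rewrite mul1r.
- exact: (@integrableZl _ _ _ mu _ mI M (EFin \o (fun x => rt x * abs2 (L2repr v x)))).
- move=> x _; rewrite /src abs2M {1}/abs2 /= expr0n addr0 sqrrN expr2 -mulrA.
  apply: ler_wpM2r; first by rewrite mulr_ge0 ?abs2_ge0// ltW.
  by case/andP: (rtb x).
Qed.

Lemma sl_max_ode lam u v s0 s1 t0 t1 : sl_max u (v + lam *: u) s0 s1 t0 t1 ->
  exists F F1, [/\ W2 l r F F1 (fun x => pot lam x * F x + src v x),
    represents u F & [/\ F l = s0, F1 l = s1, F r = t0 & F1 r = t1]].
Proof.
move=> [F [F1 [G [w uF vG tr]]]]; exists F, F1; split=> //.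
have [GL a a1] := w.
have L : (fun x => pot lam x * F x + src v x) \in sqint (cst 1) l r.
  apply: sqintD => //; apply: (@sqint_boundedC_mul _ _ _ (K lam)).
  - by apply: measurable_funTS; exact: (pot_measurable lam).1.
  - by apply: measurable_funTS; exact: (pot_measurable lam).2.
  - by move=> x; exact: (pot_bound lam x).1.
  - by move=> x; exact: (pot_bound lam x).2.
  - by apply: continuousC_sqint; exact: is_ACC_continuous (ltW lr) a.
split=> //; apply: is_ACC_ae L _ a1.
have uv : ae_eqC l r (fun x => lam * F x + L2repr v x)
    (fun x => ((rho x)^-1)%:C * tau q F G x).
  move: vG; rewrite addrC => vG; apply: ae_eqC_trans vG.
  exact: ae_eqC_sym (represents_lin lam uF (represents_repr v)).
refine (aeS2 (aeS2 rtE qtE (fun x h1 h2 => conj h1 h2)) uv _) => x [rx qx] ux xlr.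
have rx0 : rho x != 0 by rewrite -rx// gt_eqF.
have E : (rho x)%:C * (lam * F x + L2repr v x) = - G x + (q x)%:C * F x.
  by rewrite ux// mulrA -rmorphM /= divff// mul1r.
rewrite /pot /src rx// qx//.
have -> : G x = (q x)%:C * F x - (- G x + (q x)%:C * F x) by ring.
by rewrite -E rmorphN /=; ring.
Qed.

Lemma ode_sl_max lam F F1 v : W2 l r F F1 (fun x => pot lam x * F x + src v x) ->
  exists u, represents u F /\ sl_max u (v + lam *: u) (F l) (F1 l) (F r) (F1 r).
Proof.
move=> w; have [u uF] := represents_exists (sq_W2 w).
exists u; split=> //; exists F, F1, (fun x => pot lam x * F x + src v x).
split=> //.
rewrite addrC.
apply: ae_eqC_trans (represents_lin lam uF (represents_repr v)) _.
refine (aeS2 rtE qtE _) => x rx qx xlr.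
have rx0 : rho x != 0 by rewrite -rx// gt_eqF.
rewrite /tau /pot /src rx// qx// rmorphN /=.
transitivity (((rho x)^-1)%:C * ((rho x)%:C * (lam * F x + L2repr v x))).
  by rewrite mulrA -rmorphM /= mulVf// mul1r.
by congr (_ * _); ring.
Qed.

Lemma L2sqnorm0 : L2sqnorm 0 = 0.
Proof.
have L0 : (fun _ => 0) \in sqint rho l r.
  apply: sq_1rho; apply: continuousC_sqint.
  by split; apply: continuous_subspaceT => x; exact: cvg_cst.
rewrite (L2sqnormE L0 (represents0 _ _ _)) (@eq_Rintegral _ _ _ mu _ (cst 0)).
  by rewrite Rintegral_cst ?mul0r.
by move=> x _; rewrite abs2_0 mulr0.
Qed.

Lemma sl_max_solve lam : exists2 B, 0 <= B & forall v s0 s1, exists u t0 t1,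
  [/\ sl_max u (v + lam *: u) s0 s1 t0 t1,
      L2sqnorm u <= B * (L2sqnorm v + abs2 s0 + abs2 s1),
      abs2 t0 <= B * (L2sqnorm v + abs2 s0 + abs2 s1) &
      abs2 t1 <= B * (L2sqnorm v + abs2 s0 + abs2 s1)].
Proof.
have [mr mi] := pot_measurable lam.
have [B0 B00 bound] := ode_bound lr (K1 lam) mr mi
  (fun x => (pot_bound lam x).1) (fun x => (pot_bound lam x).2).
have hM := ltW M0; have d0 : 0 <= r - l by rewrite subr_ge0 ltW.
(* The factor 1 + M replaces the norm of the source by that of v; the last factor covers both the
   pointwise bound at r and its integral against the weight. *)
exists (B0 * (1 + M) * (1 + M * (r - l))).
  by rewrite !mulr_ge0 ?addr_ge0 ?mulr_ge0.
move=> v s0 s1.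
have [F [F1 [w Fl F1l]]] := ode_exists lr (K1 lam) mr mi
  (fun x => (pot_bound lam x).1) (fun x => (pot_bound lam x).2) s0 s1 (src_sqint v).
have [u [uF Tu]] := ode_sl_max w.
have {}bound := bound _ _ _ (src_sqint v) w.
rewrite Fl F1l in Tu bound.
set S := L2sqnorm v + abs2 s0 + abs2 s1.
have S0 : 0 <= S.
  by rewrite addr_ge0 ?abs2_ge0// addr_ge0 ?abs2_ge0// L2sqnorm_ge0.
have le1 : B0 * (\int[mu]_(t in `]l, r[) abs2 (src v t) + abs2 s0 + abs2 s1) <=
    B0 * (1 + M) * S.
  rewrite -mulrA ler_wpM2l//; apply: le_sum3_weight => //;
    by rewrite ?abs2_ge0 ?L2sqnorm_ge0 ?src_norm.
have le2 : B0 * (1 + M) * S <= B0 * (1 + M) * (1 + M * (r - l)) * S.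
  rewrite ler_wpM2r// ler_peMr// ?lerDl ?mulr_ge0// ?addr_ge0//.
have rr : l <= r <= r by rewrite lexx ltW.
exists u, (F r), (F1 r); split=> //.
- have FL := sq_W2 w; have [mF iF] := (sqintP _ _ _ _).1 FL.
  rewrite (L2sqnormE FL uF) (ae_Rint iF (g := fun x => rt x * abs2 (F x))); last 2 first.
  + by apply: measurable_funM => //; exact: measurable_abs2.
  + by refine (aeS rtE _) => x rx xlr; rewrite rx.
  have if2 : mu.-integrable `]l, r[ (EFin \o (fun x => rt x * abs2 (F x))).
    apply: ae_eq_integrable iF => //.
      by apply: measurable_funM => //; exact: measurable_abs2.
    by refine (aeS rtE _) => x rx xlr; rewrite rx.
  apply: (@le_trans _ _ (\int[mu]_(x in `]l, r[) (M * (B0 * (1 + M) * S)))).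
    apply: le_Rintegral => //; first exact: integrable_cst_itv.
    move=> x; rewrite /= in_itv /= => /andP[lx xr].
    apply: ler_pM; rewrite ?abs2_ge0 ?(ltW (rt0 x))//; first by case/andP: (rtb x).
    have xlr : l <= x <= r by rewrite !ltW.
    exact: le_trans (bound x xlr).1 le1.
  rewrite Rintegral_itvoo_cst//.
  set k := B0 * (1 + M) * S.
  have -> : B0 * (1 + M) * (1 + M * (r - l)) * S = k + M * k * (r - l).
    by rewrite /k; ring.
  by rewrite lerDr /k !mulr_ge0// addr_ge0.
- exact: le_trans (bound r rr).1 (le_trans le1 le2).
- exact: le_trans (bound r rr).2 (le_trans le1 le2).
Qed.

Lemma sl_max_uniq lam u t0 t1 : sl_max u (lam *: u) 0 0 t0 t1 -> u = 0.
Proof.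
rewrite -[lam *: u]add0r => /sl_max_ode[F [F1 [w uF [Fl F1l _ _]]]].
have [mr mi] := pot_measurable lam.
have [B0 B00 bound] := ode_bound lr (K1 lam) mr mi
  (fun x => (pot_bound lam x).1) (fun x => (pot_bound lam x).2).
have {}bound := bound _ _ _ (src_sqint 0) w.
rewrite Fl F1l abs2_0 !addr0 in bound.
have s0 : \int[mu]_(x in `]l, r[) abs2 (src 0 x) = 0.
  apply: le_anti; rewrite Rintegral_ge0 ?andbT => [|x _]; last exact: abs2_ge0.
  by apply: le_trans (src_norm 0) _; rewrite L2sqnorm0 mulr0.
rewrite s0 mulr0 in bound.
apply: (@represents_inj _ _ _ _ _ _ (fun _ => 0)); last exact: represents0.
refine (aeS uF _) => x ux xlr; rewrite ux//.
move: xlr; rewrite /= in_itv /= => /andP[lx xr].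
apply: abs2_eq0; apply: le_anti; rewrite abs2_ge0 andbT.
by apply: (bound x _).1; rewrite !ltW.
Qed.

Lemma sl_max_green u v s0 s1 t0 t1 u' v' s0' s1' t0' t1' :
  sl_max u v s0 s1 t0 t1 -> sl_max u' v' s0' s1' t0' t1' ->
  L2form v u' - L2form u v' =
  -1 * ((s0 * s1' - s1 * s0') - (t0 * t1' - t1 * t0')).
Proof.
move=> [F [F1 [G [w uF vG [<- <- <- <-]]]]].
move=> [F' [F1' [G' [w' uF' vG' [<- <- <- <-]]]]].
have [GL a a1] := w; have [GL' a' a1'] := w'.
(* The Wronskian F F1' - F' F1 is absolutely continuous, with derivative F G' - F' G. This equals
   rho (v u' - u v') almost everywhere, since the terms in q cancel. *)
have [Wr Wi] := is_ACC_lin (-1) (is_ACC_prod (ltW lr) a' a1) (is_ACC_prod (ltW lr) a a1').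
have rr : l <= r <= r by rewrite lexx ltW.
have [vL uL] := (L2repr_sqint v, sq_W2 w).
have [vL' uL'] := (L2repr_sqint v', sq_W2 w').
have vGE : ae_eqC l r (L2repr v) (fun x => ((rho x)^-1)%:C * tau q F G x) by [].
have vGE' : ae_eqC l r (L2repr v') (fun x => ((rho x)^-1)%:C * tau q F' G' x) by [].
rewrite (L2formE vL uL' (represents_repr v) uF') (L2formE uL vL' uF (represents_repr v')).
have [i1 i2] := integrable_weighted_mul mrho vL uL'.
have [i3 i4] := integrable_weighted_mul mrho uL vL'.
have aeE : {ae mu, forall x, `]l, r[%classic x ->
    (rho x)%:C * (L2repr v x * F' x) - (rho x)%:C * (F x * L2repr v' x) =
    -1 * (F' x * G x + F1 x * F1' x) + (F x * G' x + F1' x * F1 x)}.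
  refine (aeS2 (aeS2 vGE vGE' (fun x h1 h2 => conj h1 h2)) rtE _) => x [vx vx'] rx xlr.
  have rx0 : rho x != 0 by rewrite -rx// gt_eqF.
  have e k : (rho x)%:C * (((rho x)^-1)%:C * k) = k.
    by rewrite mulrA -rmorphM /= divff// mul1r.
  have e1 : (rho x)%:C * L2repr v x = - G x + (q x)%:C * F x by rewrite vx// e.
  have e2 : (rho x)%:C * L2repr v' x = - G' x + (q x)%:C * F' x by rewrite vx'// e.
  rewrite mulrA e1 (mulrC (F x) (L2repr v' x)) mulrA e2; ring.
have iB (f g : R -> R) : mu.-integrable `]l, r[ (EFin \o f) ->
    mu.-integrable `]l, r[ (EFin \o g) ->
    mu.-integrable `]l, r[ (EFin \o (fun x => f x - g x)).
  by move=> ifi igi; exact: (@integrableB _ _ _ mu _ mI (EFin \o f) (EFin \o g)).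
have Wr' := Wr.2 r rr; have Wi' := Wi.2 r rr.
have ir := (integrable_itvoo_cc _ _ _).2 Wr.1; have ii := (integrable_itvoo_cc _ _ _).2 Wi.1.
rewrite -!Rintegral_itvoo// in Wr' Wi'.
apply/eqP; rewrite eq_complex /= -!RintegralB//; apply/andP; split; apply/eqP.
- rewrite (ae_eq_Rintegral (iB _ _ i1 i3) ir); last first.
    refine (aeS aeE _) => x /[apply] /(congr1 (@complex.Re R)) <-.
    by case: (L2repr v x) (F x) (L2repr v' x) (F' x) => ? ? [? ?] [? ?] [? ?] /=; ring.
  apply: (addrI (complex.Re (-1 * (F' l * F1 l) + F l * F1' l))); rewrite -Wr'.
  by case: (F l) (F1 l) (F r) (F1 r) (F' l) (F1' l) (F' r) (F1' r) =>
    ? ? [? ?] [? ?] [? ?] [? ?] [? ?] [? ?] [? ?] /=; ring.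
- rewrite (ae_eq_Rintegral (iB _ _ i2 i4) ii); last first.
    refine (aeS aeE _) => x /[apply] /(congr1 (@complex.Im R)) <-.
    by case: (L2repr v x) (F x) (L2repr v' x) (F' x) => ? ? [? ?] [? ?] [? ?] /=; ring.
  apply: (addrI (complex.Im (-1 * (F' l * F1 l) + F l * F1' l))); rewrite -Wi'.
  by case: (F l) (F1 l) (F r) (F1 r) (F' l) (F1' l) (F' r) (F1' r) =>
    ? ? [? ?] [? ?] [? ?] [? ?] [? ?] [? ?] [? ?] /=; ring.
Qed.

Definition sl_conj_form : conj_form L2sqnorm :=
  ConjForm L2formDl L2formC L2conj_lin L2form_conj L2sqnorm_eq0 L2sqnorm_ge0.

Lemma sl_green_system : green_system sl_conj_form (-1) sl_max.
Proof.
split.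
- by rewrite oppr_eq0 oner_eq0.
- exact: sl_max_lin.
- exact: sl_max_trace0.
- exact: sl_max_solve.
- exact: sl_max_uniq.
- exact: sl_max_green.
- exact: sl_max_conj.
Qed.

End MaximalOperator.

Lemma abs2B_le (R : realType) (x y : R[i]) : abs2 (x - y) <= 2 * (abs2 x + abs2 y).
Proof.
have -> : abs2 y = abs2 (- y) by case: y => a b; rewrite /abs2 /= !sqrrN.
exact: abs2D_le.
Qed.

(** Estimates a coefficient given by Cramer's rule: x, y are prescribed boundary values, p1, p2
    those of a particular solution, and b1, b2 entries of the transition matrix. *)
Lemma det_bound (R : realType) (x y p1 p2 b1 b2 : R[i]) (D B n : R) :
  0 <= D -> 0 <= B -> 0 <= n -> abs2 p1 <= B * n -> abs2 p2 <= B * n ->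
  abs2 b1 <= D -> abs2 b2 <= D ->
  abs2 ((x - p1) * b1 - (y - p2) * b2) <=
  4 * D * (1 + 2 * B) * (n + abs2 x + abs2 y).
Proof.
move=> D0 B0 n0 p1B p2B b1D b2D; apply: le_trans (abs2B_le _ _) _.
rewrite !abs2M.
have le1 (z p b : R[i]) : abs2 b <= D ->
    abs2 (z - p) * abs2 b <= 2 * (abs2 z + abs2 p) * D.
  by move=> bD; apply: ler_pM; rewrite ?abs2_ge0// abs2B_le.
have h1 := le1 x p1 b1 b1D; have h2 := le1 y p2 b2 b2D.
apply: (@le_trans _ _ (4 * D * (abs2 x + abs2 p1 + (abs2 y + abs2 p2)))).
  have -> : 4 * D * (abs2 x + abs2 p1 + (abs2 y + abs2 p2)) =
    2 * (2 * (abs2 x + abs2 p1) * D + 2 * (abs2 y + abs2 p2) * D) by ring.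
  by rewrite ler_wpM2l// lerD.
rewrite -[leRHS]mulrA; apply: ler_wpM2l; first by rewrite mulr_ge0.
have x0 := abs2_ge0 x; have y0 := abs2_ge0 y.
move: (abs2 x) (abs2 y) (abs2 p1) (abs2 p2) x0 y0 p1B p2B => a b c d a0 b0 cB dB.
by have := mulr_ge0 B0 a0; have := mulr_ge0 B0 b0; lra.
Qed.

Lemma quad_bound (R : realFieldType) (B B1 S n x y : R) : 0 <= B -> 0 <= B1 ->
  0 <= S -> n <= S -> x <= B1 * S -> y <= B1 * S ->
  B * (n + x + y) <= (B1 + B * (1 + 2 * B1)) * S.
Proof.
move=> B0 B10 S0 nS xB yB; apply: (@le_trans _ _ (B * ((1 + 2 * B1) * S))).
  by apply: ler_wpM2l => //; lra.
have -> : (B1 + B * (1 + 2 * B1)) * S = B * ((1 + 2 * B1) * S) + B1 * S by ring.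
by rewrite lerDl mulr_ge0.
Qed.

(** * Boundary value problems with one real boundary condition *)

Section GreenTheory.
Context {R : realType} (H : lmodType R[i]) (N : H -> R) (cf : conj_form N).
Context (sgn : R[i]) (T : H -> H -> R[i] -> R[i] -> R[i] -> R[i] -> Prop).
Context (gs : green_system cf sgn T).
Local Notation C := R[i].
Local Notation form := (cf_form cf).

Lemma cf_formZ (c : C) u w : form (c *: u) w = c * form u w.
Proof.
have h0 : form 0 w = 0.
  have := cf_formDl cf 1 0 0 w; rewrite scaler0 addr0 mul1r => /esym/eqP.
  by rewrite addrC -subr_eq0 addrK => /eqP.
by have := cf_formDl cf c u 0 w; rewrite h0 !addr0.
Qed.

Lemma cf_form_Dr (c : C) u w w' : form u (c *: w + w') = c * form u w + form u w'.
Proof. by rewrite !(cf_formC cf u) cf_formDl. Qed.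

Lemma cf_formZr (c : C) u w : form u (c *: w) = c * form u w.
Proof. by rewrite !(cf_formC cf u) cf_formZ. Qed.

Lemma abs2_conj (c : C) : c * c^*%C = (abs2 c)%:C.
Proof.
by case: c => a b; apply/eqP; rewrite eq_complex /= /abs2 /=; apply/andP;
  split; apply/eqP; ring.
Qed.

Lemma cf_conjZ (c : C) u : cf_conj cf (c *: u) = c^*%C *: cf_conj cf u.
Proof.
have h0 : cf_conj cf 0 = 0.
  have := cf_conj_lin cf 1 0 0; rewrite scaler0 addr0 conjc1 scale1r => /esym/eqP.
  by rewrite addrC -subr_eq0 addrK => /eqP.
by have := cf_conj_lin cf c u 0; rewrite h0 !addr0.
Qed.

Lemma real_complex_inj (x y : R) : x%:C = y%:C -> x = y.
Proof. by case. Qed.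

Lemma cf_normZ (c : C) u : N (c *: u) = abs2 c * N u.
Proof.
apply: real_complex_inj; rewrite -(cf_normE cf) cf_conjZ cf_formZ cf_formZr.
by rewrite mulrA abs2_conj cf_normE rmorphM.
Qed.

(** Exchanging the end points changes the sign in Green's formula. Solvability from the other end
    holds because the transition matrix between the Cauchy data at the two ends is invertible. *)
Lemma gs_swap : green_system cf (- sgn) (fun u v s0 s1 t0 t1 => T u v t0 t1 s0 s1).
Proof.
(* The fundamental system at lam. Green's formula applied to its two members gives zero on the left,
   so their Wronskian is the same at both ends, namely 1. *)
have wr lam : exists u1 a0 a1 u2 b0 b1,
    [/\ T u1 (lam *: u1) 1 0 a0 a1, T u2 (lam *: u2) 0 1 b0 b1 &
      a0 * b1 - a1 * b0 = 1].
  have [B _ sol] := gs_solve gs lam.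
  have [u1 [a0 [a1 [h1 _ _ _]]]] := sol 0 1 0.
  have [u2 [b0 [b1 [h2 _ _ _]]]] := sol 0 0 1.
  rewrite !add0r in h1 h2; exists u1, a0, a1, u2, b0, b1; split=> //.
  have := gs_green gs h1 h2; rewrite cf_formZ cf_formZr subrr => /esym/eqP.
  rewrite mulf_eq0 (negbTE (gs_sign_neq0 gs)) /= !mul1r mulr0 subr0 subr_eq0.
  by move=> /eqP <-.
split.
- by rewrite oppr_eq0 (gs_sign_neq0 gs).
- by move=> *; exact: (gs_lin gs).
- by move=> v s0 s1 t0 t1 /(gs_trace0 gs)[].
- move=> lam; have [u1 [a0 [a1 [u2 [b0 [b1 [h1 h2 det]]]]]]] := wr lam.
  have [B B0 sol] := gs_solve gs lam.
  pose D := abs2 a0 + abs2 a1 + abs2 b0 + abs2 b1.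
  have D0 : 0 <= D by rewrite !addr_ge0 ?sqr_ge0.
  pose B1 := 4 * D * (1 + 2 * B).
  have B10 : 0 <= B1.
    by apply: mulr_ge0; [exact: mulr_ge0|rewrite addr_ge0// mulr_ge0].
  exists (B1 + B * (1 + 2 * B1)) => [|v t0 t1].
    by rewrite addr_ge0// mulr_ge0// addr_ge0// mulr_ge0.
  have [up [p0 [p1 [hp Np p0B p1B]]]] := sol v 0 0.
  rewrite abs2_0 !addr0 in Np p0B p1B.
  (* Cramer's rule, with determinant 1, for the Cauchy data at the near end that produce t0, t1 at
     the far end. *)
  pose k0 := (t0 - p0) * b1 - (t1 - p1) * b0.
  pose k1 := a0 * (t1 - p1) - a1 * (t0 - p0).
  have Nv0 := cf_norm_ge0 cf v.
  (* Solving once more from these data provides the norm estimate; uniqueness identifies this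
     solution with the combination of u1, u2 and up. *)
  have [u [q0 [q1 [h Nu _ _]]]] := sol v k0 k1.
  have T1 := gs_lin gs k0 h1 (gs_lin gs k1 h2 hp).
  have e0 : k0 * a0 + (k1 * b0 + p0) = t0.
    have -> : k0 * a0 + (k1 * b0 + p0) = (a0 * b1 - a1 * b0) * (t0 - p0) + p0.
      by rewrite /k0 /k1; ring.
    by rewrite det mul1r subrK.
  have e1 : k0 * a1 + (k1 * b1 + p1) = t1.
    have -> : k0 * a1 + (k1 * b1 + p1) = (a0 * b1 - a1 * b0) * (t1 - p1) + p1.
      by rewrite /k0 /k1; ring.
    by rewrite det mul1r subrK.
  have z0 : k0 * 1 + (k1 * 0 + 0) = k0 by ring.
  have z1 : k0 * 0 + (k1 * 1 + 0) = k1 by ring.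
  rewrite e0 e1 z0 z1 in T1.
  have vE : k0 *: (lam *: u1) + (k1 *: (lam *: u2) + (v + lam *: up)) =
      v + lam *: (k0 *: u1 + (k1 *: u2 + up)).
    by rewrite !scalerDr !scalerA !(mulrC lam) [RHS]addrC -!addrA [v + _]addrC.
  rewrite vE in T1.
  have diff := gs_lin gs (-1) h T1; rewrite !mulN1r !addNr !scaleN1r in diff.
  have dE : - (v + lam *: u) + (v + lam *: (k0 *: u1 + (k1 *: u2 + up))) =
     lam *: (- u + (k0 *: u1 + (k1 *: u2 + up))).
    by rewrite opprD addrACA addNr add0r [RHS]scalerDr scalerN.
  rewrite dE in diff.
  have uE : u = k0 *: u1 + (k1 *: u2 + up).
    by have /eqP := gs_uniq gs diff; rewrite addrC subr_eq0 => /eqP.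
  rewrite -uE in T1.
  set S := N v + abs2 t0 + abs2 t1.
  have S0 : 0 <= S by rewrite /S -addrA addr_ge0// addr_ge0 ?abs2_ge0.
  have kB : abs2 k0 <= B1 * S /\ abs2 k1 <= B1 * S.
    have [a00 a10] := (abs2_ge0 a0, abs2_ge0 a1).
    have [b00 b10] := (abs2_ge0 b0, abs2_ge0 b1).
    split; first by apply: (det_bound _ _ _ _ _ p0B p1B) => //; rewrite /D; lra.
    rewrite /k1 (mulrC a0) (mulrC a1) /S addrAC.
    by apply: (det_bound _ _ _ _ _ p1B p0B) => //; rewrite /D; lra.
  exists u, k0, k1; split=> //.
  + apply: le_trans Nu _.
    by apply: quad_bound kB.1 kB.2 => //; rewrite /S -addrA lerDl addr_ge0 ?abs2_ge0.
  + by apply: le_trans kB.1 _; rewrite ler_wpM2r// lerDl mulr_ge0// addr_ge0// mulr_ge0.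
  + by apply: le_trans kB.2 _; rewrite ler_wpM2r// lerDl mulr_ge0// addr_ge0// mulr_ge0.
- move=> lam u t0 t1 h.
  have [u1 [a0 [a1 [u2 [b0 [b1 [h1 h2 det]]]]]]] := wr lam.
  have := gs_green gs h h1; have := gs_green gs h h2.
  rewrite !cf_formZ !cf_formZr !subrr => /esym/eqP + /esym/eqP.
  rewrite !mulf_eq0 (negbTE (gs_sign_neq0 gs)) /= !mul0r !mulr0 !mulr1 !subr0 sub0r.
  rewrite oppr_eq0 => /eqP t00 /eqP t10; rewrite t00 t10 in h.
  exact: (gs_uniq gs h).
- move=> u v s0 s1 t0 t1 u' v' s0' s1' t0' t1' h h'.
  by rewrite (gs_green gs h h'); ring.
- by move=> u v s0 s1 t0 t1 h; exact: (gs_conjT gs).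
Qed.

End GreenTheory.

(* P u v k d e is the graph u |-> v of a maximal operator restricted by a real
   boundary condition at one end point, where k parametrizes the Cauchy data
   there and d, e are boundary values at the other end point. *)
Record robin_system {R : realType} (H : lmodType R[i]) (N : H -> R)
    (cf : conj_form N) (s : R[i])
    (P : H -> H -> R[i] -> R[i] -> R[i] -> Prop) : Prop := RobinSystem {
  rb_sign_neq0 : s != 0;
  rb_lin : forall c u v k d e u' v' k' d' e',
    P u v k d e -> P u' v' k' d' e' ->
    P (c *: u + u') (c *: v + v') (c * k + k') (c * d + d') (c * e + e');
  rb_trace0 : forall v k d e, P 0 v k d e -> [/\ k = 0, d = 0 & e = 0];
  rb_solve : forall lam, exists2 B, 0 <= B & forall v k, exists u d e,
    [/\ P u (v + lam *: u) k d e, N u <= B * (N v + abs2 k),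
        abs2 d <= B * (N v + abs2 k) & abs2 e <= B * (N v + abs2 k)];
  rb_uniq : forall lam u d e, P u (lam *: u) 0 d e -> u = 0;
  rb_green : forall u v k d e u' v' k' d' e',
    P u v k d e -> P u' v' k' d' e' ->
    cf_form cf v u' - cf_form cf u v' = s * (d * e' - e * d');
  rb_conjP : forall u v k d e, P u v k d e ->
    P (cf_conj cf u) (cf_conj cf v) k^*%C d^*%C e^*%C
}.

Lemma conjcN1 (R : rcfType) : (-1)^*%C = -1 :> R[i].
Proof. by rewrite -[in RHS](conjc1 R); exact: rmorphN. Qed.

Section RobinOfGreen.
Context {R : realType} (H : lmodType R[i]) (N : H -> R) (cf : conj_form N).
Context (sgn : R[i]) (T : H -> H -> R[i] -> R[i] -> R[i] -> R[i] -> Prop).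
Context (gs : green_system cf sgn T).
Context (s0 s1 k0 k1 : R) (s01 : s0 ^+ 2 + s1 ^+ 2 = 1) (k01 : k0 ^+ 2 + k1 ^+ 2 = 1).
Local Notation C := R[i].

(** The Cauchy data k (s1, - s0) are exactly those annihilated by (s0, s1). At the other end, the
    values are the image of (d, e) under the reflection with rows (k0, k1) and (k1, - k0). It is its
    own inverse, and its determinant -1 absorbs the minus sign of that end in Green's formula. *)
Definition robin u v (k d e : C) := T u v (k * s1%:C) (- (k * s0%:C))
  (k0%:C * d + k1%:C * e) (k1%:C * d - k0%:C * e).

Lemma robinI u v x0 x1 y0 y1 : T u v x0 x1 y0 y1 ->
  x0 * s0%:C + x1 * s1%:C = 0 ->
  robin u v (x0 * s1%:C - x1 * s0%:C) (k0%:C * y0 + k1%:C * y1)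
    (k1%:C * y0 - k0%:C * y1).
Proof.
have sC : s0%:C ^+ 2 + s1%:C ^+ 2 = 1 :> C by rewrite -!rmorphXn -rmorphD s01.
have kC : k0%:C ^+ 2 + k1%:C ^+ 2 = 1 :> C by rewrite -!rmorphXn -rmorphD k01.
move=> Tuv bc; rewrite /robin.
have -> : (x0 * s1%:C - x1 * s0%:C) * s1%:C = x0.
  have -> : (x0 * s1%:C - x1 * s0%:C) * s1%:C =
    x0 * (s0%:C ^+ 2 + s1%:C ^+ 2) - s0%:C * (x0 * s0%:C + x1 * s1%:C) by ring.
  by rewrite sC bc mulr1 mulr0 subr0.
have -> : - ((x0 * s1%:C - x1 * s0%:C) * s0%:C) = x1.
  have -> : - ((x0 * s1%:C - x1 * s0%:C) * s0%:C) =
    x1 * (s0%:C ^+ 2 + s1%:C ^+ 2) - s1%:C * (x0 * s0%:C + x1 * s1%:C) by ring.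
  by rewrite sC bc mulr1 mulr0 subr0.
have -> : k0%:C * (k0%:C * y0 + k1%:C * y1) + k1%:C * (k1%:C * y0 - k0%:C * y1) = y0.
  by rewrite -[RHS]mul1r -kC; ring.
have -> // : k1%:C * (k0%:C * y0 + k1%:C * y1) - k0%:C * (k1%:C * y0 - k0%:C * y1) = y1.
by rewrite -[RHS]mul1r -kC; ring.
Qed.

Lemma abs2_real (x : R) : abs2 x%:C = x ^+ 2.
Proof. by rewrite /abs2 /= expr0n addr0. Qed.

Lemma robin_system_green : robin_system cf sgn robin.
Proof.
have sC : s0%:C ^+ 2 + s1%:C ^+ 2 = 1 :> C by rewrite -!rmorphXn -rmorphD s01.
have kC : k0%:C ^+ 2 + k1%:C ^+ 2 = 1 :> C by rewrite -!rmorphXn -rmorphD k01.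
split.
- exact: gs_sign_neq0 gs.
- move=> c u v k d e u' v' k' d' e' h h'; have := gs_lin gs c h h'; rewrite /robin.
  set x0 := _ + _; set x1 := _ + _; set x2 := _ + _; set x3 := _ + _.
  by congr T; rewrite /x0 /x1 /x2 /x3; ring.
- move=> v k d e /(gs_trace0 gs)[h1 h2 h3 h4].
  split.
  + rewrite -[k]mulr1 -sC.
    have -> : k * (s0%:C ^+ 2 + s1%:C ^+ 2) =
       (k * s1%:C) * s1%:C - (- (k * s0%:C)) * s0%:C by ring.
    by rewrite h1 h2 !mul0r subr0.
  + rewrite -[d]mul1r -kC.
    have -> : (k0%:C ^+ 2 + k1%:C ^+ 2) * d = k0%:C * (k0%:C * d + k1%:C * e) +
       k1%:C * (k1%:C * d - k0%:C * e) by ring.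
    by rewrite h3 h4 !mulr0 addr0.
  + rewrite -[e]mul1r -kC.
    have -> : (k0%:C ^+ 2 + k1%:C ^+ 2) * e = k1%:C * (k0%:C * d + k1%:C * e) -
       k0%:C * (k1%:C * d - k0%:C * e) by ring.
    by rewrite h3 h4 !mulr0 subr0.
- move=> lam; have [B B0 sol] := gs_solve gs lam.
  exists (4 * B) => [|v k]; first exact: mulr_ge0.
  have [u [t0 [t1 [h Nu t0B t1B]]]] := sol v (k * s1%:C) (- (k * s0%:C)).
  have kE : N v + abs2 (k * s1%:C) + abs2 (- (k * s0%:C)) = N v + abs2 k.
    rewrite -addrA; congr (_ + _); rewrite -mulN1r !abs2M !abs2_real.
    have -> : abs2 (-1 : C) = 1 by rewrite /abs2 /= oppr0 sqrrN !expr2 mulr1 mulr0 addr0.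
    by rewrite mul1r -mulrDr addrC s01 mulr1.
  rewrite kE in Nu t0B t1B.
  have S0 : 0 <= B * (N v + abs2 k).
    by rewrite mulr_ge0// addr_ge0 ?abs2_ge0//; exact: cf_norm_ge0 cf v.
  have rot (x y : R) : x ^+ 2 + y ^+ 2 = 1 ->
      abs2 (x%:C * t0 + y%:C * t1) <= 4 * (B * (N v + abs2 k)).
    move=> xy; apply: le_trans (abs2D_le _ _) _; rewrite !abs2M !abs2_real.
    have x1 : x ^+ 2 <= 1 by rewrite -xy lerDl sqr_ge0.
    have y1 : y ^+ 2 <= 1 by rewrite -xy lerDr sqr_ge0.
    have h0 : x ^+ 2 * abs2 t0 <= B * (N v + abs2 k).
      by apply: le_trans t0B; rewrite ler_piMl// abs2_ge0.
    have h1 : y ^+ 2 * abs2 t1 <= B * (N v + abs2 k).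
      by apply: le_trans t1B; rewrite ler_piMl// abs2_ge0.
    by lra.
  exists u, (k0%:C * t0 + k1%:C * t1), (k1%:C * t0 - k0%:C * t1); split.
  + have : k * s1%:C * s0%:C + - (k * s0%:C) * s1%:C = 0 by ring.
    move/(robinI h).
    have -> // : k * s1%:C * s1%:C - - (k * s0%:C) * s0%:C = k.
    have -> : k * s1%:C * s1%:C - - (k * s0%:C) * s0%:C =
      k * (s0%:C ^+ 2 + s1%:C ^+ 2) by ring.
    by rewrite sC mulr1.
  + by rewrite -mulrA; lra.
  + by rewrite -mulrA; exact: rot.
  + rewrite -mulrA -mulNr -rmorphN; apply: rot.
    by rewrite sqrrN addrC.
- by move=> lam u d e; rewrite /robin !mul0r oppr0 => /(gs_uniq gs).
- move=> u v k d e u' v' k' d' e' h h'; rewrite (gs_green gs h h'); congr (_ * _).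
  rewrite -[RHS]mul1r -kC; ring.
- move=> u v k d e h; have := gs_conjT gs h; rewrite /robin.
  have cM (x y : C) : (x * y)^*%C = x^*%C * y^*%C by exact: rmorphM.
  have cD (x y : C) : (x + y)^*%C = x^*%C + y^*%C by exact: rmorphD.
  have cN (x : C) : (- x)^*%C = - x^*%C by exact: rmorphN.
  by rewrite !(cD, cN, cM) !conjc_real.
Qed.

End RobinOfGreen.

Lemma ler_normC (R : realType) (eps : R) (w : R[i]) :
  0 <= eps -> eps ^+ 2 <= abs2 w -> eps%:C <= `|w|.
Proof.
move=> e0 h; rewrite normc_def lecE /= eqxx /=.
by rewrite -(ger0_norm e0) -sqrtr_sqr ler_sqrt// abs2_ge0.
Qed.

Lemma not_spectrum (R : realType) (H : lmodType R[i]) (N2 : H -> R)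
    (A : H -> H -> Prop) lam (B : R) :
  (forall u, 0 <= N2 u) -> 0 <= B ->
  (forall v, exists2 u, op_sub A lam u v & N2 u <= B * N2 v) ->
  (forall u u' v, op_sub A lam u v -> op_sub A lam u' v -> u = u') ->
  ~ spectrum (fun u => Num.sqrt (N2 u)) A lam.
Proof.
move=> N0 B0 sol un; apply; split=> [v|].
  by have [u uv _] := sol v; exists u; split=> // u' /(un _ _ _ uv).
exists (Num.sqrt B) => u v uv; have [u' u'v Nu'] := sol v.
by rewrite (un _ _ _ uv u'v) -sqrtrM// ler_sqrt// mulr_ge0.
Qed.

Lemma eigenvalue_spectrum (R : realType) (H : lmodType R[i]) (nrm : H -> R)
    (A : H -> H -> Prop) lam :
  A 0 0 -> is_eigenvalue A lam -> spectrum nrm A lam.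
Proof.
move=> A0 [u [u0 Au]] [bij _]; have [w [_ wE]] := bij 0.
have e0 : w = 0 by apply: wE; rewrite /op_sub scaler0 addr0.
have eu : w = u by apply: wE; rewrite /op_sub add0r.
by rewrite -eu e0 eqxx in u0.
Qed.

(** * Spectral theory of a single interval *)

Section RobinTheory.
Context {R : realType} (H : lmodType R[i]) (N : H -> R) (cf : conj_form N).
Context (s : R[i]) (P : H -> H -> R[i] -> R[i] -> R[i] -> Prop).
Context (rs : robin_system cf s P).
Local Notation C := R[i].
Local Notation form := (cf_form cf).
Implicit Types (lam c d e k x : C) (u v : H).

Definition robin_op u v := exists k e, P u v k 0 e.

Lemma rb_P0 : P 0 0 0 0 0.
Proof.
have [B _ sol] := rb_solve rs 0; have [u [d [e [h _ _ _]]]] := sol 0 0.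
by have := rb_lin rs (-1) h h; rewrite !scaleN1r !mulN1r !addNr.
Qed.

Lemma rb_scale c u v k d e : P u v k d e ->
  P (c *: u) (c *: v) (c * k) (c * d) (c * e).
Proof. by move=> h; have := rb_lin rs c h rb_P0; rewrite !addr0. Qed.

Lemma rb_sub c u v k d e u' v' k' d' e' : P u v k d e -> P u' v' k' d' e' ->
  P (u' - c *: u) (v' - c *: v) (k' - c * k) (d' - c * d) (e' - c * e).
Proof.
move=> h h'; have := rb_lin rs (- c) h h'.
by rewrite !scaleNr !mulNr ![- _ + _]addrC.
Qed.

Lemma rb_kernel lam th u k d d' e e' : P th (lam *: th) 1 d e ->
  P u (lam *: u) k d' e' -> [/\ u = k *: th, d' = k * d & e' = k * e].
Proof.
move=> hth hu; have := rb_sub k hth hu; rewrite mulr1 subrr.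
have -> : lam *: u - k *: (lam *: th) = lam *: (u - k *: th).
  by rewrite scalerBr !scalerA mulrC.
move=> h; have e0 := rb_uniq rs h; rewrite e0 in h.
have [_ /eqP + /eqP] := rb_trace0 rs h; rewrite !subr_eq0 => /eqP-> /eqP->.
by move/eqP: e0; rewrite subr_eq0 => /eqP.
Qed.

Lemma rb_theta lam : exists th d e, P th (lam *: th) 1 d e.
Proof.
have [B _ sol] := rb_solve rs lam; have [u [d [e [h _ _ _]]]] := sol 0 1.
by exists u, d, e; rewrite add0r in h.
Qed.

Lemma rb_theta_neq0 v d e th : P th v 1 d e -> th != 0.
Proof.
move=> h; apply/eqP => th0; rewrite th0 in h.
by have [/eqP] := rb_trace0 rs h; rewrite oner_eq0.
Qed.

Lemma cf_norm_neq0 u : u != 0 -> N u != 0.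
Proof. by apply: contra_neq; exact: (cf_norm_eq0 cf). Qed.

(** The parallelogram identity, with the term of u - v discarded. *)
Lemma cf_normD_le u v : N (u + v) <= 2 * (N u + N v).
Proof.
have J c w w' := cf_conj_lin cf c w w'.
have e : (N (u + v))%:C + (N (u - v))%:C = (2 * (N u + N v))%:C.
  rewrite -!(cf_normE cf) -[u + v]addrC -[u - v]addrC.
  rewrite -[v]scale1r -[- (1 *: v)]scaleNr !J !cf_formDl !cf_form_Dr.
  have -> (n m : R) : (2 * (n + m))%:C = 2 * (n%:C + m%:C).
    by apply/eqP; rewrite eq_complex /=; apply/andP; split; apply/eqP; ring.
  by rewrite -!(cf_normE cf) conjcN1 !conjc1 !scale1r; ring.
move: e; rewrite -rmorphD => /real_complex_inj <-.
by rewrite lerDl; exact: (cf_norm_ge0 cf).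
Qed.

Lemma rb_eigenP lam th d e : P th (lam *: th) 1 d e ->
  is_eigenvalue robin_op lam <-> d = 0.
Proof.
move=> hth; split=> [[u [u0 [k [e' hu]]]]|d0]; last first.
  by exists th; split; [exact: rb_theta_neq0 hth|exists 1, e; rewrite -d0].
have [uE /esym/eqP] := rb_kernel hth hu; rewrite mulf_eq0.
by case/orP => [/eqP k0|/eqP//]; rewrite uE k0 scale0r eqxx in u0.
Qed.

(** A solution with zero near data has some far value d1; adding the multiple (d' - d1) / d of th
    corrects it to d'. *)
Lemma rb_dirichlet lam th d e : P th (lam *: th) 1 d e -> d != 0 ->
  exists2 B, 0 <= B & forall v d', exists u k e',
    [/\ P u (v + lam *: u) k d' e', N u <= B * (N v + abs2 d'),
        abs2 k <= B * (N v + abs2 d') & abs2 e' <= B * (N v + abs2 d')].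
Proof.
move=> hth d0; have [B B0 sol] := rb_solve rs lam.
(* D dominates both N th and |e|^2, and Q below controls the coefficient of th, so that one constant
   serves the three estimates. *)
pose D := 1 + N th + abs2 e.
have Nth0 := cf_norm_ge0 cf th; have e0 := abs2_ge0 e.
have D0 : 0 <= D by rewrite /D; lra.
pose Q := 2 * (1 + B) * abs2 d^-1.
have Q0 : 0 <= Q by rewrite mulr_ge0 ?abs2_ge0// mulr_ge0// addr_ge0.
exists (2 * (B + Q * D) + Q) => [|v d'].
  by rewrite addr_ge0// mulr_ge0// addr_ge0// mulr_ge0.
have [u [d1 [e1 [h Nu d1B e1B]]]] := sol v 0.
rewrite abs2_0 addr0 in Nu d1B e1B.
have Nv0 := cf_norm_ge0 cf v; have d'0 := abs2_ge0 d'.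
pose c := (d' - d1) / d.
have cB : abs2 c <= Q * (N v + abs2 d').
  rewrite /c abs2M /Q mulrAC ler_wpM2r ?abs2_ge0//.
  apply: le_trans (abs2B_le _ _) _; rewrite -mulrA ler_wpM2l//.
  by have := mulr_ge0 B0 d'0; lra.
have S0 : 0 <= N v + abs2 d' by exact: addr_ge0.
have wB (x y X : R) : 0 <= y -> y <= D -> x <= B * N v -> X <= 2 * (x + abs2 c * y) ->
    X <= (2 * (B + Q * D) + Q) * (N v + abs2 d').
  move=> y0 yD xB XB; apply: le_trans XB _.
  have h1 : abs2 c * y <= Q * (N v + abs2 d') * D.
    by apply: ler_pM => //; exact: abs2_ge0.
  by have := mulr_ge0 B0 d'0; have := mulr_ge0 Q0 S0; lra.
exists (c *: th + u), (c * 1 + 0), (c * e + e1); split.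
- have := rb_lin rs c hth h.
  have -> : c * d + d1 = d' by rewrite /c divfK// subrK.
  have -> // : c *: (lam *: th) + (v + lam *: u) = v + lam *: (c *: th + u).
  by rewrite scalerDr !scalerA (mulrC lam) addrCA.
- apply: (wB _ _ _ Nth0 _ Nu); first by rewrite /D; lra.
  by apply: le_trans (cf_normD_le _ _) _; rewrite (cf_normZ cf) [N u + _]addrC.
- rewrite mulr1 addr0; apply: le_trans cB _; rewrite ler_wpM2r//.
  by rewrite lerDr mulr_ge0// addr_ge0// mulr_ge0.
- apply: (wB _ _ _ e0 _ e1B); first by rewrite /D; lra.
  by apply: le_trans (abs2D_le _ _) _; rewrite abs2M [abs2 e1 + _]addrC.
Qed.

Lemma robin_op_uniq lam th d e : P th (lam *: th) 1 d e -> d != 0 ->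
  forall u u' v, op_sub robin_op lam u v -> op_sub robin_op lam u' v -> u = u'.
Proof.
move=> hth d0 u u' v [k [e1 h]] [k' [e1' h']].
have := rb_sub 1 h' h; rewrite !scale1r !mul1r subr0.
have -> : v + lam *: u - (v + lam *: u') = lam *: (u - u').
  by rewrite opprD addrACA subrr add0r scalerBr.
case/(rb_kernel hth) => + /esym/eqP + _.
rewrite mulf_eq0 (negbTE d0) orbF => + /eqP k0; rewrite k0 scale0r.
by move=> /eqP; rewrite subr_eq0 => /eqP.
Qed.

Lemma rb_resolvent lam th d e : P th (lam *: th) 1 d e -> d != 0 ->
  exists2 B, 0 <= B & forall v, exists2 u, op_sub robin_op lam u v & N u <= B * N v.
Proof.
move=> hth d0; have [B B0 sol] := rb_dirichlet hth d0; exists B => // v.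
have [u [k [e' [h Nu _ _]]]] := sol v 0; exists u; first by exists k, e'.
by rewrite abs2_0 addr0 in Nu.
Qed.

Lemma rb_spectrum lam :
  spectrum (fun u => Num.sqrt (N u)) robin_op lam <-> is_eigenvalue robin_op lam.
Proof.
split; last by apply: eigenvalue_spectrum; exists 0, 0; exact: rb_P0.
have [th [d [e hth]]] := rb_theta lam; rewrite (rb_eigenP hth).
have [//|d0 sp] := eqVneq d 0; exfalso; move: sp.
have [B B0 sol] := rb_resolvent hth d0.
by apply: not_spectrum B0 sol (robin_op_uniq hth d0); exact: (cf_norm_ge0 cf).
Qed.

Lemma rb_eigen_real lam : is_eigenvalue robin_op lam -> lam^*%C = lam.
Proof.
move=> [u [u0 [k [e h]]]]; have h' := rb_conjP rs h.
have := rb_green rs h h'; rewrite rmorph0 mul0r mulr0 subrr mulr0.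
rewrite cf_conjZ cf_formZ cf_formZr -mulrBl cf_normE => /eqP.
rewrite mulf_eq0 orbC eq_complex /= eqxx andbT (negbTE (cf_norm_neq0 u0)) /=.
by rewrite subr_eq0 => /eqP.
Qed.

Lemma rb_eigen_dist lam (B X : R) : 0 <= B -> 0 < X ->
  X <= B * (abs2 lam * X) -> (1 + B)^-1 <= abs2 lam.
Proof.
move=> B0 X0 h; rewrite -[leLHS]mul1r ler_pdivrMr; last by rewrite ltr_wpDr.
have h1 : 1 <= B * abs2 lam by rewrite -(ler_pM2r X0) mul1r -mulrA.
by have := abs2_ge0 lam; lra.
Qed.

Lemma rb_isolated z : exists2 eps : R, 0 < eps &
  forall lam, is_eigenvalue robin_op lam -> lam != z -> eps%:C <= `|lam - z|.
Proof.
(* B may depend on z but not on lam; 1 + B is inverted so that the distance obtained is positive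
   without a separate case B = 0. *)
suff [B B0 h] : exists2 B, 0 <= B &
    forall lam, is_eigenvalue robin_op lam -> lam != z ->
    (1 + B)^-1 <= abs2 (lam - z).
  have B1 : 0 < (1 + B)^-1 by rewrite invr_gt0 ltr_wpDr.
  exists (Num.sqrt (1 + B)^-1) => [|lam hl lz]; first by rewrite sqrtr_gt0.
  by apply: ler_normC; rewrite ?sqrtr_ge0// sqr_sqrtr ?h// ltW.
have [th [d [e hth]]] := rb_theta z.
(* When z is not an eigenvalue, an eigenvector u for lam is the resolvent at z applied to (lam - z)
   u, and boundedness of the resolvent keeps lam away from z. *)
have [d0|d0] := eqVneq d 0; last first.
  have [B B0 sol] := rb_resolvent hth d0; exists B => // lam [u [u0 [k [e' hu]]]] _.
  apply: (@rb_eigen_dist _ B (N u)) => //.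
    by rewrite lt_neqAle eq_sym cf_norm_neq0//; exact: (cf_norm_ge0 cf).
  have [u' hu' Nu'] := sol ((lam - z) *: u).
  have uE : u = u'.
    apply: (robin_op_uniq hth d0) hu'; exists k, e'.
    by rewrite -scalerDl subrK.
  by rewrite -(cf_normZ cf) {1}uE.
have [B B0 sol] := rb_solve rs z; exists B => // lam hl lz.
have [th' [d' [e' hth']]] := rb_theta lam.
have zr : z^*%C = z by apply: rb_eigen_real; apply/(rb_eigenP hth).
have d'0 : d' = 0 by apply/(rb_eigenP hth').
rewrite d0 in hth; rewrite d'0 in hth'.
apply: (@rb_eigen_dist _ B (N th')) => //.
  by rewrite lt_neqAle eq_sym cf_norm_neq0 ?(rb_theta_neq0 hth')//;
    exact: (cf_norm_ge0 cf).
have orth : form th' (cf_conj cf th) = 0.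
  have := rb_green rs hth' (rb_conjP rs hth).
  rewrite rmorph0 mul0r mulr0 subrr mulr0 cf_conjZ zr cf_formZ cf_formZr -mulrBl.
  by move/eqP; rewrite mulf_eq0 subr_eq0 (negbTE lz) /= => /eqP.
have orth' : form th (cf_conj cf th') = 0.
  have := rb_green rs hth (rb_conjP rs hth').
  rewrite rmorph0 mul0r mulr0 subrr mulr0 cf_conjZ (rb_eigen_real hl).
  rewrite cf_formZ cf_formZr -mulrBl.
  by move/eqP; rewrite mulf_eq0 subr_eq0 eq_sym (negbTE lz) /= => /eqP.
have pyth : N (th' - 1 *: th) = N th' + N th.
  apply: real_complex_inj; rewrite -(cf_normE cf) -scaleNr addrC cf_conj_lin !cf_formDl !cf_form_Dr orth orth'.
  rewrite conjcN1 rmorphD /= -!(cf_normE cf).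
  by ring.
have [u [du [eu [hu Nu _ _]]]] := sol ((lam - z) *: th') 0.
rewrite abs2_0 addr0 in Nu.
have := rb_sub 1 hth hth'; rewrite mulr1 mulr0 !subr0 subrr => hw.
(* Both sides solve the equation at z with source (lam - z) th' and zero near data; u is the one
   that comes with the estimate. *)
have uE : th' - 1 *: th = u.
  have := rb_sub 1 hu hw; rewrite mulr0 subr0.
  set x := _ - 1 *: (_ + _); have -> : x = z *: (th' - 1 *: th - 1 *: u).
    rewrite /x !scale1r scalerBl !scalerBr opprD opprB addrCA !addrA addrNK.
    by rewrite addrAC.
  move=> /(rb_uniq rs)/eqP; rewrite scale1r subr_eq0 => /eqP ->.
  by rewrite scale1r.
rewrite -uE pyth (cf_normZ cf) in Nu; apply: le_trans Nu.
by rewrite lerDl; exact: (cf_norm_ge0 cf).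
Qed.

(** Green's formula for phi against th. As lam is real and th is normalized by the real datum 1, th
    is its own conjugate, so the form of th with itself is its squared norm. *)
Lemma rb_lagrange lam th e : P th (lam *: th) 1 0 e ->
  forall phi c k d' e', P phi (lam *: phi + c *: th) k d' e' ->
  c * (N th)%:C = s * (d' * e).
Proof.
move=> hth phi c k d' e' h.
have lr : lam^*%C = lam.
  by apply: rb_eigen_real; exact/(rb_eigenP hth).
have thr : cf_conj cf th = th.
  have := rb_conjP rs hth; rewrite cf_conjZ lr rmorph1 => h'.
  by have [-> _ _] := rb_kernel hth h'; rewrite scale1r.
have := rb_green rs h hth; rewrite cf_formDl cf_formZr cf_formZ -{3}thr cf_normE.
by rewrite mulr0 subr0 addrAC subrr add0r.
Qed.

(** The equation with source th is solvable when the far end is left free. If e vanished,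
    [rb_lagrange] with c = 1 would make the norm of th zero. *)
Lemma rb_far_trace_neq0 lam th e : P th (lam *: th) 1 0 e -> e != 0.
Proof.
move=> hth; have [B _ sol] := rb_solve rs lam.
have [u [d [e' [h _ _ _]]]] := sol th 0.
rewrite -[X in X + _]scale1r addrC in h.
have := rb_lagrange hth h; apply: contra_eq_neq => ->.
rewrite mul1r !mulr0 eq_complex /= eqxx andbT.
by rewrite cf_norm_neq0// (rb_theta_neq0 hth).
Qed.

(* A Jordan chain of length two above th is what it takes to reach a prescribed
   far boundary value d' when lam is an eigenvalue. *)
Lemma rb_coupling lam th d e : P th (lam *: th) 1 d e ->
  forall d', exists phi g k e', [/\ P phi (lam *: phi + g *: th) k d' e',
    d != 0 -> g = 0 & d = 0 -> g = 0 -> d' = 0].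
Proof.
move=> hth d'; have [d0|d0] := eqVneq d 0; last first.
  exists ((d' / d) *: th), 0, (d' / d * 1), (d' / d * e).
  split=> // [|d00]; last by rewrite d00 eqxx in d0.
  have := rb_scale (d' / d) hth; rewrite divfK// scale0r addr0.
  by rewrite !scalerA [lam * _]mulrC.
rewrite d0 in hth; have [B _ sol] := rb_solve rs lam.
have [u [d1 [e1 [h _ _ _]]]] := sol th 0.
rewrite -[X in X + _]scale1r addrC in h.
have d10 : d1 != 0.
  have := rb_lagrange hth h; apply: contra_eq_neq => ->.
  rewrite mul1r mul0r mulr0 eq_complex /= eqxx andbT.
  by rewrite cf_norm_neq0// (rb_theta_neq0 hth).
exists ((d' / d1) *: u), (d' / d1), (d' / d1 * 0), (d' / d1 * e1).
split=> [|d00|]; last 1 first.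
- by move=> _ /eqP; rewrite mulf_eq0 invr_eq0 (negbTE d10) orbF => /eqP.
- have := rb_scale (d' / d1) h; rewrite divfK//.
  by rewrite scalerDr !scalerA [lam * _]mulrC mulr1.
- by [].
Qed.

(** With far value zero, [rb_lagrange] excludes a chain above an eigenvector. The hypothesis on x
    restricts multiples of th to the case where lam is an eigenvalue; the conclusion restores this
    restriction for k. *)
Lemma rb_no_jordan lam th d e : P th (lam *: th) 1 d e ->
  forall phi x k e', P phi (lam *: phi + x *: th) k 0 e' -> (d != 0 -> x = 0) ->
  [/\ x = 0, phi = k *: th, e' = k * e & d != 0 -> k = 0].
Proof.
move=> hth phi x k e' h hx.
have x0 : x = 0.
  have [d0|/hx//] := eqVneq d 0; rewrite d0 in hth.
  have /eqP := rb_lagrange hth h; rewrite mul0r mulr0 mulf_eq0 => /orP[/eqP//|].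
  by rewrite eq_complex /= eqxx andbT (negbTE (cf_norm_neq0 (rb_theta_neq0 hth))).
rewrite x0 scale0r addr0 in h.
have [-> /esym/eqP + ->] := rb_kernel hth h; rewrite mulf_eq0 => kd.
by split=> // d0; case/orP: kd => /eqP // d00; rewrite d00 eqxx in d0.
Qed.

End RobinTheory.

(** * The coupled operator *)

Section Spans.
Context {R : realType} {H : lmodType R[i]}.
Local Notation C := R[i].
Implicit Types (S : set H) (c : C).

Lemma lspan_min S S0 : S `<=` S0 -> S0 0 ->
  (forall c u v, S0 u -> S0 v -> S0 (c *: u + v)) -> lspan S `<=` S0.
Proof.
move=> sS S00 lin v [n [c [e [he ->]]]].
by elim/big_ind: _ => // [x y x0 y0|i _];
  [rewrite -[x]scale1r; exact: lin|rewrite -[_ *: _]addr0; apply: lin => //; exact: sS].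
Qed.

Lemma lspan_sub S : S `<=` lspan S.
Proof.
move=> v Sv; exists 1, (fun=> 1), (fun=> v); split=> //.
by rewrite big_ord1 scale1r.
Qed.

Lemma lspan_range n (e : 'I_n -> H) :
  lspan (range e) = [set v | exists c : 'I_n -> C, v = \sum_(i < n) c i *: e i].
Proof.
apply/seteqP; split=> [|v [c ->]]; last by exists n, c, e; split=> // i; exists i.
apply: lspan_min => [_ [i _ <-]||c u v [c1 ->] [c2 ->]].
- exists (fun j => (j == i)%:R); rewrite (bigD1 i)//= eqxx scale1r big1 ?addr0//.
  by move=> j /negbTE ->; rewrite scale0r.
- by exists (fun=> 0); rewrite big1// => i _; rewrite scale0r.
- exists (fun i => c * c1 i + c2 i); rewrite scaler_sumr -big_split /=.
  by apply: eq_bigr => i _; rewrite scalerDl scalerA.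
Qed.

Lemma has_dim0 : has_dim [set 0 : H] 0.
Proof.
exists (fun=> 0); split=> [c _ []//|].
rewrite lspan_range; apply/seteqP; split=> [_ ->|v [c ->]] /=.
  by exists (fun=> 0); rewrite big_ord0.
by rewrite big_ord0.
Qed.

(** The flag decides whether e is adjoined, so that a dimension can be computed as a sum of booleans
    without separating cases. The hypothesis on e is independence from S. *)
Lemma has_dim_add S n (x : bool) (e : H) : has_dim S n ->
  (forall c, S (c *: e) -> c = 0) ->
  has_dim [set v | exists s c, [/\ S s, ~~ x -> c = 0 & v = s + c *: e]] (x + n)%N.
Proof.
move=> [f [free Sf]] fe; case: x => /=; last first.
  exists f; split=> //; rewrite -Sf; apply/seteqP; split=> [v [s [c [Ss c0 ->]]]|v Sv].
    by rewrite c0// scale0r addr0.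
  by exists v, 0; rewrite scale0r addr0.
pose g (i : 'I_n.+1) := oapp f e (unlift ord0 i).
have gE (c : 'I_n.+1 -> C) : \sum_(i < n.+1) c i *: g i =
    c ord0 *: e + \sum_(i < n) c (lift ord0 i) *: f i.
  rewrite big_ord_recl /g unlift_none /=; congr (_ + _).
  by apply: eq_bigr => i _; rewrite liftK.
exists g; split=> [c|].
  rewrite gE => h.
  have c0 : c ord0 = 0.
    apply: fe; rewrite Sf lspan_range /=; exists (fun i => - c (lift ord0 i)).
    move/eqP: h; rewrite addr_eq0 => /eqP ->.
    by rewrite -sumrN; apply: eq_bigr => i _; rewrite scaleNr.
  rewrite c0 scale0r add0r in h => i.
  by case: (unliftP ord0 i) => [j ->|-> //]; exact: (free _ h).
rewrite lspan_range; apply/seteqP; split=> [v [s [c [Ss _ ->]]]|v [c ->]] /=.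
  move: Ss; rewrite Sf lspan_range => -[c' ->].
  exists (fun i => oapp c' c (unlift ord0 i)); rewrite gE unlift_none /= addrC.
  by congr (_ + _); apply: eq_bigr => i _; rewrite liftK.
exists (\sum_(i < n) c (lift ord0 i) *: f i), (c ord0); split=> //.
  by rewrite Sf lspan_range; exists (fun i => c (lift ord0 i)).
by rewrite gE addrC.
Qed.

End Spans.

Lemma coupled_bound (R : realType) (Ba BB Bb na nB nb ua uB ub kB eB : R) :
  0 <= Ba -> 0 <= BB -> 0 <= Bb -> 0 <= na -> 0 <= nB -> 0 <= nb ->
  uB <= BB * nB -> kB <= BB * nB -> eB <= BB * nB ->
  ua <= Ba * (na + kB) -> ub <= Bb * (nb + eB) ->
  ua + uB + ub <= ((Ba + Bb) * (1 + BB) + BB) * (na + nB + nb).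
Proof.
move=> a0 B0 b0 na0 nB0 nb0 hB hk he ha hb.
have ha' : ua <= Ba * (na + BB * nB) by apply: le_trans ha _; rewrite ler_wpM2l// lerD2l.
have hb' : ub <= Bb * (nb + BB * nB) by apply: le_trans hb _; rewrite ler_wpM2l// lerD2l.
have h1 := mulr_ge0 a0 nB0; have h2 := mulr_ge0 a0 nb0.
have h3 := mulr_ge0 b0 nB0; have h4 := mulr_ge0 b0 na0.
have h5 := mulr_ge0 B0 na0; have h6 := mulr_ge0 B0 nb0.
have h7 := mulr_ge0 a0 h5; have h8 := mulr_ge0 a0 h6.
have h9 := mulr_ge0 b0 h5; have h10 := mulr_ge0 b0 h6.
have -> : ((Ba + Bb) * (1 + BB) + BB) * (na + nB + nb) =
  Ba * (na + BB * nB) + BB * nB + Bb * (nb + BB * nB) +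
  (Ba * nB + Ba * nb + Bb * nB + Bb * na + (BB * na + BB * nb) +
   (Ba * (BB * na) + Ba * (BB * nb)) + (Bb * (BB * na) + Bb * (BB * nb))) by ring.
by apply: ler_wpDr; [rewrite !addr_ge0|rewrite !lerD].
Qed.

(** The element p reaches the far value dp, so u - k' p has far value zero and [rb_no_jordan]
    applies to it. The coefficient of t in the source must then be the one produced by k' p. *)
Lemma rb_step (R : realType) (H : lmodType R[i]) (N : H -> R) (cf : conj_form N) (s : R[i])
    (P : H -> H -> R[i] -> R[i] -> R[i] -> Prop) (rs : robin_system cf s P)
    lam (t p u : H) (d e kp dp ep g x k e' k' : R[i]) :
  P t (lam *: t) 1 d e -> P p (lam *: p + g *: t) kp dp ep ->
  (d != 0 -> g = 0) -> (d != 0 -> x = 0) ->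
  P u (x *: t + lam *: u) k (k' * dp) e' ->
  x = k' * g /\ exists c, u = c *: t + k' *: p /\ (d != 0 -> c = 0).
Proof.
move=> ht hp hg hx hu; have := rb_sub rs k' hp hu.
rewrite subrr.
have -> : x *: t + lam *: u - k' *: (lam *: p + g *: t) =
    lam *: (u - k' *: p) + (x - k' * g) *: t.
  rewrite scalerBr scalerBl !scalerDr !scalerA (mulrC lam) opprD addrACA.
  by rewrite addrACA [x *: t + _]addrC addrACA.
move=> h; have := rb_no_jordan rs ht h.
case=> [d0|/eqP + /eqP + _ hk]; first by rewrite hx// hg// mulr0 subrr.
rewrite subr_eq0 => /eqP -> ; rewrite subr_eq => /eqP ->; split=> //.
by exists (k - k' * kp).
Qed.

(** * Root subspaces of the coupled operator *)

Section Coupled.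
Context {R : realType} (Ha HB Hb : lmodType R[i]).
Context (Na : Ha -> R) (NB : HB -> R) (Nb : Hb -> R).
Context (cfa : conj_form Na) (cfB : conj_form NB) (cfb : conj_form Nb).
Context (sa sB sb : R[i]).
Context (Pa : Ha -> Ha -> R[i] -> R[i] -> R[i] -> Prop)
        (PB : HB -> HB -> R[i] -> R[i] -> R[i] -> Prop)
        (Pb : Hb -> Hb -> R[i] -> R[i] -> R[i] -> Prop).
Context (rsa : robin_system cfa sa Pa) (rsB : robin_system cfB sB PB)
        (rsb : robin_system cfb sb Pb).
Local Notation C := R[i].
Local Notation H := ((Ha * HB * Hb)%type : lmodType R[i]).

(** The matching conditions are the shared variables: the near datum kB and the second far value eB
    of the middle component are the far values of the outer ones. The 0 is the condition at the
    right end of the middle interval. *)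
Definition coupled (U V : H) := exists ka ea kB eB kb eb,
  [/\ Pa U.1.1 V.1.1 ka kB ea, PB U.1.2 V.1.2 kB 0 eB & Pb U.2 V.2 kb eB eb].

Definition coupled_sqnorm (U : H) : R := Na U.1.1 + NB U.1.2 + Nb U.2.

Lemma coupled_sqnorm_ge0 U : 0 <= coupled_sqnorm U.
Proof.
by rewrite !addr_ge0//; [exact: cf_norm_ge0 cfa _|exact: cf_norm_ge0 cfB _|
  exact: cf_norm_ge0 cfb _].
Qed.

Lemma coupled0 : coupled 0 0.
Proof.
exists 0, 0, 0, 0, 0, 0.
by split; [exact: rb_P0 rsa|exact: rb_P0 rsB|exact: rb_P0 rsb].
Qed.

Lemma coupled_sub U V U' V' : coupled U V -> coupled U' V' -> coupled (U' - U) (V' - V).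
Proof.
move=> [ka [ea [kB [eB [kb [eb [ha hB hb]]]]]]].
move=> [ka' [ea' [kB' [eB' [kb' [eb' [ha' hB' hb']]]]]]].
have h1 := rb_sub rsa 1 ha ha'; have h2 := rb_sub rsB 1 hB hB'.
have h3 := rb_sub rsb 1 hb hb'; rewrite !scale1r !mul1r ?subr0 in h1 h2 h3.
by do 6 eexists; split; [exact: h1|exact: h2|exact: h3].
Qed.

Section AtPoint.
Context (lam : C).
Context (ta : Ha) (tB : HB) (tb : Hb) (da ea dB eB db eb : C).
Context (hta : Pa ta (lam *: ta) 1 da ea) (htB : PB tB (lam *: tB) 1 dB eB)
  (htb : Pb tb (lam *: tb) 1 db eb).
Context (pa : Ha) (pb : Hb) (ga gb ka kb xa xb : C).
Context (hpa : Pa pa (lam *: pa + ga *: ta) ka 1 xa)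
  (hpb : Pb pb (lam *: pb + gb *: tb) kb eB xb).
Context (ga0 : da != 0 -> ga = 0) (gb0 : db != 0 -> gb = 0).

(* The vanishing of da, dB, db expresses that lam is an eigenvalue of the outer
   parts and of the middle one.  combo 1 0 0 and combo 0 0 1 are the extensions
   by 0 of the outer eigenfunctions, and combo 0 1 0 the extension of the middle
   one, whose outer components are Jordan chains of length two when ga or gb is
   nonzero. *)
Let combo (x y z : C) : H := (x *: ta + y *: pa, y *: tB, z *: tb + y *: pb).

Definition jordan_span : set H := [set U | exists x y z,
  [/\ U = combo x y z, da != 0 -> x = 0, dB != 0 -> y = 0 & db != 0 -> z = 0]].

Let combo0 : combo 0 0 0 = 0.
Proof. by rewrite /combo !scale0r !addr0. Qed.

Let comboD c x y z x' y' z' :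
  c *: combo x y z + combo x' y' z' = combo (c * x + x') (c * y + y') (c * z + z').
Proof.
rewrite /combo !scalerDl -!scalerA; congr (_, _, _) => /=.
  by rewrite scalerDr addrACA.
by rewrite scalerDr addrACA.
Qed.

Let comboE x y z :
  x *: combo 1 0 0 + y *: combo 0 1 0 + z *: combo 0 0 1 = combo x y z.
Proof.
rewrite /combo; congr (_, _, _) => /=;
  by rewrite !(scale0r, scale1r, scaler0, addr0, add0r) // addrC.
Qed.

Let mask0 (d k : C) : (d != 0 -> k = 0) -> k * d = 0.
Proof. by have [->|d0 ->] := eqVneq d 0; rewrite ?mulr0 ?mul0r. Qed.

(** Reading the action of the operator backwards. The middle equation involves only the middle
    component and admits no Jordan chain, so y = 0; its solution is a multiple y' of tB, and
    [rb_step] with far values proportional to y' determines the outer components. *)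
Lemma jordan_step U x y z : (da != 0 -> x = 0) -> (dB != 0 -> y = 0) ->
  (db != 0 -> z = 0) -> op_sub coupled lam U (combo x y z) ->
  exists x' y' z', [/\ U = combo x' y' z',
    [/\ da != 0 -> x' = 0, dB != 0 -> y' = 0 & db != 0 -> z' = 0],
    y = 0, x = y' * ga & z = y' * gb].
Proof.
move=> mx my mz; case: U => [[u1 u2] u3].
move=> [k1 [e1 [k2 [e2 [k3 [e3 [/= h1 h2 h3]]]]]]].
rewrite addrC in h2.
have [y0 u2E e2E mk2] := rb_no_jordan rsB htB h2 my.
rewrite y0 !scale0r addr0 in h1; rewrite y0 !scale0r addr0 in h3.
rewrite -[k2]mulr1 in h1; rewrite e2E in h3.
have [xE [x' [u1E mx']]] := rb_step rsa hta hpa ga0 mx h1.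
have [zE [z' [u3E mz']]] := rb_step rsb htb hpb gb0 mz h3.
by exists x', k2, z'; split=> //; rewrite u1E u2E u3E.
Qed.

Lemma jordan_op x y z : (da != 0 -> x = 0) -> (dB != 0 -> y = 0) ->
  (db != 0 -> z = 0) -> op_sub coupled lam (combo x y z) (combo (y * ga) 0 (y * gb)).
Proof.
move=> mx my mz.
exists (x * 1 + y * ka), (x * ea + y * xa), y, (y * eB), (z * 1 + y * kb), (z * eb + y * xb).
split=> /=.
- have := rb_lin rsa x hta (rb_scale rsa y hpa); rewrite (mask0 mx) add0r mulr1.
  have -> // : x *: (lam *: ta) + y *: (lam *: pa + ga *: ta) =
     (y * ga) *: ta + 0 *: pa + lam *: (x *: ta + y *: pa).
  by rewrite scale0r addr0 !scalerDr !scalerA !(mulrC lam) addrA addrC.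
- have := rb_scale rsB y htB; rewrite (mask0 my) mulr1.
  by rewrite scale0r add0r !scalerA (mulrC lam).
- have := rb_lin rsb z htb (rb_scale rsb y hpb); rewrite (mask0 mz) add0r.
  have -> // : z *: (lam *: tb) + y *: (lam *: pb + gb *: tb) =
     (y * gb) *: tb + 0 *: pb + lam *: (z *: tb + y *: pb).
  by rewrite scale0r addr0 !scalerDr !scalerA !(mulrC lam) addrA addrC.
Qed.

Let T := op_sub coupled lam.

Lemma jordan_span0 : jordan_span 0.
Proof. by exists 0, 0, 0; rewrite combo0. Qed.

(** Preimages of elements of [jordan_span] stay in it, so by induction the span contains the kernels
    of all powers. *)
Lemma op_ker_pow_jordan k : op_ker (op_pow T k) `<=` jordan_span.
Proof.
elim: k => [u /= ->|k IH u [w [Tuw /IH [x [y [z [wE mx my mz]]]]]]].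
  exact: jordan_span0.
rewrite wE in Tuw; have [x' [y' [z' [uE [mx' my' mz'] _ _ _]]]] := jordan_step mx my mz Tuw.
by exists x', y', z'.
Qed.

(** One application leaves an element without middle component, and such an element is killed by the
    next application. *)
Lemma jordan_ker_pow2 : jordan_span `<=` op_ker (op_pow T 2).
Proof.
move=> u [x [y [z [-> mx my mz]]]].
have mga : da != 0 -> y * ga = 0 by move=> d0; rewrite ga0// mulr0.
have mgb : db != 0 -> y * gb = 0 by move=> d0; rewrite gb0// mulr0.
exists (combo (y * ga) 0 (y * gb)); split; first exact: jordan_op.
exists (combo (0 * ga) 0 (0 * gb)); split; first exact: jordan_op.
by rewrite !mul0r combo0.
Qed.

Lemma root_subspaceE : root_subspace coupled lam = jordan_span.
Proof.
apply/seteqP; split=> [|u /jordan_ker_pow2 hu]; last first.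
  by apply: lspan_sub; exists 2.
apply: lspan_min => [u [k _ /op_ker_pow_jordan//]||]; first exact: jordan_span0.
move=> c _ _ [x [y [z [-> mx my mz]]]] [x' [y' [z' [-> mx' my' mz']]]].
exists (c * x + x'), (c * y + y'), (c * z + z'); split; first exact: comboD.
- by move=> d0; rewrite mx// mx'// mulr0 addr0.
- by move=> d0; rewrite my// my'// mulr0 addr0.
- by move=> d0; rewrite mz// mz'// mulr0 addr0.
Qed.

Lemma jordan_span_ker2 : jordan_span = op_ker (op_pow T 2).
Proof. by apply/seteqP; split; [exact: jordan_ker_pow2|exact: op_ker_pow_jordan]. Qed.

Lemma jordan_span_ker1 : dB != 0 -> jordan_span = op_ker (op_pow T 1).
Proof.
move=> dB0; apply/seteqP; split; last exact: op_ker_pow_jordan.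
move=> u [x [y [z [-> mx my mz]]]]; exists (combo (y * ga) 0 (y * gb)).
by split; [exact: jordan_op|rewrite my// !mul0r combo0].
Qed.

(** The witness is [combo 0 1 0], the extension of the middle eigenfunction: its image has outer
    coefficients ga and gb. *)
Lemma jordan_span_nker1 : dB = 0 -> ga != 0 \/ gb != 0 ->
  jordan_span <> op_ker (op_pow T 1).
Proof.
move=> dB0 g0 E; have : op_ker (op_pow T 1) (combo 0 1 0).
  by rewrite -E; exists 0, 1, 0; split=> //; rewrite dB0 eqxx.
move=> [w [Tw w0]]; rewrite w0 -combo0 in Tw.
have [|||x' [y' [z' [[_ yE _] _ _ gaE gbE]]]] := jordan_step _ _ _ Tw; rewrite ?dB0 //.
have y1 : y' = 1.
  move/eqP: yE; rewrite -subr_eq0 -scalerBl scaler_eq0 (negbTE (rb_theta_neq0 rsB htB)).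
  by rewrite orbF subr_eq0 => /eqP.
rewrite y1 !mul1r in gaE gbE.
by case: g0; rewrite -?gaE -?gbE eqxx.
Qed.

(** The three generators are independent whatever the flags, because ta, tB and tb are nonzero and
    only the second generator has a middle component; the flags merely select among them. *)
Lemma jordan_span_dim : has_dim jordan_span ((da == 0)%R + (dB == 0)%R + (db == 0)%R)%N.
Proof.
have ta0 := rb_theta_neq0 rsa hta; have tB0 := rb_theta_neq0 rsB htB.
have tb0 := rb_theta_neq0 rsb htb.
have sc0 (K : lmodType C) (v : K) (c : C) : v != 0 -> c *: v = 0 -> c = 0.
  by move=> v0 /eqP; rewrite scaler_eq0 (negbTE v0) orbF => /eqP.
have h0 (c : C) : [set 0 : H] (c *: combo 1 0 0) -> c = 0.
  rewrite -[c *: _]addr0 -combo0 comboD => /= -[+ _ _].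
  by rewrite !(scale0r, scale1r, scaler0, mulr0, mulr1, addr0, add0r); exact: sc0.
have d1 := has_dim_add (da == 0) (@has_dim0 R H) h0.
set S1 := [set v | _] in d1.
have h1 (c : C) : S1 (c *: combo 0 1 0) -> c = 0.
  move=> [_ [c' [-> _]]]; rewrite add0r => -[_ + _].
  by rewrite !(scale0r, scale1r, scaler0, mulr0, mulr1, addr0, add0r); exact: sc0.
have d2 := has_dim_add (dB == 0) d1 h1.
set S2 := [set v | _] in d2.
have h2 (c : C) : S2 (c *: combo 0 0 1) -> c = 0.
  move=> [_ [c2 [[_ [c1 [-> _ ->]]] _]]]; rewrite add0r => -[_].
  rewrite /= !scale0r !scale1r !scaler0 !addr0 !add0r => /esym/(sc0 _ _ _ tB0) ->.
  by rewrite !(scale0r, scale1r, scaler0, mulr0, mulr1, addr0, add0r); exact: sc0.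
have d3 := has_dim_add (db == 0) d2 h2.
set S3 := [set v | _] in d3.
rewrite addn0 addnC [X in (X + _)%N]addnC in d3; suff <- : S3 = jordan_span by [].
apply/seteqP; split=> [_ [_ [z [[_ [y [[_ [x [-> mx ->]]] my ->]]] mz ->]]]|].
  by exists x, y, z; split=> //; rewrite add0r comboE.
move=> _ [x [y [z [-> mx my mz]]]].
exists (x *: combo 1 0 0 + y *: combo 0 1 0), z; split=> //.
  exists (x *: combo 1 0 0), y; split=> //.
  by exists 0, x; rewrite add0r.
Qed.

Lemma coupled_eigen : [|| da == 0, dB == 0 | db == 0] -> is_eigenvalue coupled lam.
Proof.
have ev x y z : combo x y z != 0 -> (da != 0 -> x = 0) -> (dB != 0 -> y = 0) ->
    (db != 0 -> z = 0) -> y * ga = 0 -> y * gb = 0 -> is_eigenvalue coupled lam.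
  move=> u0 mx my mz ga1 gb1; exists (combo x y z); split=> //.
  by have := jordan_op mx my mz; rewrite ga1 gb1 combo0 /op_sub add0r.
have [da0 _|da0] := eqVneq da 0.
  apply: (ev 1 0 0); rewrite ?da0 ?eqxx ?mul0r//.
  apply: contra_neq (rb_theta_neq0 rsa hta) => -[+ _ _].
  by rewrite scale1r scale0r addr0.
have [db0 _|db0] := eqVneq db 0.
  apply: (ev 0 0 1); rewrite ?db0 ?eqxx ?mul0r//.
  apply: contra_neq (rb_theta_neq0 rsb htb) => -[_ _].
  by rewrite scale1r scale0r addr0.
(* Neither outer part has the eigenvalue, so ga = gb = 0 and the extended middle eigenfunction is an
   eigenvector. *)
rewrite orbF /= => /eqP dB0; apply: (ev 0 1 0); rewrite ?dB0 ?eqxx ?ga0 ?gb0 ?mulr0//.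
apply: contra_neq (rb_theta_neq0 rsB htB) => -[_ + _].
by rewrite scale1r.
Qed.

Lemma coupled_resolvent : da != 0 -> dB != 0 -> db != 0 ->
  ~ spectrum (fun U => Num.sqrt (coupled_sqnorm U)) coupled lam.
Proof.
move=> da0 dB0 db0.
have [Ba Ba0 sola] := rb_dirichlet rsa hta da0.
have [BB BB0 solB] := rb_dirichlet rsB htB dB0.
have [Bb Bb0 solb] := rb_dirichlet rsb htb db0.
pose B := (Ba + Bb) * (1 + BB) + BB.
have B0 : 0 <= B.
  by apply: addr_ge0 => //; apply: mulr_ge0; apply: addr_ge0.
apply: not_spectrum coupled_sqnorm_ge0 B0 _ _ => [[[va vB] vb]|U U' V hU hU'].
  (* The middle equation is solved first; its values k and e at the two ends are then prescribed to
     the outer equations. *)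
  have [uB [k [e [hB NuB kB eB']]]] := solB vB 0.
  rewrite abs2_0 addr0 in NuB kB eB'.
  have [ua [k1 [e1 [h1 Nua _ _]]]] := sola va k.
  have [ub [k2 [e2 [h2 Nub _ _]]]] := solb vb e.
  exists (ua, uB, ub); first by exists k1, e1, k, e, k2, e2.
  apply: coupled_bound Ba0 BB0 Bb0 _ _ _ NuB kB eB' Nua Nub.
  - exact: cf_norm_ge0 cfa _.
  - exact: cf_norm_ge0 cfB _.
  - exact: cf_norm_ge0 cfb _.
(* Uniqueness: the difference of two solutions has image [combo 0 0 0], hence is a [combo] whose
   three coefficients all vanish here. *)
have := coupled_sub hU' hU.
have -> : V + lam *: U - (V + lam *: U') = combo 0 0 0 + lam *: (U - U').
  by rewrite combo0 add0r opprD addrACA subrr add0r scalerBr.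
case/(jordan_step _ _ _) => // x [y [z [uE [mx my mz] _ _ _]]].
by apply/eqP; rewrite -subr_eq0 uE mx// my// mz// combo0.
Qed.

End AtPoint.

Theorem coupled_spectral lam : exists xa xB xb : bool,
  [/\ [/\ is_eigenvalue (robin_op Pa) lam <-> xa,
          is_eigenvalue (robin_op PB) lam <-> xB &
          is_eigenvalue (robin_op Pb) lam <-> xb],
      [|| xa, xB | xb] -> is_eigenvalue coupled lam,
      ~~ [|| xa, xB | xb] ->
        ~ spectrum (fun U => Num.sqrt (coupled_sqnorm U)) coupled lam,
      has_dim (root_subspace coupled lam) (xa + xB + xb)%N &
      [/\ root_subspace coupled lam = op_ker (op_pow (op_sub coupled lam) 2),
          ~~ xB -> root_subspace coupled lam = op_ker (op_pow (op_sub coupled lam) 1) &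
          xB -> xa || xb ->
          root_subspace coupled lam <> op_ker (op_pow (op_sub coupled lam) 1)]].
Proof.
have [ta [da [ea hta]]] := rb_theta rsa lam.
have [tB [dB [eB htB]]] := rb_theta rsB lam.
have [tb [db [eb htb]]] := rb_theta rsb lam.
(* The prescribed far values 1 and eB are the values at the two ends of tB, which is normalized to
   have value 1 on the left. *)
have [pa [ga [ka [xa [hpa ga0 ga1]]]]] := rb_coupling rsa hta 1.
have [pb [gb [kb [xb [hpb gb0 gb1]]]]] := rb_coupling rsb htb eB.
exists (da == 0), (dB == 0), (db == 0).
have JE := root_subspaceE hta htB htb hpa hpb ga0 gb0.
split.
- split.
  + by rewrite (rb_eigenP rsa hta); split=> /eqP.
  + by rewrite (rb_eigenP rsB htB); split=> /eqP.
  + by rewrite (rb_eigenP rsb htb); split=> /eqP.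
- exact: (coupled_eigen hta htB htb hpa hpb ga0 gb0).
- rewrite !negb_or => /and3P[da0 dB0 db0].
  exact: (coupled_resolvent hta htB htb hpa hpb ga0 gb0).
- by rewrite JE; exact: (jordan_span_dim hta htB htb).
- rewrite JE; split.
  + exact: (jordan_span_ker2 hta htB htb hpa hpb ga0 gb0).
  + exact: (jordan_span_ker1 hta htB htb hpa hpb ga0 gb0).
  + move=> /eqP dB0 dab; apply: (jordan_span_nker1 hta htB htb hpa hpb ga0 gb0 dB0).
    (* If an outer part has the eigenvalue but its chain coefficient is zero, the value it had to
       reach is zero. It is 1 on the left and the far value eB of an eigenfunction on the right,
       neither of which vanishes. *)
    case/orP: dab => /eqP d0; [left|right]; apply/eqP => g0.
      by have /eqP := ga1 d0 g0; rewrite oner_eq0.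
    rewrite dB0 in htB; have := rb_far_trace_neq0 rsB htB.
    by rewrite (gb1 d0 g0) eqxx.
Qed.

End Coupled.

Theorem coupled_theorem (R : realType) (Ha HB Hb : lmodType R[i])
    (Na : Ha -> R) (NB : HB -> R) (Nb : Hb -> R)
    (cfa : conj_form Na) (cfB : conj_form NB) (cfb : conj_form Nb) (s1 s2 s3 : R[i])
    (Pa : Ha -> Ha -> R[i] -> R[i] -> R[i] -> Prop)
    (PB : HB -> HB -> R[i] -> R[i] -> R[i] -> Prop)
    (Pb : Hb -> Hb -> R[i] -> R[i] -> R[i] -> Prop)
    (rsa : robin_system cfa s1 Pa) (rsB : robin_system cfB s2 PB)
    (rsb : robin_system cfb s3 Pb) :
  let A_a := robin_op Pa in let A_b := robin_op Pb in let B := robin_op PB in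
  let A := coupled Pa PB Pb in
  let nrm := fun U => Num.sqrt (coupled_sqnorm Na NB Nb U) in
  let sA := spectrum nrm A in
  let sa := spectrum (fun u => Num.sqrt (Na u)) A_a in
  let sb := spectrum (fun u => Num.sqrt (Nb u)) A_b in
  let sB := spectrum (fun u => Num.sqrt (NB u)) B in
  let X := root_subspace A in
  let ker_pow (lam : R[i]) (k : nat) := op_ker (op_pow (op_sub A lam) k) in
  [/\ [/\ real_spectrum nrm A, discrete_spectrum nrm A & sA = sa `|` sB `|` sb],
      forall lam : R[i],
        [\/ [/\ sa lam, ~ sB lam & ~ sb lam],
            [/\ ~ sa lam, sB lam & ~ sb lam] |
            [/\ ~ sa lam, ~ sB lam & sb lam]] ->
        eigenvalue_of_mult A lam 1%N,
      forall lam : R[i], sa lam -> sb lam -> ~ is_eigenvalue B lam ->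
        eigenvalue_of_mult A lam 2%N /\ X lam = ker_pow lam 1%N &
      [/\ forall lam : R[i], sa lam -> sB lam -> ~ is_eigenvalue A_b lam ->
            [/\ eigenvalue_of_mult A lam 2%N, X lam = ker_pow lam 2%N &
                X lam <> ker_pow lam 1%N],
          forall lam : R[i], sb lam -> sB lam -> ~ is_eigenvalue A_a lam ->
            [/\ eigenvalue_of_mult A lam 2%N, X lam = ker_pow lam 2%N &
                X lam <> ker_pow lam 1%N] &
          forall lam : R[i], sa lam -> sb lam -> sB lam ->
            [/\ eigenvalue_of_mult A lam 3%N, X lam = ker_pow lam 2%N &
                X lam <> ker_pow lam 1%N]]].
Proof.
move=> A_a A_b B A nrm sA sa sb sB X ker_pow.
have saP lam : sa lam = is_eigenvalue A_a lam := propext (rb_spectrum rsa lam).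
have sbP lam : sb lam = is_eigenvalue A_b lam := propext (rb_spectrum rsb lam).
have sBP lam : sB lam = is_eigenvalue B lam := propext (rb_spectrum rsB lam).
(* Three booleans record which parts have the eigenvalue lam; each assertion then becomes a finite
   case analysis on them. *)
have spec lam : exists xa xB xb : bool,
  [/\ [/\ sa lam = xa, sB lam = xB & sb lam = xb],
      sA lam = [|| xa, xB | xb],
      [|| xa, xB | xb] -> eigenvalue_of_mult A lam (xa + xB + xb)%N &
      [/\ X lam = ker_pow lam 2%N, ~~ xB -> X lam = ker_pow lam 1%N &
          xB -> xa || xb -> X lam <> ker_pow lam 1%N]].
  have [xa [xB [xb [[ea eB eb] ev res dim ker]]]] := coupled_spectral rsa rsB rsb lam.
  exists xa, xB, xb; split; last exact: ker.
  - by rewrite saP sbP sBP; split; apply: propext.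
  - apply: propext; split=> [sp|x].
      by case: (boolP [|| xa, xB | xb]) => [x|/res /(_ sp)].
    exact: (eigenvalue_spectrum (coupled0 rsa rsB rsb) (ev x)).
  - by move=> x; split; [exact: ev|exact: dim].
have sAE : sA = sa `|` sB `|` sb.
  apply/seteqP; split=> lam /=.
    have [xa [xB [xb [[-> -> ->] -> _ _]]]] := spec lam.
    by case/or3P => x; [left; left|left; right|right].
  have [xa [xB [xb [[-> -> ->] -> _ _]]]] := spec lam.
  by case=> [[|]|] ->; rewrite ?orbT.
split.
- split=> //.
  + move=> lam; rewrite -/(sA lam) sAE => sp.
    have : lam^*%C = lam.
      rewrite /= saP sBP sbP in sp; case: sp => [[|]|] e.
      * exact: (rb_eigen_real rsa e).
      * exact: (rb_eigen_real rsB e).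
      * exact: (rb_eigen_real rsb e).
    by case: lam {sp} => x y [] /eqP; rewrite eq_sym -addr_eq0 -mulr2n mulrn_eq0 => /eqP.
  + split=> [lam sp|z].
      have [xa [xB [xb [_ sP mult _]]]] := spec lam.
      by exists (xa + xB + xb)%N; apply: mult; rewrite -sP.
    have [ea ea0 ha] := rb_isolated rsa z.
    have [eB eB0 hB] := rb_isolated rsB z.
    have [eb eb0 hb] := rb_isolated rsb z.
    exists (Num.min ea (Num.min eB eb)) => [|lam]; first by rewrite !lt_min ea0 eB0.
    rewrite -/(sA lam) sAE => sp lz.
    have le e : Num.min ea (Num.min eB eb) <= e -> e%:C <= `|lam - z| ->
        (Num.min ea (Num.min eB eb))%:C <= `|lam - z|.
      by move=> h; apply: le_trans; rewrite lecR.
    rewrite /= saP sBP sbP in sp; case: sp => [[|]|] e.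
    * by apply: le (ha _ e lz); rewrite ge_min lexx.
    * by apply: le (hB _ e lz); rewrite !ge_min lexx orbT.
    * by apply: le (hb _ e lz); rewrite !ge_min lexx !orbT.
- move=> lam; have [xa [xB [xb [[ea eB eb] _ mult _]]]] := spec lam.
  rewrite ea eB eb; move: mult; case: xa xB xb {ea eB eb} => [] [] [] mult;
    first [by move=> _; exact: mult|case=> [[x y z]|[x y z]|[x y z]]; exfalso];
    by first [exact: (x isT)|exact: (y isT)|exact: (z isT)|done].
- move=> lam; have [xa [xB [xb [[ea eB eb] _ mult [_ k1 _]]]]] := spec lam.
  rewrite ea eb -sBP eB; move: mult k1; case: xa xB xb {ea eB eb} => [] [] [] // mult k1.
  by move=> _ _ _; split; [exact: mult|exact: k1].
- split=> lam; have [xa [xB [xb [[ea eB eb] _ mult [k2 _ k3]]]]] := spec lam.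
  + rewrite ea eB -sbP eb; move: mult k3; case: xa xB xb {ea eB eb} => [] [] [] // mult k3.
    by move=> _ _ _; split; [exact: mult|exact: k2|exact: k3].
  + rewrite eb eB -saP ea; move: mult k3; case: xa xB xb {ea eB eb} => [] [] [] // mult k3.
    by move=> _ _ _; split; [exact: mult|exact: k2|exact: k3].
  + rewrite ea eB eb; move: mult k3; case: xa xB xb {ea eB eb} => [] [] [] // mult k3.
    by move=> _ _ _; split; [exact: mult|exact: k2|exact: k3].
Qed.

(** * Identification of the operators *)

Section Identification.
Context {R : realType}.
Local Notation mu := (@lebesgue_measure R).
Local Notation C := R[i].
Implicit Types (l r x : R) (rho q : R -> R).

Lemma Linfty_sub l r l' r' q : l <= l' -> r' <= r -> Linfty l r q -> Linfty l' r' q.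
Proof.
move=> ll rr [mq [M qM]]; have sub : `]l', r'[ `<=` (`]l, r[ : set R).
  by apply: subset_itv; rewrite bnd_simp.
split; first exact: measurable_funS sub mq.
by exists M; refine (aeS qM _) => x qx /sub.
Qed.

Lemma uniformly_positive_sub l r l' r' q : l <= l' -> r' <= r ->
  uniformly_positive l r q -> uniformly_positive l' r' q.
Proof.
move=> ll rr [c c0 qc]; have sub : `]l', r'[ `<=` (`]l, r[ : set R).
  by apply: subset_itv; rewrite bnd_simp.
by exists c => //; refine (aeS qc _) => x qx /sub.
Qed.

Lemma sl_green l r rho q : l < r -> Linfty l r rho -> uniformly_positive l r rho ->
  Linfty l r q -> exists cf : conj_form (@L2sqnorm R l r rho),
  green_system cf (-1) (@sl_max R l r rho q).
Proof.
move=> lr hrho prho hq.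
have [rt [c [M [mrt c0 rtb rtE]]]] := positive_version hrho prho.
have [qt [M' [mqt qtM qtE]]] := bounded_version hq.
(* The estimates for the maximal operator use a single bound for the weight and the potential. *)
pose M1 := Num.max M M'.
have rtb1 x : c <= rt x <= M1 by case/andP: (rtb x) => -> h; rewrite le_max h.
have qtM1 x : `|qt x| <= M1 by rewrite le_max qtM orbT.
by eexists; exact: (sl_green_system lr hrho.1 c0 mrt rtb1 rtE mqt qtM1 qtE).
Qed.

(** Stated for an arbitrary condition on the four boundary values, so that one passage from weak
    derivatives to continuous representatives serves all the operators. *)
Lemma sl_opP l r rho q (bc : C -> C -> C -> C -> Prop) (u v : L2 rho l r) : l < r ->
  sl_op q (fun f f1 => bc (bval l r f l) (bval l r f1 l) (bval l r f r) (bval l r f1 r))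
    u v <->
  exists s0 s1 t0 t1, @sl_max R l r rho q u v s0 s1 t0 t1 /\ bc s0 s1 t0 t1.
Proof.
move=> lr; have lI : l <= l <= r by rewrite lexx ltW.
have rI : l <= r <= r by rewrite lexx ltW.
split=> [[f [f1 [f2 [/(sobolev2_W2 lr)[F [F1 [w fF f1F1]]] hbc uf vf]]]]|].
  have [cF cF1] := W2_continuous (ltW lr) w.
  exists (F l), (F1 l), (F r), (F1 r); split.
    exists F, F1, f2; split=> //; first exact: ae_eqC_trans uf fF.
    apply: ae_eqC_trans vf _; refine (aeS fF _) => x fx xlr.
    by rewrite /tau fx.
  by move: hbc; rewrite !(bval_continuous lr cF fF)// !(bval_continuous lr cF1 f1F1).
move=> [s0 [s1 [t0 [t1 [[F [F1 [G [w uF vF [<- <- <- <-]]]]] hbc]]]]].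
have [cF cF1] := W2_continuous (ltW lr) w.
exists F, F1, G; split=> //; first exact: W2_sobolev2.
have FF : ae_eqC l r F F by exact: aeW.
have FF1 : ae_eqC l r F1 F1 by exact: aeW.
by rewrite !(bval_continuous lr cF FF)// !(bval_continuous lr cF1 FF1).
Qed.

Lemma sl_max_bval l r rho q (u v : L2 rho l r) s0 s1 t0 t1 : l < r ->
  @sl_max R l r rho q u v s0 s1 t0 t1 ->
  bval l r (L2repr u) l = s0 /\ bval l r (L2repr u) r = t0.
Proof.
move=> lr [F [F1 [G [w uF vF [<- _ <- _]]]]].
have [cF _] := W2_continuous (ltW lr) w.
by split; apply: (bval_continuous lr cF uF); rewrite lexx ltW.
Qed.

Context (h : R -> R).

(** With these coefficients, k and e are the values of the function at the left and right ends, d is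
    its derivative at the right end, and its derivative at the left end is zero. *)
Definition neumann := robin (@sl_max R (-1) 1 h (cst 0)) 0 1 0 1.

Let lt11 : -1 < 1 :> R. Proof. by rewrite gtrN. Qed.

Lemma op_BP u v : op_B h u v <->
  neumann u v (bval (-1) 1 (L2repr u) (-1)) 0 (bval (-1) 1 (L2repr u) 1).
Proof.
have P := sl_opP (cst 0) (fun _ s1 _ t1 => s1 = 0 /\ t1 = 0) u v lt11.
split=> [/P[s0 [s1 [t0 [t1 [m [bc1 bc2]]]]]]|m].
  have [-> ->] := sl_max_bval lt11 m; rewrite bc1 bc2 in m.
  by rewrite /neumann /robin mulr1 mulr0 oppr0 mul0r mul1r mulr0 mul0r add0r subr0.
apply/P; do 4 eexists; split; first exact: m.
by rewrite mulr0 oppr0 mulr0 mul0r subr0.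
Qed.

Lemma neumann_bval u v k d e : neumann u v k d e ->
  bval (-1) 1 (L2repr u) (-1) = k /\ bval (-1) 1 (L2repr u) 1 = e.
Proof.
by move=> /(sl_max_bval lt11)[-> ->]; rewrite mulr1 mul0r mul1r add0r.
Qed.

Lemma op_BE : op_B h = robin_op neumann.
Proof.
apply/funext => u; apply/funext => v; apply/propext; split=> [/op_BP m|[k [e m]]].
  by do 2 eexists; exact: m.
by apply/op_BP; have [-> ->] := neumann_bval m.
Qed.

Context (a b alpha beta : R) (q r : R -> R) (a0 : a < 0) (b0 : 0 < b).

Definition robin_a := robin (@sl_max R a 0 r q) (cos alpha) (sin alpha) 1 0.

(** The end points are exchanged so that b, which carries the boundary condition, comes first and
    the coupling point 0 is the far end, as for [robin_a]. *)
Definition robin_b :=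
  robin (fun u v s0 s1 t0 t1 => @sl_max R 0 b r q u v t0 t1 s0 s1) (cos beta) (sin beta) 1 0.

Lemma op_Aring_aP u v : op_Aring_a alpha q u v <->
  exists k e, robin_a u v k (bval a 0 (L2repr u) 0) e.
Proof.
have e1 := cos2Dsin2 alpha.
have e2 : 1 ^+ 2 + 0 ^+ 2 = 1 :> R by rewrite expr1n expr0n addr0.
have P := sl_opP q (fun s0 s1 _ _ => s0 * (cos alpha)%:C + s1 * (sin alpha)%:C = 0) u v a0.
split=> [/P[s0 [s1 [t0 [t1 [m bc]]]]]|[k [e m]]].
  have := robinI e1 e2 m bc; rewrite mul1r mul0r addr0 (sl_max_bval a0 m).2.
  by move=> m'; do 2 eexists; exact: m'.
apply/P; do 4 eexists; split; first exact: m.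
by rewrite /=; ring.
Qed.

Lemma robin_a_bval u v k d e : robin_a u v k d e -> bval a 0 (L2repr u) 0 = d.
Proof. by move=> /(sl_max_bval a0)[_ ->]; rewrite mul1r mul0r addr0. Qed.

Lemma op_Aring_bP u v : op_Aring_b beta q u v <->
  exists k e, robin_b u v k (bval 0 b (L2repr u) 0) e.
Proof.
have e1 := cos2Dsin2 beta.
have e2 : 1 ^+ 2 + 0 ^+ 2 = 1 :> R by rewrite expr1n expr0n addr0.
have P := sl_opP q (fun _ _ t0 t1 => t0 * (cos beta)%:C + t1 * (sin beta)%:C = 0) u v b0.
split=> [/P[s0 [s1 [t0 [t1 [m bc]]]]]|[k [e m]]].
  have := robinI (T := fun u v s0 s1 t0 t1 => @sl_max R 0 b r q u v t0 t1 s0 s1) e1 e2 m bc.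
  rewrite mul1r mul0r addr0 (sl_max_bval b0 m).1.
  by move=> m'; do 2 eexists; exact: m'.
apply/P; do 4 eexists; split; first exact: m.
by rewrite /=; ring.
Qed.

Lemma robin_b_bval u v k d e : robin_b u v k d e -> bval 0 b (L2repr u) 0 = d.
Proof. by move=> /(sl_max_bval b0)[-> _]; rewrite mul1r mul0r addr0. Qed.

Lemma op_A_aE : op_A_a a alpha q r = robin_op robin_a.
Proof.
apply/funext => u; apply/funext => v; apply/propext; split.
  by move=> [/op_Aring_aP[k [e m]] d0]; rewrite d0 in m; exists k, e.
move=> [k [e m]]; have d0 := robin_a_bval m; split=> //.
by apply/op_Aring_aP; exists k, e; rewrite d0.
Qed.

Lemma op_A_bE : op_A_b b beta q r = robin_op robin_b.
Proof.
apply/funext => u; apply/funext => v; apply/propext; split.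
  by move=> [/op_Aring_bP[k [e m]] d0]; rewrite d0 in m; exists k, e.
move=> [k [e m]]; have d0 := robin_b_bval m; split=> //.
by apply/op_Aring_bP; exists k, e; rewrite d0.
Qed.

Lemma op_calAE : op_calA a b alpha beta q r h = coupled robin_a neumann robin_b.
Proof.
apply/funext => U; apply/funext => V; apply/propext; split.
  move=> [/op_Aring_aP[ka [ea ma]] /op_BP mB /op_Aring_bP[kb [eb mb]] da db].
  rewrite da in ma; rewrite db in mb.
  by exists ka, ea; do 2 eexists; exists kb, eb; split; [exact: ma|exact: mB|exact: mb].
move=> [ka [ea [kB [eB [kb [eb [ma mB mb]]]]]]].
have [kE eE] := neumann_bval mB.
have da := robin_a_bval ma; have db := robin_b_bval mb.
split; rewrite ?da ?db ?kE ?eE//.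
- by apply/op_Aring_aP; exists ka, ea; rewrite da.
- by apply/op_BP; rewrite kE eE.
- by apply/op_Aring_bP; exists kb, eb; rewrite db.
Qed.

End Identification.

Theorem theorem2 (R : realType) (a b : R) (ha : a < 0) (hb : 0 < b)
    (alpha beta : R) (q r h : R -> R)
    (hq : Linfty a b q) (hr : Linfty a b r) (hh : Linfty (-1) 1 h)
    (hrpos : uniformly_positive a b r)
    (hhpos : uniformly_positive (-1) 1 h) :
  let A_a := op_A_a a alpha q r in
  let A_b := op_A_b b beta q r in
  let B := op_B h in
  let A := op_calA a b alpha beta q r h in
  let sA := spectrum (L2prod_norm a b r h) A in
  let sa := spectrum (L2norm r a 0) A_a in
  let sb := spectrum (L2norm r 0 b) A_b in
  let sB := spectrum (L2norm h (-1) 1) B in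
  let X := root_subspace A in
  let ker_pow (lam : R[i]) (k : nat) := op_ker (op_pow (op_sub A lam) k) in
  [/\ (* (i) *)
      [/\ real_spectrum (L2prod_norm a b r h) A,
          discrete_spectrum (L2prod_norm a b r h) A &
          sA = sa `|` sB `|` sb],
      (* (ii) *)
      forall lam : R[i],
        [\/ [/\ sa lam, ~ sB lam & ~ sb lam],
            [/\ ~ sa lam, sB lam & ~ sb lam] |
            [/\ ~ sa lam, ~ sB lam & sb lam]] ->
        eigenvalue_of_mult A lam 1%N,
      (* (iii) *)
      forall lam : R[i], sa lam -> sb lam -> ~ is_eigenvalue B lam ->
        eigenvalue_of_mult A lam 2%N /\ X lam = ker_pow lam 1%N &
      (* (iv) *)
      [/\ forall lam : R[i], sa lam -> sB lam -> ~ is_eigenvalue A_b lam ->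
            [/\ eigenvalue_of_mult A lam 2%N, X lam = ker_pow lam 2%N &
                X lam <> ker_pow lam 1%N],
          forall lam : R[i], sb lam -> sB lam -> ~ is_eigenvalue A_a lam ->
            [/\ eigenvalue_of_mult A lam 2%N, X lam = ker_pow lam 2%N &
                X lam <> ker_pow lam 1%N] &
          forall lam : R[i], sa lam -> sb lam -> sB lam ->
            [/\ eigenvalue_of_mult A lam 3%N, X lam = ker_pow lam 2%N &
                X lam <> ker_pow lam 1%N]]].
Proof.
have e1 := cos2Dsin2 alpha; have e2 := cos2Dsin2 beta.
have e10 : 1 ^+ 2 + 0 ^+ 2 = 1 :> R by rewrite expr1n expr0n addr0.
have e01 : 0 ^+ 2 + 1 ^+ 2 = 1 :> R by rewrite expr1n expr0n add0r.
have aa := lexx a; have bb := lexx b; have a0 := ltW ha; have b0 := ltW hb.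
have [cfa gsa] := sl_green ha (Linfty_sub aa b0 hr)
  (uniformly_positive_sub aa b0 hrpos) (Linfty_sub aa b0 hq).
have [cfb gsb] := sl_green hb (Linfty_sub a0 bb hr)
  (uniformly_positive_sub a0 bb hrpos) (Linfty_sub a0 bb hq).
have h0 : Linfty (-1) 1 (cst 0 : R -> R).
  by split=> //; exists 0; apply: aeW => x _ /=; rewrite normr0.
have lt11 : -1 < 1 :> R by rewrite gtrN.
have [cfB gsB] := sl_green lt11 hh hhpos h0.
have rsa := robin_system_green gsa e1 e10.
have rsB := robin_system_green gsB e01 e01.
have rsb := robin_system_green (gs_swap gsb) e2 e10.
(* Nonnegativity of the squared norms, available from the conjugation forms, allows the square of
   each square root to be removed. *)
have nE : L2prod_norm a b r h =
    fun U => Num.sqrt (@coupled_sqnorm R _ _ _ (@L2sqnorm R a 0 r)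
      (@L2sqnorm R (-1) 1 h) (@L2sqnorm R 0 b r) U).
  have n2 rho l s (cf : conj_form (@L2sqnorm R l s rho)) u :
      L2norm rho l s u ^+ 2 = L2sqnorm u by exact: (sqr_sqrtr (cf_norm_ge0 cf u)).
  apply/funext => U.
  exact: (congr1 Num.sqrt (congr2 +%R (congr2 +%R (n2 _ _ _ cfa U.1.1)
    (n2 _ _ _ cfB U.1.2)) (n2 _ _ _ cfb U.2))).
rewrite nE (op_A_aE _ _ _ ha) (op_A_bE _ _ _ hb) op_BE (op_calAE _ _ _ _ _ ha hb).
exact: (coupled_theorem rsa rsB rsb).
Qed.
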